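(* Let $F$ be a number field not containing a primitive cube root of unity $\zeta_3$. Let $S$ be a finite set of (finite) primes of $F$ for which $\mathrm{Cl}^S(F)/2=0$, where $\mathrm{Cl}^S(F)$ is the subgroup of $\mathrm{Cl}(\mathcal{O}_F)$ generated by the classes of the primes of $S$. Let $r(S)=|\{v\in S: |k_v|\equiv-1\pmod 3\}|$, where $k_v$ is the residue field at $v$. Then $$3\text{-rank}\left(H_3(\mathrm{SL}_2(\mathcal{O}_S),\mathbb{Z})\right)\ge 1+r(S).$$
   Context: For an abelian group $A$, $A/2=A\otimes\mathbb{Z}/2$, and the $3$-rank of $A$ means $\dim_{\mathbb{F}_3}\{a\in A:3a=0\}$. $\mathcal{O}_S=\{0\}\cup\{a\in F^\times: v(a)\ge0\text{ for all finite primes }v\notin S\}$ is the ring of $S$-integers. *)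

(* Defs.v *)
From HB Require Import structures.
From mathcomp Require Import all_boot all_order all_algebra all_field.
From mathcomp Require Import finmap boolp classical_sets functions cardinality.
From mathcomp Require Import freeg.

Set Implicit Arguments.
Unset Strict Implicit.
Unset Printing Implicit Defensive.

Import Order.TTheory GRing.Theory Num.Theory.
Local Open Scope ring_scope.

Record special_linear (n : nat) (R : comNzRingType) := SpecialLinear {
  sl_val :> 'M[R]_n;
  sl_det : \det sl_val == 1
}.

HB.instance Definition _ n R := [isSub for @sl_val n R].
HB.instance Definition _ n R := [Choice of special_linear n R by <:].

Section SpecialLinearGroup.
Variables (n : nat) (R : comNzRingType).
Implicit Types A B : special_linear n R.

Lemma sl_one_subproof : \det (1%:M : 'M[R]_n) == 1.
Proof. by rewrite det1. Qed.

Lemma sl_mul_subproof A B : \det (val A *m val B) == 1.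
Proof. by rewrite det_mulmx (eqP (sl_det A)) (eqP (sl_det B)) mulr1. Qed.

Lemma sl_inv_subproof A : \det (\adj (val A)) == 1.
Proof.
have := congr1 determinant (mul_mx_adj (val A)).
by rewrite det_mulmx (eqP (sl_det A)) det1 mul1r => ->.
Qed.

Definition sl_one := SpecialLinear sl_one_subproof.
Definition sl_mul A B := SpecialLinear (sl_mul_subproof A B).
Definition sl_inv A := SpecialLinear (sl_inv_subproof A).

Lemma sl_mulA : associative sl_mul.
Proof. by move=> A B C; apply: val_inj; rewrite /= mulmxA. Qed.
Lemma sl_mul1 : left_id sl_one sl_mul.
Proof. by move=> A; apply: val_inj; rewrite /= mul1mx. Qed.
Lemma sl_1mul : right_id sl_one sl_mul.
Proof. by move=> A; apply: val_inj; rewrite /= mulmx1. Qed.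
Lemma sl_mulV : left_inverse sl_one sl_inv sl_mul.
Proof.
by move=> A; apply: val_inj; rewrite /= mul_adj_mx (eqP (sl_det A)).
Qed.
Lemma sl_Vmul : right_inverse sl_one sl_inv sl_mul.
Proof.
by move=> A; apply: val_inj; rewrite /= mul_mx_adj (eqP (sl_det A)).
Qed.

HB.instance Definition _ := isGroup.Build (special_linear n R)
  sl_mulA sl_mul1 sl_1mul sl_mulV sl_Vmul.

End SpecialLinearGroup.

(* Integral homology, by the inhomogeneous bar complex. *)
Section GroupHomology.
Variable G : groupType.

Definition bar_chain (n : nat) : zmodType := {freeg {ffun 'I_n -> G} / int}.

(* Writing g = [g_0 | ... | g_n], the 0-th face drops g_0, the (n+1)-st drops *)
(* g_n, and the i-th one for 0 < i <= n multiplies g_(i-1) and g_i.           *)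
Definition bar_face (n : nat) (i : 'I_n.+2) (g : {ffun 'I_n.+1 -> G}) :
    {ffun 'I_n -> G} :=
  [ffun j : 'I_n =>
     let gj := g (widen_ord (leqnSn n) j) in
     let gSj := g (fintype.lift ord0 j) in
     if (j.+1 < i)%N then gj
     else if j.+1 == i :> nat then (gj * gSj)%g else gSj].

Definition bar_diff (n : nat) (c : bar_chain n.+1) : bar_chain n :=
  fglift (fun g : {ffun 'I_n.+1 -> G} =>
    \sum_(i < n.+2) << (-1) ^+ i *g bar_face i g >>) c.

Definition bar_cycle (n : nat) : pred (bar_chain n) :=
  if n is m.+1 return pred (bar_chain n) then fun c => bar_diff c == 0
  else predT.

Lemma bar_diffB n : {morph @bar_diff n : x y / x - y}.
Proof. exact: lift_is_additive. Qed.

Lemma bar_diff0 n : @bar_diff n 0 = 0.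
Proof. by rewrite -[X in bar_diff X](subrr 0) bar_diffB subrr. Qed.

Lemma bar_cycle_closed n : zmod_closed (@bar_cycle n).
Proof.
case: n => [|n]; split=> //; first by rewrite unfold_in /= bar_diff0.
move=> x y; rewrite !unfold_in /= => /eqP dx /eqP dy.
by rewrite bar_diffB dx dy subrr.
Qed.

HB.instance Definition _ n :=
  GRing.isZmodClosed.Build (bar_chain n) (@bar_cycle n) (bar_cycle_closed n).

Record bar_cycles (n : nat) := BarCycle {
  cycle_val :> bar_chain n;
  cycleP : cycle_val \in @bar_cycle n
}.

HB.instance Definition _ n := [isSub for @cycle_val n].
HB.instance Definition _ n := [Choice of bar_cycles n by <:].
HB.instance Definition _ n := [SubChoice_isSubZmodule of bar_cycles n by <:].

Definition bar_boundary (n : nat) : pred (bar_cycles n) :=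
  fun z => `[< exists c : bar_chain n.+1, val z = bar_diff c >].

Lemma bar_boundary_closed n : zmod_closed (@bar_boundary n).
Proof.
split; first by apply/asboolP; exists 0; rewrite bar_diff0.
move=> x y /asboolP[c dc] /asboolP[e de]; apply/asboolP; exists (c - e).
by rewrite bar_diffB raddfB /= dc de.
Qed.

HB.instance Definition _ n := GRing.isZmodClosed.Build
  (bar_cycles n) (@bar_boundary n) (bar_boundary_closed n).

Definition group_homology (n : nat) : zmodType :=
  {ideal_quot (GRing.ZmodClosed.clone _ (@bar_boundary n) _)}.

End GroupHomology.

Section Mod2.
Variable A : zmodType.

Definition doubles : pred A := fun a => `[< exists b : A, a = b *+ 2 >].

Lemma doubles_closed : zmod_closed doubles.
Proof.
split; first by apply/asboolP; exists 0; rewrite mul0rn.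
move=> x y /asboolP[b ->] /asboolP[c ->]; apply/asboolP.
by exists (b - c); rewrite mulrnBl.
Qed.

HB.instance Definition _ := GRing.isZmodClosed.Build A doubles doubles_closed.

(* A (x) Z/2, as the quotient A / 2A *)
Definition mod2 : zmodType :=
  {ideal_quot (GRing.ZmodClosed.clone _ doubles _)}.

End Mod2.

Section GeneratedSubgroup.
Variables (A : zmodType) (X : set A).

Definition in_span : pred A :=
  fun a => `[< smallest (fun H : set A => zmod_closed (mem H)) X a >].

Lemma in_span_closed : zmod_closed in_span.
Proof.
split; first by apply/asboolP => H [[H0 _] _]; rewrite inE in H0.
move=> x y /asboolP xX /asboolP yX; apply/asboolP => H HX.
have := HX.1.2 x y; rewrite !inE; apply; [exact: xX|exact: yX].
Qed.

HB.instance Definition _ := GRing.isZmodClosed.Build A in_span in_span_closed.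

Record generated_subgroup := GeneratedSubgroup {
  gen_val :> A;
  genP : gen_val \in in_span
}.

HB.instance Definition _ := [isSub for gen_val].
HB.instance Definition _ := [Choice of generated_subgroup by <:].
HB.instance Definition _ := [SubChoice_isSubZmodule of generated_subgroup by <:].

End GeneratedSubgroup.

Section Torsion3.
Variable A : zmodType.

Definition killed_by_3 : pred A := fun a => a *+ 3 == 0.

Lemma killed_by_3_closed : zmod_closed killed_by_3.
Proof.
split; first by rewrite unfold_in mul0rn.
move=> x y; rewrite !unfold_in /killed_by_3 => /eqP x3 /eqP y3.
by rewrite mulrnBl x3 y3 subrr.
Qed.

HB.instance Definition _ :=
  GRing.isZmodClosed.Build A killed_by_3 killed_by_3_closed.

Record torsion3 := Torsion3 {
  tors_val :> A;
  torsP : tors_val \in killed_by_3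
}.

HB.instance Definition _ := [isSub for tors_val].
HB.instance Definition _ := [Choice of torsion3 by <:].
HB.instance Definition _ := [SubChoice_isSubZmodule of torsion3 by <:].

Lemma torsion3_mulr3n (a : torsion3) : a *+ 3 = 0.
Proof. by apply: val_inj; rewrite raddfMn /=; apply/eqP/torsP. Qed.

Lemma torsion3_modn (a : torsion3) n : a *+ (n %% 3) = a *+ n.
Proof.
by rewrite {2}(divn_eq n 3) mulrnDr mulnC mulrnA torsion3_mulr3n mul0rn add0r.
Qed.

Definition torsion3_scale (k : 'F_3) (a : torsion3) : torsion3 := a *+ (k : nat).

Lemma torsion3_scaleA k l a :
  torsion3_scale k (torsion3_scale l a) = torsion3_scale (k * l) a.
Proof.
rewrite /torsion3_scale -mulrnA -[LHS]torsion3_modn mulnC; congr (_ *+ _).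
Qed.
Lemma torsion3_scale1 : left_id 1 torsion3_scale.
Proof. by []. Qed.
Lemma torsion3_scaleDr : right_distributive torsion3_scale +%R.
Proof. by move=> k a b; rewrite /torsion3_scale mulrnDl. Qed.
Lemma torsion3_scaleDl a : {morph torsion3_scale^~ a : k l / k + l}.
Proof. by move=> k l; rewrite /torsion3_scale -mulrnDr -[RHS]torsion3_modn. Qed.

HB.instance Definition _ := GRing.Zmodule_isLmodule.Build 'F_3 torsion3
  torsion3_scaleA torsion3_scale1 torsion3_scaleDr torsion3_scaleDl.

End Torsion3.

Section Dimension.
Variables (K : fieldType) (V : lmodType K).

Definition lin_indep (B : set V) : Prop :=
  forall (n : nat) (b : 'I_n -> V) (c : 'I_n -> K),
    injective b -> (forall i, B (b i)) ->
    \sum_(i < n) c i *: b i = 0 -> forall i, c i = 0.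

Definition spanning (B : set V) : Prop :=
  forall x : V, exists (n : nat) (b : 'I_n -> V) (c : 'I_n -> K),
    (forall i, B (b i)) /\ x = \sum_(i < n) c i *: b i.

Definition is_basis (B : set V) : Prop := lin_indep B /\ spanning B.

(* n <= dim V, where dim V, possibly infinite, is the cardinality of a basis  *)
Definition dim_ge (n : nat) : Prop :=
  exists B : set V, is_basis B /\ (`I_n #<= B)%card.

End Dimension.

Definition rank3_ge (A : zmodType) (n : nat) : Prop := dim_ge (torsion3 A) n.

(* A finite prime is represented by its normalized discrete valuation. Over a *)
(* number field these correspond bijectively to the nonzero primes of O_F by  *)
(* v |-> prime_ideal v (defined below). The value at 0 is a dummy, fixed so   *)
(* that equality of records is equality of primes.                            *)
Record finite_prime (F : fieldExtType rat) := FinitePrime {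
  nu :> F -> int;
  nu0 : nu 0 = 0;
  nuM : forall x y, x != 0 -> y != 0 -> nu (x * y) = nu x + nu y;
  nuD : forall x y, x != 0 -> y != 0 -> x + y != 0 ->
    Num.min (nu x) (nu y) <= nu (x + y);
  nu_normalized : exists2 x, x != 0 & nu x = 1
}.

HB.instance Definition _ F := gen_eqMixin (finite_prime F).
HB.instance Definition _ F := gen_choiceMixin (finite_prime F).

Section Valuation.
Variables (F : fieldExtType rat) (v : finite_prime F).

Lemma nu1 : v 1 = 0.
Proof.
have := nuM v (oner_neq0 F) (oner_neq0 F); rewrite mulr1 => /eqP.
by rewrite -subr_eq0 opprD addNKr oppr_eq0 => /eqP.
Qed.

Lemma nuN x : v (- x) = v x.
Proof.
have [->|x0] := eqVneq x 0; first by rewrite oppr0.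
have N10 : (-1 : F) != 0 by rewrite oppr_eq0 oner_neq0.
have := nuM v N10 N10; rewrite mulrNN mulr1 nu1 => /esym/eqP.
rewrite -mulr2n mulrn_eq0 /= => /eqP vN1.
by rewrite -mulN1r nuM // vN1 add0r.
Qed.

End Valuation.

Section SIntegers.
Variables (F : fieldExtType rat) (S : set (finite_prime F)).

Definition S_integral : pred F :=
  fun a => `[< a = 0 \/ (a != 0 /\ forall v, ~ S v -> 0 <= v a) >].

Lemma S_integral_subproof : subring_closed S_integral.
Proof.
split=> [|x y|x y].
- by apply/asboolP; right; rewrite oner_neq0; split=> // v _; rewrite nu1.
- move=> /asboolP[->|[x0 vx]] /asboolP[->|[y0 vy]]; apply/asboolP.
  + by left; rewrite subrr.
  + by right; rewrite sub0r oppr_eq0; split=> // v /vy; rewrite nuN.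
  + by right; rewrite subr0.
  + have [->|xy0] := eqVneq (x - y) 0; first by left.
    right; split=> // v Sv; have Ny0 : - y != 0 by rewrite oppr_eq0.
    apply: le_trans (nuD v x0 Ny0 xy0).
    by rewrite le_min nuN vx // vy.
- move=> /asboolP[->|[x0 vx]] /asboolP[->|[y0 vy]]; apply/asboolP;
    rewrite ?mul0r ?mulr0; try by left.
  right; rewrite mulf_neq0 //; split=> // v Sv.
  by rewrite nuM // addr_ge0 ?vx ?vy.
Qed.

HB.instance Definition _ :=
  GRing.isSubringClosed.Build F S_integral S_integral_subproof.

Record S_integers := SInteger {
  sint_val :> F;
  sintP : sint_val \in S_integral
}.

HB.instance Definition _ := [isSub for sint_val].
HB.instance Definition _ := [Choice of S_integers by <:].
HB.instance Definition _ := [SubChoice_isSubComNzRing of S_integers by <:].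

End SIntegers.

Section ResidueField.
Variables (F : fieldExtType rat) (v : finite_prime F).

Definition in_valuation_ring : pred F := fun a => (a == 0) || (0 <= v a).

Lemma in_valuation_ring_subproof : subring_closed in_valuation_ring.
Proof.
split=> [|x y|x y]; rewrite !unfold_in /in_valuation_ring.
- by rewrite nu1 lexx orbT.
- have [->|x0] := eqVneq x 0; first by rewrite sub0r nuN oppr_eq0.
  have [->|y0] /= := eqVneq y 0; first by rewrite subr0 (negPf x0).
  move=> vx vy; have [//|xy0] /= := eqVneq (x - y) 0.
  have Ny0 : - y != 0 by rewrite oppr_eq0.
  by apply: le_trans (nuD v x0 Ny0 xy0); rewrite le_min nuN vx.
- have [->|x0] := eqVneq x 0; first by rewrite mul0r eqxx.
  have [->|y0] /= := eqVneq y 0; first by rewrite mulr0 eqxx.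
  by move=> vx vy; rewrite nuM // addr_ge0 ?orbT.
Qed.

HB.instance Definition _ :=
  GRing.isSubringClosed.Build F in_valuation_ring in_valuation_ring_subproof.

Record valuation_ring := ValuationRing {
  vring_val :> F;
  vringP : vring_val \in in_valuation_ring
}.

HB.instance Definition _ := [isSub for vring_val].
HB.instance Definition _ := [Choice of valuation_ring by <:].
HB.instance Definition _ := [SubChoice_isSubComNzRing of valuation_ring by <:].

Definition valuation_ideal : pred valuation_ring :=
  fun a => (val a == 0) || (0 < v (val a)).

Lemma valuation_ideal_subproof : idealr_closed valuation_ideal.
Proof.
split; rewrite ?unfold_in /valuation_ideal.
- by rewrite raddf0 eqxx.
- by rewrite rmorph1 (negPf (oner_neq0 F)) nu1 ltxx.
move=> a x y; rewrite !unfold_in /valuation_ideal rmorphD rmorphM /=.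
have := vringP a; rewrite unfold_in /in_valuation_ring.
have vax : (val a == 0) || (0 <= v (val a)) ->
    (val x == 0) || (0 < v (val x)) ->
    (val a * val x == 0) || (0 < v (val a * val x)).
  have [->|a0] := eqVneq (val a) 0; first by rewrite mul0r eqxx.
  have [->|x0] /= := eqVneq (val x) 0; first by rewrite mulr0 eqxx.
  by move=> va vx; rewrite nuM // ltr_wpDl ?orbT.
move=> /vax/[apply]; move: (val a * val x) (val y) => {vax}z w.
have [->|z0] := eqVneq z 0; first by rewrite add0r.
have [->|w0] /= := eqVneq w 0; first by rewrite addr0 (negPf z0).
move=> vz vw; have [//|zw0] /= := eqVneq (z + w) 0.
by apply: lt_le_trans (nuD v z0 w0 zw0); rewrite lt_min vz.
Qed.

HB.instance Definition _ :=
  isIdealr.Build valuation_ring valuation_ideal valuation_ideal_subproof.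

Definition residue_field : comNzRingType :=
  {ideal_quot (Idealr.clone _ valuation_ideal _)}.

(* k_v is finite over a number field; fset_set is the empty set on infinite   *)
(* sets.                                                                      *)
Definition residue_card : nat := #|` fset_set [set: residue_field] |.

End ResidueField.

Definition r_of (F : fieldExtType rat) (S : set (finite_prime F)) : nat :=
  #|` fset_set [set v | S v /\ (residue_card v = -1 %[mod 3])%Z] |.

Section ClassGroup.
Variable F : fieldExtType rat.

Local Open Scope classical_set_scope.

Definition ring_of_integers : set F :=
  [set x | integralOver (intr : int -> F) x].
Local Notation O := ring_of_integers.

Definition O_submodule (I : set F) : Prop :=
  [/\ I 0, (forall x y, I x -> I y -> I (x + y))
    & (forall a x, O a -> I x -> I (a * x))].

Definition ideal_prod (I J : set F) : set F :=
  [set x | exists2 s : seq (F * F),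
     (forall p, p \in s -> I p.1 /\ J p.2) & x = \sum_(p <- s) p.1 * p.2].

(* Invertible fractional ideals of O_F. As O_F is a Dedekind domain, these    *)
(* are all the nonzero fractional ideals.                                     *)
Record fractional_ideal := FractionalIdeal {
  fi_val :> set F;
  fi_submodule : O_submodule fi_val;
  fi_invertible : exists2 J, O_submodule J & ideal_prod fi_val J = O
}.

HB.instance Definition _ := gen_eqMixin fractional_ideal.
HB.instance Definition _ := gen_choiceMixin fractional_ideal.

Lemma fi_inj (I J : fractional_ideal) : fi_val I = fi_val J -> I = J.
Proof.
case: I J => [I sI iI] [J sJ iJ] /= eIJ; subst J.
by rewrite (Prop_irrelevance sI sJ) (Prop_irrelevance iI iJ).
Qed.

Lemma O_add x y : O x -> O y -> O (x + y). Proof. exact: integral_add. Qed.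
Lemma O_mul x y : O x -> O y -> O (x * y). Proof. exact: integral_mul. Qed.
Lemma O_1 : O 1. Proof. exact: integral1. Qed.
Lemma O_submodule_O : O_submodule O.
Proof. by split; [exact: integral0|exact: O_add|exact: O_mul]. Qed.

Lemma ideal_prod_mem I J x y : I x -> J y -> ideal_prod I J (x * y).
Proof.
move=> Ix Jy; exists [:: (x, y)]; last by rewrite big_seq1.
by move=> p; rewrite inE => /eqP->.
Qed.

Lemma ideal_prod_min (I J K : set F) : O_submodule K ->
  (forall x y, I x -> J y -> K (x * y)) -> ideal_prod I J `<=` K.
Proof.
move=> [K0 KD _] KIJ _ [s sIJ ->]; elim: s sIJ => [|p s IHs] sIJ.
  by rewrite big_nil.
rewrite big_cons; apply: KD.
  by have [Ip Jp] := sIJ p (mem_head _ _); apply: KIJ.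
by apply: IHs => q qs; apply: sIJ; rewrite inE qs orbT.
Qed.

Lemma ideal_prod_submodule I J : O_submodule I -> O_submodule (ideal_prod I J).
Proof.
move=> [_ _ IM]; split.
- by exists [::]; rewrite ?big_nil.
- move=> _ _ [s sIJ ->] [t tIJ ->]; exists (s ++ t); last by rewrite big_cat.
  by move=> p; rewrite mem_cat => /orP[/sIJ|/tIJ].
- move=> a _ Oa [s sIJ ->]; exists [seq (a * p.1, p.2) | p <- s].
    by move=> _ /mapP[p /sIJ[Ip Jp] ->]; split=> //=; apply: IM.
  by rewrite big_map mulr_sumr; apply: eq_bigr => p _; rewrite mulrA.
Qed.

Lemma ideal_prodC : commutative ideal_prod.
Proof.
have sub I J : ideal_prod I J `<=` ideal_prod J I.
  move=> _ [s sIJ ->]; exists [seq (p.2, p.1) | p <- s].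
    by move=> _ /mapP[p /sIJ[Ip Jp] ->].
  by rewrite big_map; apply: eq_bigr => p _; rewrite mulrC.
by move=> I J; apply/seteqP; split; apply: sub.
Qed.

Lemma ideal_prodA I J K : O_submodule I -> O_submodule J -> O_submodule K ->
  ideal_prod I (ideal_prod J K) = ideal_prod (ideal_prod I J) K.
Proof.
have sub I' J' K' : O_submodule I' ->
    ideal_prod I' (ideal_prod J' K') `<=` ideal_prod (ideal_prod I' J') K'.
  move=> mI; apply: ideal_prod_min.
    exact/ideal_prod_submodule/ideal_prod_submodule.
  move=> x _ Ix [s sJK ->]; exists [seq (x * p.1, p.2) | p <- s].
    move=> _ /mapP[p /sJK[Jp Kp] ->]; split=> //=.
    exact: ideal_prod_mem.
  by rewrite big_map mulr_sumr; apply: eq_bigr => p _; rewrite mulrA.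
move=> mI mJ mK; apply/seteqP; split; first exact: sub.
rewrite (ideal_prodC _ K) (ideal_prodC I J).
rewrite (ideal_prodC I (ideal_prod J K)) (ideal_prodC J K).
exact: sub.
Qed.

Lemma ideal_prod1 I : O_submodule I -> ideal_prod O I = I.
Proof.
move=> mI; apply/seteqP; split; first by apply: ideal_prod_min => //; case: mI.
by move=> x Ix; rewrite -[x]mul1r; apply: ideal_prod_mem => //; apply: O_1.
Qed.

Definition ideal_colon (I : set F) : set F :=
  [set x | forall y, I y -> O (x * y)].

Lemma ideal_colon_submodule I : O_submodule (ideal_colon I).
Proof.
split=> [y _|x y Ix Iy z Iz|a x Oa Ix y Iy].
- by rewrite mul0r; case: O_submodule_O.
- by rewrite mulrDl; apply: O_add; [apply: Ix|apply: Iy].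
- by rewrite -mulrA; apply: O_mul => //; apply: Ix.
Qed.

Lemma ideal_prodV (I : fractional_ideal) : ideal_prod (ideal_colon I) I = O.
Proof.
have [J mJ IJ] := fi_invertible I.
apply/seteqP; split.
  by apply: ideal_prod_min O_submodule_O _ => x y cx Iy; apply: cx.
rewrite -{1}IJ ideal_prodC => _ [s sJI ->]; exists s => // p /sJI[Jp Ip].
split=> // y Iy; rewrite -IJ mulrC; exact: ideal_prod_mem.
Qed.

Lemma fi_one_subproof : exists2 J, O_submodule J & ideal_prod O J = O.
Proof. exists O; [|apply: ideal_prod1]; exact: O_submodule_O. Qed.

Lemma fi_mul_subproof (I J : fractional_ideal) :
  exists2 K, O_submodule K & ideal_prod (ideal_prod I J) K = O.
Proof.
have [mI mJ] := (fi_submodule I, fi_submodule J).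
have [cI cJ] := (ideal_colon_submodule I, ideal_colon_submodule J).
exists (ideal_prod (ideal_colon J) (ideal_colon I)).
  exact: ideal_prod_submodule.
rewrite ideal_prodA //; last exact: ideal_prod_submodule.
rewrite -(ideal_prodA mI mJ cJ) (ideal_prodC J) ideal_prodV.
by rewrite (ideal_prodC I) ideal_prod1 // ideal_prodC ideal_prodV.
Qed.

Lemma fi_inv_subproof (I : fractional_ideal) :
  exists2 J, O_submodule J & ideal_prod (ideal_colon I) J = O.
Proof. by exists I; [exact: fi_submodule|exact: ideal_prodV]. Qed.

Definition fi_one := FractionalIdeal O_submodule_O fi_one_subproof.
Definition fi_mul (I J : fractional_ideal) := FractionalIdeal
  (ideal_prod_submodule _ (fi_submodule I)) (fi_mul_subproof I J).
Definition fi_inv (I : fractional_ideal) :=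
  FractionalIdeal (ideal_colon_submodule I) (fi_inv_subproof I).

Lemma fi_mulA : associative fi_mul.
Proof.
by move=> I J K; apply: fi_inj; apply: ideal_prodA; apply: fi_submodule.
Qed.
Lemma fi_mulC : commutative fi_mul.
Proof. by move=> I J; apply: fi_inj; apply: ideal_prodC. Qed.
Lemma fi_mul1 : left_id fi_one fi_mul.
Proof. by move=> I; apply: fi_inj; apply/ideal_prod1/fi_submodule. Qed.
Lemma fi_mulV : left_inverse fi_one fi_inv fi_mul.
Proof. by move=> I; apply: fi_inj; apply: ideal_prodV. Qed.

(* The group of fractional ideals is written additively: I + J is the product *)
(* of I and J, and 0 is O_F.                                                  *)
HB.instance Definition _ := GRing.isZmodule.Build fractional_ideal
  fi_mulA fi_mulC fi_mul1 fi_mulV.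

Definition principal : pred fractional_ideal :=
  fun I => `[< exists2 x : F, x != 0 & fi_val I = [set x * a | a in O] >].

Lemma principal_closed : zmod_closed principal.
Proof.
split.
  apply/asboolP; exists 1; first exact: oner_neq0.
  apply/seteqP; split=> [x Ox|_ [x Ox <-]]; last by rewrite mul1r.
  by exists x; rewrite ?mul1r.
move=> I J /asboolP[x x0 Ix] /asboolP[y y0 Jy]; apply/asboolP.
exists (x / y); first by rewrite mulf_neq0 ?invr_eq0.
change (ideal_prod I (ideal_colon J) = [set x / y * a | a in O]).
have Jy1 : fi_val J y by rewrite Jy; exists 1; [exact: O_1|rewrite mulr1].
have cJ z : ideal_colon J z <-> exists2 a, O a & z = y^-1 * a.
  split=> [Jz|[a Oa ->] w].
    exists (z * y); first exact: Jz.
    by rewrite mulrC mulfK.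
  rewrite Jy => -[b Ob <-].
  by rewrite mulrACA mulVf // mul1r; apply: O_mul.
apply/seteqP; split.
  move=> _ [s sIJ ->]; elim: s sIJ => [|p s IHs] sIJ.
    by rewrite big_nil; exists 0; [case: O_submodule_O|rewrite mulr0].
  rewrite big_cons.
  have [a Oa <-] : [set x / y * a | a in O] (\sum_(p <- s) p.1 * p.2).
    by apply: IHs => q qs; apply: sIJ; rewrite inE qs orbT.
  have [+ /cJ[c Oc ->]] := sIJ p (mem_head _ _).
  rewrite Ix => -[b Ob <-]; exists (b * c + a).
    by apply: O_add => //; apply: O_mul.
  by rewrite mulrDr mulrACA.
move=> _ [a Oa <-]; rewrite -mulrA; apply: ideal_prod_mem.
  by rewrite Ix; exists 1; [exact: O_1|rewrite mulr1].
by apply/cJ; exists a.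
Qed.

HB.instance Definition _ :=
  GRing.isZmodClosed.Build fractional_ideal principal principal_closed.

Definition class_group : zmodType :=
  {ideal_quot (GRing.ZmodClosed.clone _ principal _)}.

Definition prime_ideal (v : finite_prime F) : set F :=
  [set a | O a /\ (a = 0 \/ (a != 0 /\ 0 < v a))].

(* Cl^S(F) *)
Definition class_group_S (S : set (finite_prime F)) : zmodType :=
  generated_subgroup [set c : class_group |
    exists v (I : fractional_ideal),
      [/\ S v, fi_val I = prime_ideal v & c = \pi_class_group%qT I]].

End ClassGroup.

(* Main.v *)
Require Import Defs.
From HB Require Import structures.
From mathcomp Require Import all_boot all_order all_algebra all_field.
From mathcomp Require Import finmap boolp classical_sets functions cardinality fsbigop.
From mathcomp Require Import freeg ring zify cyclic.

(** For a unit [t] of the ring of S-integers, conjugating the matrix (0 -1; 1 -1),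
    which has order three, by the diagonal matrix with entries [t] and 1 gives a
    matrix [tri] over that ring. A generator of the third homology of the cyclic
    group of order three maps to a class [order3_class], killed by 3, in the third
    homology of SL_2. The classes obtained from [t = 1] and from one unit [t_v] for
    each prime [v] of S that is inert, in the sense that its residue field has
    order -1 modulo 3, are linearly independent over the field with three
    elements.

    The unit [t_v] has odd valuation at [v] and valuation 0 at every other prime
    ([prescribed_valuation]). It exists because the subgroup of the class group
    generated by S is 2-divisible and finitely generated, hence of odd exponent
    ([odd_exponent]): an odd power of the prime of [v] is principal.

    The classes are separated by explicit cocycles with values in a finite cyclic
    group of order N divisible by 3, all obtained in the same way. Let a group act
    on a set, with a logarithm of a factor of automorphy that vanishes at almost
    all points. The generator of the third cohomology of the cyclic group can be
    transferred along this action, and the resulting functional takes on the class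
    of an element [g] of order three the value N/3 times the number of fixed points
    of [g] with nontrivial factor, the points that [g] moves cancelling in threes
    ([transfer_value], [transfer_functional]).

    One set is the projective line over a finite field [E] that receives the ring
    of S-integers and contains a primitive cube root of unity. Every element of
    order three fixes two points, so that this functional does not vanish on the
    class of [tri 1] ([finite_field_detect]).

    The other set is attached to an inert prime [v]. Let [k] be its residue field
    and [E] a finite extension containing a primitive cube root of unity; the root
    is not in [k]. The points are the vertices of the tree of SL_2 at [v], each
    decorated with an element of [E] outside [k]; only the vertices in the orbit of
    the standard one are used. Having no eigenvector over [k], the matrix [tri t]
    fixes a single vertex of the tree, which is in this orbit exactly when the
    valuation of [t] is even. There it fixes two decorations, its eigenlines over
    [E]. So the functional vanishes on the class of [tri t] if [v t] is odd, and
    not if [v t] is even ([tree_functional], [inert_functional]).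

    Twisting the functional of [v] by the diagonal matrix with entries [t_v] and 1
    replaces [t] by [t / t_v]. The twisted functional does not vanish on the class
    of [t_v], but it vanishes on the classes of 1 and of the other [t_w]. In a
    linear relation all coefficients therefore vanish except possibly that of
    [t = 1], and the first functional takes care of this one.

    As finite primes are normalised valuations, the arithmetic starts from the
    finiteness of [R / m R] for every subring [R] of the number field
    ([quotient_finite]). By the pigeonhole principle the ring of integers is then
    completely integrally closed ([O_completely_closed]), which makes its maximal
    ideals invertible ([maximal_ideal_inverse], [maximal_invertible]) and puts them
    in correspondence with the valuations ([maximal_ideal_valuation],
    [prime_ideal_maximal], [prime_ideal_inj]). *)

Set Implicit Arguments.
Unset Strict Implicit.
Unset Printing Implicit Defensive.

Import Order.TTheory GRing.Theory Num.Theory.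
Local Open Scope ring_scope.

(** * Cochains on the bar complex *)

HB.instance Definition _ (G : groupType) (n : nat) :=
  GRing.isZmodMorphism.Build (bar_chain G n.+1) (bar_chain G n)
    (@bar_diff G n) (@bar_diffB G n).

Section BarEvaluation.
Variables (G : groupType) (A : zmodType) (n : nat).

Definition bar_eval (f : {ffun 'I_n -> G} -> A) (c : bar_chain G n) : A :=
  fglift (f : _ -> zmodule A) c.

Variable f : {ffun 'I_n -> G} -> A.

Lemma bar_evalB : {morph bar_eval f : x y / x - y}.
Proof. exact: (@lift_is_additive _ _ (zmodule A)). Qed.

HB.instance Definition _ :=
  GRing.isZmodMorphism.Build (bar_chain G n) A (bar_eval f) bar_evalB.

Lemma bar_evalU k x : bar_eval f << k *g x >> = f x *~ k.
Proof. by rewrite /bar_eval liftU. Qed.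

End BarEvaluation.

Lemma bar_diffU (G : groupType) (n : nat) (g : {ffun 'I_n.+1 -> G}) :
  bar_diff (<< g >> : bar_chain G n.+1) =
  \sum_(i < n.+2) (<< (-1) ^+ i *g bar_face i g >> : bar_chain G n).
Proof. by rewrite /bar_diff liftU scale1r. Qed.

(** It is enough to check a cocycle condition on bar words. *)
Lemma bar_eval_diff (G : groupType) (A : zmodType) (n : nat)
    (f : {ffun 'I_n -> G} -> A) :
  (forall g, \sum_(i < n.+2) f (bar_face i g) *~ (-1) ^+ i = 0) ->
  forall c : bar_chain G n.+1, bar_eval f (bar_diff c) = 0.
Proof.
move=> f0 c; rewrite -[c]freeg_sumE !raddf_sum big1 // => g _.
have -> : << coeff g c *g g >> = (<< g >> : bar_chain G n.+1) *~ coeff g c.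
  by rewrite freegU_mulz intz.
rewrite !raddfMz /= bar_diffU raddf_sum.
rewrite (eq_bigr (fun i : 'I_n.+2 => f (bar_face i g) *~ (-1) ^+ i)).
  by rewrite f0 mul0rz.
by move=> i _; rewrite [LHS]bar_evalU.
Qed.

(** * The 3-torsion classes carried by elements of order three *)

Lemma quot_eq0 (V : zmodType) (I : zmodClosed V) (x : V) :
  (\pi_({ideal_quot I})%qT x == 0) = (x \in I).
Proof.
by rewrite -[0](raddf0 (\pi_({ideal_quot I})%qT)) -Quotient.idealrBE subr0.
Qed.

Section CyclicClass.
Variable G : groupType.
Local Open Scope group_scope.

Definition word2 (a b : G) : {ffun 'I_2 -> G} :=
  [ffun i : 'I_2 => nth 1 [:: a; b] i].
Definition word3 (a b c : G) : {ffun 'I_3 -> G} :=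
  [ffun i : 'I_3 => nth 1 [:: a; b; c] i].
Definition word4 (a b c d : G) : {ffun 'I_4 -> G} :=
  [ffun i : 'I_4 => nth 1 [:: a; b; c; d] i].
Lemma bar_diff_word3 a b c :
  bar_diff (<< word3 a b c >> : bar_chain G 3) =
  (<< word2 b c >> - << word2 (a * b) c >> + << word2 a (b * c) >>
   - << word2 a b >> : bar_chain G 2)%R.
Proof.
rewrite bar_diffU !big_ord_recl big_ord0 addr0 !addrA /= -!freegUN.
by congr (_ + _ + _ + _)%R; [|congr (- _)%R| |congr (- _)%R];
  congr (Freeg [:: (_, _)]); apply/ffunP => -[[|[|[]]] //= k];
  rewrite !ffunE.
Qed.

Lemma bar_diff_word4 a b c d :
  bar_diff (<< word4 a b c d >> : bar_chain G 4) =
  (<< word3 b c d >> - << word3 (a * b) c d >> + << word3 a (b * c) d >>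
   - << word3 a b (c * d) >> + << word3 a b c >> : bar_chain G 3)%R.
Proof.
rewrite bar_diffU !big_ord_recl big_ord0 addr0 !addrA /= -!freegUN.
by congr (_ + _ + _ + _ + _)%R; [|congr (- _)%R| |congr (- _)%R|];
  congr (Freeg [:: (_, _)]); apply/ffunP => -[[|[|[|[]]]] //= k];
  rewrite !ffunE.
Qed.

Variable g : G.
Hypothesis g3 : g * (g * g) = 1.

(** The standard 3-cycle of a cyclic group of order three is the case [h = g];
    letting the last entry vary makes the sum additive in [h] up to
    boundaries, hence killed by 3. *)
Definition orbit_chain (h : G) : bar_chain G 3 :=
  (<< word3 g 1 h >> + << word3 g g h >> + << word3 g (g * g) h >>)%R.

Definition orbit_chain4 (h k : G) : bar_chain G 4 :=
  (<< word4 g 1 h k >> + << word4 g g h k >> + << word4 g (g * g) h k >>)%R.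

Lemma bar_diff_orbit_chain : bar_diff (orbit_chain g) = 0%R.
Proof.
rewrite /orbit_chain !raddfD /= !bar_diff_word3 !mulg1 !mul1g g3 -mulgA g3.
by apply/eqP/freeg_eqP => w; rewrite !(coeffB, coeffD, coeff0); ring.
Qed.

Lemma bar_diff_orbit_chain4 h k :
  bar_diff (orbit_chain4 h k) =
  (<< word3 g h k >> + << word3 g (g * h) k >> + << word3 g (g * g * h) k >>
   - orbit_chain (h * k) + orbit_chain h : bar_chain G 3)%R.
Proof.
rewrite /orbit_chain4 /orbit_chain !raddfD /= !bar_diff_word4 !mulg1 !mul1g g3.
by apply/eqP/freeg_eqP => w; rewrite !(coeffB, coeffD, coeff0); ring.
Qed.

(** The boundary of [orbit_chain4 h k] compares [orbit_chain h + orbit_chain k]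
    with [orbit_chain (h * k)] when [h] is a power of [g]: left multiplication by
    [h] then only permutes 1, [g], [g * g]. Three such comparisons reduce the
    triple of the cycle to the trivial case [h = 1]. *)
Lemma orbit_chain3 : orbit_chain g *+ 3 =
  bar_diff (orbit_chain4 g g + orbit_chain4 (g * g) g + orbit_chain4 1 1)%R.
Proof.
rewrite raddfD raddfD /= !bar_diff_orbit_chain4 /orbit_chain !mulg1 -!mulgA !g3 !mulg1.
by apply/eqP/freeg_eqP => w; rewrite !(coeffMn, coeffB, coeffD, coeff0); ring.
Qed.

Lemma orbit_chain_cycle : orbit_chain g \in @bar_cycle G 3.
Proof. by rewrite unfold_in /= bar_diff_orbit_chain. Qed.

Definition order3_class : group_homology G 3 :=
  \pi_(group_homology G 3)%qT (BarCycle orbit_chain_cycle).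

Lemma order3_class_tors : order3_class \in @killed_by_3 (group_homology G 3).
Proof.
rewrite unfold_in /killed_by_3 /order3_class -raddfMn /=.
rewrite quot_eq0; apply/asboolP; eexists.
by rewrite raddfMn /= orbit_chain3.
Qed.

End CyclicClass.

(** * Homogeneous cocycles as functionals on the third homology *)

Definition cocycle4 (X : Type) (A : zmodType) (c : X -> X -> X -> X -> A) :=
  forall x0 x1 x2 x3 x4, c x1 x2 x3 x4 - c x0 x2 x3 x4 + c x0 x1 x3 x4
    - c x0 x1 x2 x4 + c x0 x1 x2 x3 = 0.

(** The value of a homogeneous cochain on the 3-cycle of [orbit_chain], when
    [x], [y], [z] are the translates of a base point by 1, [g], [g ^+ 2]. *)
Definition orbit_value (X : Type) (A : zmodType) (c : X -> X -> X -> X -> A)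
    (x y z : X) : A := c x y y z + c x y z x + c x y x y.

(** On a free orbit the three translates of the 3-cycle add up to a boundary:
    it is coned off from one of the three points. *)
Lemma orbit_value_sum (X : Type) (A : comNzRingType) (c : X -> X -> X -> X -> A) :
  cocycle4 c -> forall x y z,
  orbit_value c x y z + orbit_value c y z x + orbit_value c z x y = 0.
Proof.
move=> cc x y z; rewrite /orbit_value.
pose cone a b d e := c a b d e - c x b d e + c x a d e - c x a b e + c x a b d.
transitivity (cone x y y z + cone x y z x + cone x y x y
  + (cone y z z x + cone y z x y + cone y z y z)
  + (cone z x x y + cone z x y z + cone z x z x)).
  by rewrite /cone; ring.
by rewrite /cone !cc !addr0.
Qed.

Section CocycleFunctional.
Variables (G : groupType) (A : zmodType) (c : G -> G -> G -> G -> A).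
Hypothesis c_cocycle : cocycle4 c.
Hypothesis c_invariant : forall h x0 x1 x2 x3 : G,
  c (h * x0)%g (h * x1)%g (h * x2)%g (h * x3)%g = c x0 x1 x2 x3.

Definition inhomogeneous (w : {ffun 'I_3 -> G}) : A :=
  let a := w (inord 0) in let b := w (inord 1) in let d := w (inord 2) in
  c 1%g a (a * b)%g (a * b * d)%g.

Lemma inhomogeneous_word a b d :
  inhomogeneous (word3 a b d) = c 1%g a (a * b)%g (a * b * d)%g.
Proof. by rewrite /inhomogeneous /word3 !ffunE !inordK. Qed.

Lemma inhomogeneous_cocycle (c4 : bar_chain G 4) :
  bar_eval inhomogeneous (bar_diff c4) = 0.
Proof.
apply: bar_eval_diff => w.
have -> : w = word4 (w (inord 0)) (w (inord 1)) (w (inord 2)) (w (inord 3)).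
  by apply/ffunP => -[[|[|[|[|k]]]] lt_k] //; rewrite ffunE /=;
    congr (w _); apply: val_inj; rewrite /= inordK.
move: (w _) (w _) (w _) (w _) => t z y x.
transitivity (bar_eval inhomogeneous (bar_diff (<< word4 x y z t >> : bar_chain G 4))).
  rewrite bar_diffU raddf_sum; apply: eq_bigr => i _.
  by rewrite /= bar_evalU.
rewrite bar_diff_word4 !(raddfB, raddfD) /= !bar_evalU !mulr1z.
rewrite !inhomogeneous_word.
rewrite -(c_invariant x 1%g) !mulg1 !mulgA.
exact: c_cocycle.
Qed.

(** A left invariant homogeneous cocycle becomes a functional on the third
    homology by reading the bar word [a | b | d] as the simplex
    (1, a, a b, a b d). *)
Lemma cocycle_functional : exists phi : {additive group_homology G 3 -> A},
  forall (g : G) (g3 : (g * (g * g) = 1)%g),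
    phi (order3_class g3) = orbit_value c 1%g g (g * g)%g.
Proof.
pose ev (z : bar_cycles G 3) : A := bar_eval inhomogeneous (val z).
pose phi (x : group_homology G 3) := ev (repr x).
have phi_pi z : phi (\pi_(group_homology G 3)%qT z) = ev z.
  apply/eqP; rewrite -subr_eq0 /phi /ev -!raddfB /=.
  have : repr (\pi_(group_homology G 3)%qT z) - z \in @bar_boundary G 3.
    by rewrite Quotient.idealrBE reprK.
  by move=> /asboolP[w /= ->]; rewrite inhomogeneous_cocycle.
have phiB : zmod_morphism phi.
  elim/quotW=> x; elim/quotW=> y.
  by rewrite -raddfB /= !phi_pi /ev !raddfB.
pose M := GRing.isZmodMorphism.Build _ _ phi phiB.
pose phi' : {additive group_homology G 3 -> A} := HB.pack phi M.
exists phi'; move=> g g3; rewrite -[LHS]/(phi _) phi_pi /ev /= /orbit_chain.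
rewrite !raddfD /= !bar_evalU !mulr1z !inhomogeneous_word.
by rewrite /orbit_value !mulg1 -!mulgA g3 mulg1.
Qed.
End CocycleFunctional.

(** * The carry cocycle of a cyclic group *)

Section CarryCocycle.
Variable n : nat.
Local Notation Zn := 'I_n.+2.
Implicit Types x y z t : Zn.

Definition carry x y : nat := (x + y) %/ n.+2.

Lemma carry_cocycle x y z :
  (carry y z + carry x (y + z)%R = carry x y + carry (x + y)%R z)%N.
Proof.
have carryE a b : (carry a b * n.+2 + (a + b)%R = a + b)%N.
  by rewrite /carry -divn_eq.
have := carryE y z; have := carryE x (y + z).
have := carryE x y; have := carryE (x + y) z; rewrite addrA.
move=> e1 e2 e3 e4; apply/eqP; rewrite -(eqn_pmul2r (isT : 0 < n.+2)%N) !mulnDl.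
move: e1 e2 e3 e4 => {carryE}; move: (_ * _)%N (_ * _)%N (_ * _)%N (_ * _)%N.
by move: (nat_of_ord (x + y)) (nat_of_ord (y + z)) (nat_of_ord (_ + z)); lia.
Qed.

(** The generator of the third cohomology of a cyclic group, in homogeneous
    form. *)
Definition carry4 (x0 x1 x2 x3 : Zn) : Zn :=
  (x1 - x0) *+ carry (x2 - x1) (x3 - x2).

Lemma carry4_shift a x0 x1 x2 x3 :
  carry4 (a + x0) (a + x1) (a + x2) (a + x3) = carry4 x0 x1 x2 x3.
Proof.
have e u v : a + u - (a + v) = u - v by rewrite opprD addrACA subrr add0r.
by rewrite /carry4 !e.
Qed.

Lemma carry4_const x : carry4 x x x x = 0.
Proof. by rewrite /carry4 subrr mul0rn. Qed.

Lemma carry4_cocycle : cocycle4 carry4.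
Proof.
move=> x0 x1 x2 x3 x4; rewrite /carry4.
have := carry_cocycle (x2 - x1) (x3 - x2) (x4 - x3).
have e a b d : b - a + (d - b) = d - a :> Zn by rewrite addrC subrKA.
rewrite !e -[x2 - x0](e x0 x1 x2); move: (x1 - x0) (x2 - x1) => a w k1234.
rewrite mulrnDl opprD [w *+ _ + _]addrC subrK -addrA addrACA -opprD.
by rewrite -mulrnDr k1234 mulrnDr [_ + a *+ carry w (x3 - x2)]addrC addNr.
Qed.

Hypothesis three : (3 %| n.+2)%N.
Definition third : Zn := inZp (n.+2 %/ 3).

Lemma third_val : third = (n.+2 %/ 3)%N :> nat.
Proof. by rewrite /third /= modn_small // ltn_Pdiv. Qed.

Lemma mulrn_ord_val (x : Zn) k : x *+ k = (x * k %% n.+2)%N :> nat.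
Proof. by rewrite Zp_mulrn. Qed.

Lemma third3 : third *+ 3 = 0.
Proof.
by apply: val_inj; rewrite [LHS]mulrn_ord_val third_val divnK // modnn.
Qed.

Lemma third2_neq0 : third *+ 2 != 0.
Proof.
have := divnK three => e.
apply/eqP => /(congr1 (@nat_of_ord _)); rewrite mulrn_ord_val third_val.
by rewrite modn_small => /=; lia.
Qed.

(** Here [s] is one third or two thirds of the modulus. Only in the second case
    does [s + s] carry, and then [2 s] is again one third: the two generators of
    the subgroup of order three give the same value. *)
Lemma orbit_value_carry4 x s : s != 0 -> s *+ 3 = 0 ->
  orbit_value carry4 x (s + x) (s + (s + x)) = third.
Proof.
move=> s0 s3.
have sx y : s + y - y = s by rewrite addrK.
have s2x : x - (s + (s + x)) = s.
  by apply/esym/eqP; rewrite -subr_eq0 opprB -s3 !mulrS addr0 !addrA addrK.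
have xs : x - (s + x) = - s by rewrite opprD addrC addrNK.
rewrite /orbit_value /carry4 !subrr !sx s2x xs.
have sv : (s * 3 %% n.+2 = 0)%N by rewrite -mulrn_ord_val s3.
have s_lt := ltn_ord s; have s_gt : (0 < s)%N by rewrite lt0n.
have := divnK three; set N3 := (n.+2 %/ 3)%N => eN.
have [k ek] : exists k, (s * 3 = k * n.+2)%N.
  by exists (s * 3 %/ n.+2)%N; rewrite {1}(divn_eq (s * 3) n.+2) sv addn0.
have esk : (s = k * N3 :> nat)%N.
  by apply/eqP; rewrite -(eqn_pmul2r (isT : 0 < 3)%N) ek -mulnA eN.
have s12 : (s = N3 :> nat) \/ (s = N3 * 2 :> nat)%N.
  move: s_lt s_gt; rewrite esk -eN [(N3 * 3)%N]mulnC.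
  rewrite ltn_mul2r muln_gt0 => /andP[N30 k3] /andP[k0 _].
  by case: k k3 k0 {ek esk} => [|[|[|]]] // _ _; rewrite ?mul1n; lia.
have c0 : carry 0 s = 0%N by rewrite /carry /= divn_small.
have cN : carry (- s) s = 1%N.
  rewrite /carry /= modn_small; last by rewrite ltn_subrL s_gt.
  by rewrite subnK ?divnn // ltnW.
rewrite c0 cN mulr0n add0r mulr1n.
have -> : carry s s = if s == N3 :> nat then 0%N else 1%N.
  rewrite /carry; case: s12 => es; rewrite es; first by rewrite eqxx divn_small; lia.
  rewrite ifN; last by apply/eqP; lia.
  by rewrite -[(_ + _)%N]addn0 (_ : _ + _ + 0 = 1 * n.+2 + N3)%N ?divnMDl ?divn_small; lia.
case: s12 => es; rewrite es ?eqxx ?mulr0n ?add0r.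
  by apply: val_inj; rewrite [RHS]third_val.
rewrite ifN; last by apply/eqP; lia.
apply: val_inj; rewrite [RHS]third_val mulr1n /= es.
by rewrite (_ : _ + _ = 1 * n.+2 + N3)%N ?modnMDl ?modn_small; lia.
Qed.

End CarryCocycle.

(** * The transferred cocycle of a group acting on a set *)

Section Transfer.
Variables (G : groupType) (Theta : choiceType) (D : set Theta).
Variables (act : G -> Theta -> Theta) (n : nat) (j : G -> Theta -> 'I_n.+2).
Hypothesis act_stable : forall g t, D t -> D (act g t).
Hypothesis act1 : forall t, D t -> act 1%g t = t.
Hypothesis actM : forall g h t, D t -> act (g * h)%g t = act h (act g t).
Hypothesis j_mul : forall h g t, D t ->
  j (h * g)%g t - j h t = j g (act h t) - j 1%g (act h t).
Hypothesis j_finite :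
  forall g, finite_set [set t | D t /\ j g t <> j 1%g t].

Local Open Scope classical_set_scope.

(** [j g t] is the coordinate of [g] in a cyclic group attached to the point
    [t]. By [j_mul], acting by [h] moves these coordinates along the orbits up
    to a translation that does not depend on [g], and [carry4] is invariant
    under translations; the sum over all points is therefore an invariant
    cocycle, the transfer of [carry4]. *)
Definition transfer4 (x0 x1 x2 x3 : G) : 'I_n.+2 :=
  \sum_(t \in D) carry4 (j x0 t) (j x1 t) (j x2 t) (j x3 t).

Lemma common_support (s : seq G) : exists B : set Theta,
  [/\ finite_set B, B `<=` D &
      forall t g, D t -> ~ B t -> g \in s -> j g t = j 1%g t].
Proof.
elim: s => [|g s [B [finB BD Bj]]]; first by exists set0; split.
exists ([set t | D t /\ j g t <> j 1%g t] `|` B); split.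
- by rewrite finite_setU; split.
- by move=> t [[]//|/BD].
move=> t h Dt /not_orP[/not_andP nt nB]; rewrite inE => /orP[/eqP->|/Bj->//].
by case: nt => // /contrapT.
Qed.

Lemma transfer4_support (B : set Theta) (s : seq G) x0 x1 x2 x3 :
  finite_set B -> B `<=` D ->
  (forall t g, D t -> ~ B t -> g \in s -> j g t = j 1%g t) ->
  {subset [:: x0; x1; x2; x3] <= s} ->
  transfer4 x0 x1 x2 x3 =
    \sum_(t <- fset_set B) carry4 (j x0 t) (j x1 t) (j x2 t) (j x3 t).
Proof.
move=> finB BD Bj sub; rewrite -fsbig_finite //; apply/esym/fsbig_widen => //.
move=> t [Dt nBt] /=; have E x : x \in [:: x0; x1; x2; x3] -> j x t = j 1%g t.
  by move=> /sub; apply: Bj.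
by rewrite !E ?inE ?eqxx ?orbT // carry4_const.
Qed.

Lemma transfer4_cocycle : cocycle4 transfer4.
Proof.
move=> x0 x1 x2 x3 x4.
have [B [finB BD Bj]] := common_support [:: x0; x1; x2; x3; x4].
rewrite !(transfer4_support finB BD Bj); first last.
1-5: by move=> x; rewrite !inE => /or4P[]/eqP->; rewrite eqxx ?orbT.
rewrite -!sumrB -!big_split /= -sumrB -big_split /= big1 // => t _.
exact: carry4_cocycle.
Qed.

Lemma act_bij h : set_bij D D (act h).
Proof.
split => [t|s t|t Dt]; first exact: act_stable.
  rewrite !inE => Ds Dt e; rewrite -(act1 Ds) -(act1 Dt) -(mulgV h) !actM //.
  by rewrite e.
exists (act h^-1%g t); first exact: act_stable.
by rewrite -actM // mulVg act1.
Qed.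

Lemma transfer4_invariant h x0 x1 x2 x3 :
  transfer4 (h * x0)%g (h * x1)%g (h * x2)%g (h * x3)%g = transfer4 x0 x1 x2 x3.
Proof.
rewrite /transfer4 [RHS](reindex_fsbig (act h) D) ?act_bij //; last exact: act_bij.
apply: eq_fsbigr => t; rewrite inE => Dt.
have E x : j (h * x)%g t = (j h t - j 1%g (act h t)) + j x (act h t).
  by rewrite addrAC -addrA -j_mul // addrC subrK.
by rewrite !E carry4_shift.
Qed.

Variable g : G.
Hypothesis g3 : (g * (g * g) = 1)%g.

Let value t := orbit_value (@carry4 n) (j 1%g t) (j g t) (j (g * g)%g t).
Let S := [set t | D t /\ (j g t <> j 1%g t \/ j (g * g)%g t <> j 1%g t)].
Let moved := S `&` [set t | act g t <> t].

Lemma orbit_value_shift a x y z :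
  orbit_value (@carry4 n) (a + x) (a + y) (a + z) = orbit_value (@carry4 n) x y z.
Proof. by rewrite /orbit_value !carry4_shift. Qed.

Let finS : finite_set S.
Proof.
apply: sub_finite_set (_ : _ `<=` [set t | D t /\ j g t <> j 1%g t] `|`
  [set t | D t /\ j (g * g)%g t <> j 1%g t]) _; last first.
  by rewrite finite_setU; split; apply: j_finite.
by move=> t [Dt [?|?]]; [left|right].
Qed.

Lemma transfer_orbit_value :
  orbit_value transfer4 1%g g (g * g)%g = \sum_(t \in S) value t.
Proof.
pose s := [:: 1%g; g; (g * g)%g].
have SD : S `<=` D by move=> t [].
have Sj t h : D t -> ~ S t -> h \in s -> j h t = j 1%g t.
  move=> Dt /not_andP[//|/not_orP[/contrapT jg /contrapT jgg]].
  by rewrite !inE => /or3P[]/eqP->.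
rewrite /orbit_value !(transfer4_support finS SD Sj).
1: by rewrite -!big_split fsbig_finite.
all: by move=> x; rewrite !inE => /or4P[]/eqP->; rewrite eqxx ?orbT.
Qed.

Lemma j_act x t : D t -> j x (act g t) = (j 1%g (act g t) - j g t) + j (g * x)%g t.
Proof.
by move=> Dt; rewrite addrAC -addrA j_mul // addrC subrK.
Qed.

Lemma value_act t : D t ->
  value (act g t) = orbit_value (@carry4 n) (j g t) (j (g * g)%g t) (j 1%g t).
Proof.
move=> Dt; rewrite -[RHS](orbit_value_shift (j 1%g (act g t) - j g t)).
have := j_act (g * g)%g Dt; rewrite g3 => <-.
by rewrite -j_act // subrK.
Qed.

Lemma value_act2 t : D t -> value (act g (act g t)) =
  orbit_value (@carry4 n) (j (g * g)%g t) (j 1%g t) (j g t).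
Proof.
move=> Dt; rewrite value_act; last exact: act_stable.
rewrite -[RHS](orbit_value_shift (j 1%g (act g t) - j g t)).
have := j_act (g * g)%g Dt; rewrite g3 => <-.
by rewrite -j_act // subrK.
Qed.

Let ggt t : D t -> act g (act g (act g t)) = t.
Proof. by move=> Dt; rewrite -!actM // ?g3 ?act1 //; apply: act_stable. Qed.

Let moved_act t : moved t -> moved (act g t).
Proof.
move=> [[Dt jt] /= gt]; split; last first.
  by move=> e; apply: gt; rewrite -[RHS](ggt Dt) !e.
split; first exact: act_stable.
apply/not_andP => -[/= e1 e2].
have := j_mul g g Dt; have := j_mul g (g * g)%g Dt.
rewrite e1 e2 g3 subrr => /eqP; rewrite subr_eq0 => /eqP j1 /eqP.
by rewrite subr_eq0 -j1 => /eqP jgg; case: jt => -[].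
Qed.

(** The points moved by [g] form free orbits of three points, over which the
    contributions cancel by [orbit_value_sum]. A representative [rep] of each
    orbit cuts the set into three parts that [g] permutes cyclically. *)
Lemma moved_sum : \sum_(t \in moved) value t = 0.
Proof.
have finM : finite_set moved by apply: finite_setIl.
pose orb t := [pred u | [|| u == t, u == act g t | u == act g (act g t)]].
pose rep t := choose (orb t) t.
have rep_act t : moved t -> rep (act g t) = rep t.
  move=> [[Dt _] _]; rewrite /rep.
  have orbE : orb (act g t) =1 orb t.
    by move=> u; rewrite /= ggt // orbA orbC orbA.
  rewrite (eq_choose orbE); apply: choose_id; rewrite /= eqxx ?orbT //.
pose Q k := moved `&` [set t | rep t = iter k (act g) t].
have finQ k : finite_set (Q k) by apply: finite_setIl.
have movedE : moved = Q 0 `|` (Q 1 `|` Q 2).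
  apply/seteqP; split => [t mt|t [[]|[[]|[]]]] //.
  have : orb t (rep t) by apply: chooseP; rewrite /= eqxx.
  by move=> /or3P[]/eqP e; [left|right; left|right; right].
have neq1 t : moved t -> act g t <> t by case.
have neq2 t : moved t -> act g (act g t) <> t.
  move=> mt e; apply: (neq1 t mt); case: (mt) => [[Dt _] _].
  by rewrite -[RHS](ggt Dt) e.
have bij k : set_bij (Q k.+1) (Q k) (act g).
  split => [t [mt rt]|s t|t [mt rt]].
  - by split; [exact: moved_act|rewrite /= rep_act // rt -iterSr].
  - rewrite !inE => -[[[Ds _] _] _] [[[Dt _] _] _] e.
    by rewrite -(ggt Ds) -(ggt Dt) e.
  - exists (act g (act g t)); last by rewrite ggt //; case: mt => [[]].
    split; first by do 2!apply: moved_act.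
    rewrite /= !rep_act //; last exact: moved_act.
    by rewrite rt -iterS iterSr ggt //; case: mt => [[]].
rewrite movedE !fsbigU0 ?finite_setU //; first last.
- move=> t [[mt r0] [[_ r1]|[_ r2]]].
    by case: (neq1 t) => //; rewrite -[RHS]r0 r1.
  by case: (neq2 t) => //; rewrite -[RHS]r0 r2.
- move=> t [[mt r1] [_ r2]]; case: (neq1 (act g t)); first exact: moved_act.
  by rewrite -[RHS]r1 r2.
have reindexQ k F : \sum_(t \in Q k) F t = \sum_(t \in Q k.+1) F (act g t) :> 'I_n.+2.
  exact: reindex_fsbig (bij k).
rewrite !(reindexQ 0) !(reindexQ 1) !fsbig_finite //.
rewrite -!big_split big_seq big1 //= => t.
rewrite in_fset_set // inE => -[[[Dt _] _] _].
by rewrite value_act2 // value_act // addrCA addrA orbit_value_sum //; apply: carry4_cocycle.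
Qed.

Hypothesis three : (3 %| n.+2)%N.

(** What remains is the sum over the fixed points [t] of [g], where the
    coordinates of 1, [g], [g * g] are in arithmetic progression, with a
    difference killed by 3. *)
Theorem transfer_value : orbit_value transfer4 1%g g (g * g)%g =
  third n *+ #|` fset_set [set t | [/\ D t, act g t = t & j g t <> j 1%g t]]|.
Proof.
set F := [set t | _].
rewrite transfer_orbit_value (fsbigID [set t | act g t <> t]) //.
rewrite -/moved moved_sum /= add0r.
have -> : S `&` ~` [set t | act g t <> t] = F.
  apply/seteqP; split => [t [[Dt jt] /contrapT gt]|t [Dt gt jt]].
    split=> // jg; case: jt => // jgg; apply: jgg.
    by have := j_act g Dt; rewrite gt jg subrr add0r => <-.
  by split; [split => //; left|move=> /(_ gt)].
have finF : finite_set F by apply: sub_finite_set (j_finite g) => t [].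
rewrite fsbig_finite // big_seq (eq_bigr (fun=> third n)).
  by rewrite -big_seq big_const_seq count_predT iter_addr_0.
move=> t; rewrite in_fset_set // inE => -[Dt gt jt].
have := j_act g Dt; have := j_act (g * g)%g Dt; rewrite gt g3.
rewrite /value; set a := j 1%g t; set b := j g t; set c := j _ t => e1 e2.
have s0 : b - a != 0 by rewrite subr_eq0; apply/eqP.
move: e1 e2; rewrite -[a - b]opprB; have := subrK a b.
move: (b - a) s0 => s s0 eb e1 e2.
have ec : c = s + b by rewrite e2 addNKr.
rewrite ec -eb; apply: orbit_value_carry4 => //.
apply: (addIr a); rewrite !mulrS mulr0n addr0 -!addrA eb -ec e1 addNKr add0r.
by [].
Qed.

End Transfer.

Section TransferFunctional.
Variables (G H : groupType) (h : G -> H) (Theta : choiceType) (D : set Theta).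
Variables (act : H -> Theta -> Theta) (n : nat) (j : H -> Theta -> 'I_n.+2).
Hypothesis hM : {morph h : x y / (x * y)%g}.
Hypothesis act_stable : forall g t, D t -> D (act g t).
Hypothesis act1 : forall t, D t -> act 1%g t = t.
Hypothesis actM : forall g g' t, D t -> act (g * g')%g t = act g' (act g t).
Hypothesis j_mul : forall g g' t, D t ->
  j (g * g')%g t - j g t = j g' (act g t) - j 1%g (act g t).
Hypothesis j_finite :
  forall g, finite_set [set t | D t /\ j g t <> j 1%g t]%classic.
Hypothesis three : (3 %| n.+2)%N.

Lemma transfer_functional : exists phi : {additive group_homology G 3 -> 'I_n.+2},
  forall (g : G) (g3 : (g * (g * g) = 1)%g), phi (order3_class g3) =
    third n *+ #|` fset_set [set t | [/\ D t, act (h g) t = t &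
                                       j (h g) t <> j 1%g t]]%classic|.
Proof.
have h1 : h 1%g = 1%g by apply: (mulgI (h 1%g)); rewrite -hM !mulg1.
pose c x0 x1 x2 x3 := transfer4 D j (h x0) (h x1) (h x2) (h x3).
have c_cocycle : cocycle4 c by move=> *; apply: transfer4_cocycle.
have c_inv k x0 x1 x2 x3 :
    c (k * x0)%g (k * x1)%g (k * x2)%g (k * x3)%g = c x0 x1 x2 x3.
  by rewrite /c !hM; apply: (transfer4_invariant act_stable act1 actM j_mul).
have [phi phiE] := cocycle_functional c_cocycle c_inv.
exists phi => g g3; rewrite phiE.
have hg3 : (h g * (h g * h g) = 1)%g by rewrite -!hM g3.
rewrite -(transfer_value act_stable act1 actM j_mul j_finite hg3 three).
by rewrite /orbit_value /c h1 hM.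
Qed.

End TransferFunctional.

(** * A finite independent family bounds the dimension from below *)

Section BasisExtension.
Variables (K : fieldType) (V : lmodType K).
Local Open Scope classical_set_scope.
Implicit Types B C : set V.

Lemma lin_indep_seqP B : lin_indep B <->
  forall (s : seq V) (c : V -> K), uniq s -> (forall v, v \in s -> B v) ->
    \sum_(v <- s) c v *: v = 0 -> forall v, v \in s -> c v = 0.
Proof.
split=> [indB s c us sB s0 v vs|indB n b c injb bB b0 i].
  pose b (i : 'I_(size s)) := s`_i.
  have injb : injective b.
    by move=> i k /eqP; rewrite nth_uniq // => /eqP/val_inj.
  have := indB _ b (c \o b) injb (fun i => sB _ (mem_nth 0 (ltn_ord i))).
  move: s0; rewrite (big_nth 0) big_mkord => s0 /(_ s0).
  have vs' : (index v s < size s)%N by rewrite index_mem.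
  by move=> /(_ (Ordinal vs')); rewrite /b /= nth_index.
pose s := [seq b i | i <- enum 'I_n].
pose c' v := if [pick i | b i == v] is Some i then c i else 0.
have c'E i' : c' (b i') = c i'.
  rewrite /c'; case: pickP => [k /eqP/injb->//|/(_ i')].
  by rewrite eqxx.
rewrite -c'E; apply: (indB s).
- by rewrite map_inj_uniq ?enum_uniq.
- by move=> v /mapP[k _ ->].
- rewrite big_map big_enum -[RHS]b0; apply: eq_bigr => k _.
  by rewrite c'E.
- by apply: map_f; rewrite mem_enum.
Qed.

Lemma spanning_seq B x (s : seq V) (c : V -> K) : (forall v, v \in s -> B v) ->
  x = \sum_(v <- s) c v *: v ->
  exists (n : nat) (b : 'I_n -> V) (c : 'I_n -> K),
    (forall i, B (b i)) /\ x = \sum_(i < n) c i *: b i.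
Proof.
move=> sB ->; exists (size s), (fun i => s`_i), (fun i => c s`_i); split.
  by move=> i; apply/sB/mem_nth.
by rewrite (big_nth 0) big_mkord.
Qed.

(** A maximal independent set exists by Zorn's lemma. It spans: an [x] outside
    its span could be added, because a relation in which [x] has a nonzero
    coefficient expresses [x] by the other vectors. *)
Lemma lin_indep_extend B : lin_indep B -> exists2 C, B `<=` C & is_basis C.
Proof.
move=> indB.
have [F FP totF|A [indA maxA]] := @Zorn_bigcup V [set A | lin_indep (B `|` A)].
  apply/lin_indep_seqP => s c us sF s0.
  have [A FA sA] : exists2 A, A = set0 \/ F A & forall v, v \in s -> (B `|` A) v.
    elim: s sF {us s0} => [|v s IH] sF; first by exists set0; [left|].
    have [u us|A FA sA] := IH; first by apply: sF; rewrite inE us orbT.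
    have [Bv|[A' FA' A'v]] := sF v (mem_head v s).
      exists A => // u; rewrite inE => /predU1P[->|/sA//]; by left.
    have [AA'|A'A] : A `<=` A' \/ A' `<=` A.
      case: FA => [->|FA]; first by left.
      exact: totF.
    - exists A'; [by right|move=> u; rewrite inE => /predU1P[->|]; first by right].
      by move=> /sA; apply: setUS.
    - exists A => // u; rewrite inE => /predU1P[->|/sA//]; right; exact: A'A.
  have indA : lin_indep (B `|` A) by case: FA => [->|/FP//]; rewrite setU0.
  by move/lin_indep_seqP: indA => /(_ s c us sA s0).
exists (B `|` A); first exact: subsetUl.
split => // x; have [[s [c [sA xE]]]|nspan] := pselect (exists (s : seq V) c,
    (forall v, v \in s -> (B `|` A) v) /\ x = \sum_(v <- s) c v *: v).
  exact: spanning_seq sA xE.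
case: (maxA (x |` A)).
  split; first exact: subsetUr.
  move=> /(_ x (or_introl erefl)) Ax; apply: nspan; exists [:: x], (fun=> 1); split.
    by move=> v; rewrite inE => /eqP->; right.
  by rewrite big_seq1 scale1r.
apply/lin_indep_seqP => s c us sA s0.
have sA' v : v \in s -> v != x -> (B `|` A) v.
  move=> /sA[Bv|[/= ->|Av]]; rewrite ?eqxx // => _; by [left|right].
have [xs|xNs] := boolP (x \in s); last first.
  move/lin_indep_seqP: indA; apply => // v vs; apply: sA' => //.
  by apply: contraNneq xNs => <-.
move: s0; rewrite (bigD1_seq x) //= => s0.
have remA v : v \in rem x s -> (B `|` A) v.
  rewrite mem_rem_uniq // inE => /andP[vx vs]; exact: sA'.
have cx : c x = 0.
  apply/eqP/negPn/negP => cx; apply: nspan.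
  exists (rem x s), (fun v => - (c x)^-1 * c v); split => //.
  rewrite rem_filter // big_filter; under eq_bigr do rewrite -scalerA.
  rewrite -scaler_sumr scaleNr -scalerN.
  by apply: (scalerI cx); rewrite scalerA mulfV // scale1r; apply/eqP;
    rewrite -subr_eq0 opprK s0.
move: s0; rewrite cx scale0r add0r -big_filter -rem_filter // => s0 v vs.
have [->//|vx] := eqVneq v x.
move/lin_indep_seqP: indA => /(_ _ c (rem_uniq x us) remA s0); apply.
by rewrite mem_rem_uniq // inE vx.
Qed.

Lemma dim_ge_indep n (b : 'I_n -> V) :
  (forall c : 'I_n -> K, \sum_(i < n) c i *: b i = 0 -> forall i, c i = 0) ->
  dim_ge V n.
Proof.
move=> indb; have injb : injective b.
  move=> i k bik; apply/eqP/negPn/negP => ik.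
  suff /indb/(_ i)/eqP : \sum_(l < n) ((l == i)%:R - (l == k)%:R : K) *: b l = 0.
    by rewrite eqxx (negPf ik) subr0 oner_eq0.
  under eq_bigr do rewrite scalerBl; rewrite sumrB.
  have E u : \sum_(l < n) (l == u)%:R *: b l = b u.
    rewrite (bigD1 u) //= eqxx scale1r big1 ?addr0 // => l /negPf->.
    by rewrite scale0r.
  by rewrite !E bik subrr.
have /lin_indep_extend[C bC basC] : lin_indep (range b).
  move=> m b' c injb' b'b s0 i.
  have /choice[f fb] k : exists l, b l = b' k by case: (b'b k) => l _ <-; exists l.
  have injf : injective f by move=> k l fkl; apply: injb'; rewrite -!fb fkl.
  pose c' l := \sum_(k < m | f k == l) c k.
  have := indb c'; rewrite -(_ : c' (f i) = c i); last first.
    rewrite /c' (bigD1 i) //= big1 ?addr0 // => k /andP[/eqP/injf->].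
    by rewrite eqxx.
  move=> /(_ _ (f i)); apply; rewrite -[RHS]s0.
  under eq_bigr do rewrite scaler_suml.
  rewrite (exchange_big_dep xpredT) //=; apply: eq_bigr => k _.
  by rewrite (big_pred1 (f k)) ?fb // => l; rewrite eq_sym.
exists C; split => //; apply: card_le_trans (subset_card_le bC).
case: n b indb injb bC => [|n] b indb injb bC.
  by rewrite II0 card_ge0.
pose h (k : nat) := b (inord k).
have injh : {in `I_n.+1 &, injective h}.
  move=> k l; rewrite !inE => kn ln /injb /(congr1 val) /=.
  by rewrite !inordK.
have := inj_card_eq injh; rewrite card_eq_le => /andP[_ le1].
by apply: card_le_trans le1 (subset_card_le _) => _ [k _ <-]; exists (inord k).
Qed.

End BasisExtension.

(** * Elements of order three in [SL_2] *)

Section TwoByTwo.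
Variable R : comNzRingType.
Implicit Types A B : 'M[R]_2.

Definition mat2 (a b c d : R) : 'M[R]_2 := \matrix_(i, j)
  if i == 0 then if j == 0 then a else b else if j == 0 then c else d.

Lemma mat2E a b c d : (mat2 a b c d 0 0 = a) * (mat2 a b c d 0 1 = b) *
  (mat2 a b c d 1 0 = c) * (mat2 a b c d 1 1 = d).
Proof. by rewrite !mxE. Qed.

Lemma ord2P (P : 'I_2 -> Prop) : P 0 -> P 1 -> forall i, P i.
Proof.
move=> P0 P1 [[|[|//]] lti].
  by rewrite (_ : Ordinal _ = 0) //; apply: val_inj.
by rewrite (_ : Ordinal _ = 1) //; apply: val_inj.
Qed.

Lemma mat2_eta A : A = mat2 (A 0 0) (A 0 1) (A 1 0) (A 1 1).
Proof. by apply/matrixP; apply: ord2P; apply: ord2P; rewrite !mxE. Qed.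

Lemma mulmx2E A B i j : (A *m B) i j = A i 0 * B 0 j + A i 1 * B 1 j.
Proof.
rewrite mxE big_ord_recl big_ord1; congr (_ + A i _ * B _ j);
  exact: val_inj.
Qed.

Lemma mulmx_mat2 a b c d a' b' c' d' :
  mat2 a b c d *m mat2 a' b' c' d' =
  mat2 (a * a' + b * c') (a * b' + b * d') (c * a' + d * c') (c * b' + d * d').
Proof. by rewrite [LHS]mat2_eta !mulmx2E !mat2E. Qed.

Lemma det_mx2 A : \det A = A 0 0 * A 1 1 - A 0 1 * A 1 0.
Proof.
rewrite (expand_det_row A 0) big_ord_recl big_ord1.
have -> : fintype.lift ord0 ord0 = 1 :> 'I_2 by apply: val_inj.
rewrite /cofactor !det_mx11 !mxE /= !expr0 mul1r expr1 mulrA mulrN1 mulNr.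
by congr (_ * A _ _ - _ * A _ _); apply: val_inj.
Qed.

Lemma sl2_det (A : special_linear 2 R) :
  val A 0 0 * val A 1 1 - val A 0 1 * val A 1 0 = 1.
Proof. by rewrite -det_mx2; apply/eqP/sl_det. Qed.

Variables (t t' : R) (tt' : t * t' = 1).

Lemma tri_subproof : \det (mat2 0 (- t) t' (- 1)) == 1.
Proof. by rewrite det_mx2 !mat2E mul0r sub0r mulNr opprK tt'. Qed.

(** The conjugate of [mat2 0 (-1) 1 (-1)], of characteristic polynomial
    [x ^+ 2 + x + 1], by the diagonal matrix with entries [t] and 1. *)
Definition tri : special_linear 2 R := SpecialLinear tri_subproof.

Lemma tri3 : (tri * (tri * tri) = 1)%g.
Proof.
apply: val_inj; rewrite /= !mulmx_mat2 [RHS]mat2_eta !mxE /=.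
congr mat2; rewrite ?mulr1n ?mulr0n; ring: tt'.
Qed.

End TwoByTwo.

(** * Roots of unity in finite fields *)

Lemma dvd3_ord n (s : 'I_n.+2) : s != 0 -> s *+ 3 = 0 -> (3 %| n.+2)%N.
Proof.
move=> s0 s3; have : (n.+2 %| s * 3)%N.
  by apply/eqP; rewrite -[RHS]/(nat_of_ord (0 : 'I_n.+2)) -s3 mulrn_ord_val.
apply: contraLR; rewrite -prime_coprime // coprime_sym => co3.
rewrite Gauss_dvdl // gtnNdvd // lt0n.
by apply: contra s0 => /eqP s0; apply/eqP/val_inj.
Qed.

Lemma finField_log (E : finFieldType) n : #|E|.-1 = n.+2 ->
  exists L : E -> 'I_n.+2,
    {in [pred x | x != 0] &, {morph L : x y / x * y >-> x + y}} /\
    (forall x, x != 0 -> L x = 0 -> x = 1).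
Proof.
move=> Ecard; pose rs := [seq x <- enum E | x != 0].
have x1 (x : E) : x != 0 -> x ^+ n.+2 = 1.
  move=> x0; apply: (mulfI x0); rewrite -exprS -Ecard prednK ?expf_card ?mulr1 //.
  exact: ltnW (finNzRing_gt1 E).
have /hasP[z _ prz] : has n.+2.-primitive_root rs.
  have Urs : uniq rs by rewrite filter_uniq ?enum_uniq.
  apply: has_prim_root => //.
    by apply/allP => x; rewrite mem_filter unity_rootE => /andP[/x1->]; rewrite eqxx.
  by rewrite -Ecard -(cardC1 0) cardE /rs enumT /enum_mem.
pose L x : 'I_n.+2 := odflt 0 [pick i : 'I_n.+2 | x == z ^+ i].
have LE x : x != 0 -> x = z ^+ L x.
  move=> x0; rewrite /L; case: pickP => [i /eqP//|].
  by have [i ->] := prim_rootP prz (x1 _ x0) => /(_ i); rewrite eqxx.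
exists L; split=> [x y x0 y0|x x0 Lx]; last by rewrite (LE x) // Lx.
have : z ^+ L (x * y) == z ^+ (L x + L y)%N.
  by rewrite exprD -!LE // mulf_neq0.
rewrite (eq_prim_root_expr prz) => /eqP e; apply: val_inj.
by rewrite /= -e modn_small.
Qed.

Lemma cube_root_extension (k : finFieldType) :
  exists (E : finFieldType) (f : {rmorphism k -> E}) (z : E), z ^+ 2 + z + 1 = 0.
Proof.
pose p : {poly k} := 'X^2 + 'X + 1.
have sp : size p = 3%N.
  by rewrite /p -addrA size_polyDl size_polyXn // size_polyDl size_polyX // size_poly1.
have p0 : p != 0 by rewrite -size_poly_eq0 sp.
have [L [zs Dp _]] := FinSplittingFieldFor p0.
pose E : finFieldType := FinFieldExtType L.
have : size (map_poly (in_alg L) p) = size (\prod_(z <- zs) ('X - z%:P)).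
  exact: eqp_size.
rewrite size_map_poly sp size_prod_XsubC; case: zs Dp => [//|z zs] Dp _.
exists E, (in_alg L), z.
have : root (map_poly (in_alg L) p) z.
  by rewrite (eqp_root Dp) root_prod_XsubC mem_head.
by rewrite rootE /p !rmorphD /= map_polyXn map_polyX rmorph1 !hornerE => /eqP.
Qed.

(** * Detecting one class over a finite residue field *)

Section FiniteField.
Variables (E : finFieldType) (n : nat) (L : E -> 'I_n.+2).
Hypothesis LM : {in [pred x | x != 0] &, {morph L : x y / x * y >-> x + y}}.
Hypothesis L_inj : forall x, x != 0 -> L x = 0 -> x = 1.

Lemma log1 : L 1 = 0.
Proof.
by apply: (addrI (L 1)); rewrite -LM ?inE ?oner_eq0 // mulr1 addr0.
Qed.

Lemma logV x : x != 0 -> L x^-1 = - L x.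
Proof.
move=> x0; apply: (addrI (L x)); rewrite subrr -LM ?inE ?invr_eq0 //.
by rewrite mulfV // log1.
Qed.

Variable z : E.
Hypotheses (z3 : z ^+ 2 + z + 1 = 0) (E3 : 3%:R != 0 :> E).

Lemma cube_root_neq0 : z != 0.
Proof.
by apply: contra_eqN z3 => /eqP->; rewrite expr0n !add0r oner_eq0.
Qed.

Lemma cube_root_expr3 : z ^+ 3 = 1.
Proof.
have e : z ^+ 3 - 1 = (z - 1) * (z ^+ 2 + z + 1) by ring.
by apply/eqP; rewrite -subr_eq0 e z3 mulr0.
Qed.

Lemma cube_root_neq1 : z != 1.
Proof.
apply: contraNneq E3 => z1; rewrite -z3 z1; apply/eqP; ring.
Qed.

Lemma log_cube_root : L z != 0.
Proof.
apply: contraNneq cube_root_neq1 => /L_inj -> //; exact: cube_root_neq0.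
Qed.

Lemma log_cube_root3 : L z *+ 3 = 0.
Proof.
have z0 := cube_root_neq0.
by rewrite -log1 -cube_root_expr3 !exprS mulr1 !LM ?inE ?mulf_neq0 //
  !mulrS addr0.
Qed.

Lemma cube_root_dvd3 : (3 %| n.+2)%N.
Proof. exact: dvd3_ord log_cube_root log_cube_root3. Qed.

End FiniteField.

Lemma card_ge3 (E : finFieldType) (z : E) : z ^+ 2 + z + 1 = 0 ->
  3%:R != 0 :> E -> exists n, #|E|.-1 = n.+2.
Proof.
move=> z3 E3; have z0 := cube_root_neq0 z3; have z1 := cube_root_neq1 z3 E3.
have : (#|[:: (0 : E)%R; 1%R; z]| <= #|E|)%N by apply: max_card.
rewrite (card_uniqP _) /= ?inE ?negb_or ?[0 == _]eq_sym ?[1 == z]eq_sym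
  ?oner_eq0 ?z0 ?z1 //.
by case: #|E| => [|[|[|m]]] // _; exists m.
Qed.

Section RowAction.
Variable E : fieldType.
Implicit Types (A : 'M[E]_2) (s : E * E).

Definition rowact A s := (s.1 * A 0 0 + s.2 * A 1 0, s.1 * A 0 1 + s.2 * A 1 1).
Definition rowscale (c : E) s := (c * s.1, c * s.2).
Definition pivot s := if s.1 != 0 then s.1 else s.2.
(** The points of the projective line are represented by their multiple of pivot
    1. *)
Definition rownorm s := rowscale (pivot s)^-1 s.

Lemma rowact1 s : rowact 1%:M s = s.
Proof. by case: s => a b; rewrite /rowact !mxE /= !mulr1 !mulr0 addr0 add0r. Qed.

Lemma rowactM A B s : rowact (A *m B) s = rowact B (rowact A s).
Proof. by rewrite /rowact !mulmx2E /=; congr (_, _); ring. Qed.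

Lemma rowact_scale A c s : rowact A (rowscale c s) = rowscale c (rowact A s).
Proof. by rewrite /rowact /rowscale /=; congr (_, _); ring. Qed.

Lemma rowscaleA c d s : rowscale c (rowscale d s) = rowscale (c * d) s.
Proof. by rewrite /rowscale /= !mulrA. Qed.

Lemma rowscale1 s : rowscale 1 s = s.
Proof. by case: s => a b; rewrite /rowscale !mul1r. Qed.

Lemma pivot_scale c s : c != 0 -> pivot (rowscale c s) = c * pivot s.
Proof.
by move=> c0; rewrite /pivot /rowscale /= mulf_eq0 (negPf c0) /=; case: ifP.
Qed.

Lemma pivot_eq0 s : pivot s = 0 -> s = (0, 0).
Proof.
case: s => a b; rewrite /pivot /=; have [->|a0] := eqVneq a 0 => /= [->//|/eqP].
by rewrite (negPf a0).
Qed.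

Lemma pivot_rowact (A : special_linear 2 E) s : pivot s != 0 ->
  pivot (rowact (val A) s) != 0.
Proof.
apply: contraNneq => /pivot_eq0 As.
have : rowact (val (A^-1)%g) (rowact (val A) s) = s.
  by rewrite -rowactM -[val A *m _]/(val (A * A^-1)%g) mulgV rowact1.
by rewrite As /rowact /= !mul0r addr0 => <-; rewrite /pivot /= eqxx.
Qed.

Lemma pivot_norm s : pivot s != 0 -> pivot (rownorm s) = 1.
Proof. by move=> s0; rewrite pivot_scale ?invr_eq0 // mulVf. Qed.

Lemma rownorm_scale c s : c != 0 -> rownorm (rowscale c s) = rownorm s.
Proof.
move=> c0; rewrite /rownorm pivot_scale // rowscaleA invfM mulrAC mulVf //.
by rewrite mul1r.
Qed.

End RowAction.

Lemma map_sl_subproof n (R S : comNzRingType) (f : {rmorphism R -> S})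
  (A : special_linear n R) : \det (map_mx f (val A)) == 1.
Proof. by rewrite det_map_mx (eqP (sl_det A)) rmorph1. Qed.

Definition map_sl (n : nat) (R S : comNzRingType) (f : {rmorphism R -> S})
    (A : special_linear n R) : special_linear n S :=
  SpecialLinear (map_sl_subproof f A).

Lemma map_slM n (R S : comNzRingType) (f : {rmorphism R -> S}) :
  {morph @map_sl n R S f : A B / (A * B)%g}.
Proof. by move=> A B; apply: val_inj; rewrite /= map_mxM. Qed.

(** The transfer for the projective line over [E]. An element of order three has
    the two primitive cube roots of unity as eigenvalues, hence two fixed
    points, and the local factors there are these eigenvalues. *)
Lemma finite_field_detect (R : comNzRingType) (E : finFieldType)
    (f : {rmorphism R -> E}) (z : E) :
  z ^+ 2 + z + 1 = 0 -> 3%:R != 0 :> E ->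
  exists (n : nat)
    (phi : {additive group_homology (special_linear 2 R) 3 -> 'I_n.+2}),
    phi (order3_class (tri3 (mulr1 1))) = third n *+ 2 /\ (3 %| n.+2)%N.
Proof.
move=> z3 E3.
have [n Ecard] := card_ge3 z3 E3.
have [L [LM L_inj]] := finField_log Ecard.
have three := cube_root_dvd3 LM L_inj z3 E3.
pose h (A : special_linear 2 R) : special_linear 2 E := map_sl f A.
pose D : set (E * E) := [set s | pivot s = 1]%classic.
pose act (A : special_linear 2 E) s := rownorm (rowact (val A) s).
pose j (A : special_linear 2 E) s := L (pivot (rowact (val A) s)).
have D0 s : D s -> pivot s != 0 by rewrite /D /= => ->; apply: oner_neq0.
have Dnorm s : D s -> rownorm s = s.
  by rewrite /D /rownorm /= => ->; rewrite invr1 rowscale1.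
have act_stable A s : D s -> D (act A s).
  by move=> /D0 s0; apply/pivot_norm/pivot_rowact.
have act1 s : D s -> act 1%g s = s by move=> Ds; rewrite /act rowact1 Dnorm.
have actM A B s : D s -> act (A * B)%g s = act B (act A s).
  move=> /D0 s0; rewrite /act /= rowactM.
  have c0 : (pivot (rowact (val A) s))^-1 != 0 by rewrite invr_eq0 pivot_rowact.
  by rewrite -[LHS](rownorm_scale _ c0) -rowact_scale.
have j_mul A B s : D s ->
    j (A * B)%g s - j A s = j B (act A s) - j 1%g (act A s).
  move=> Ds; have /D0 s0 := Ds.
  rewrite /j /= rowact1 pivot_norm ?pivot_rowact // (log1 LM) subr0 rowactM.
  rewrite rowact_scale pivot_scale ?invr_eq0 ?pivot_rowact //.
  rewrite LM ?inE ?invr_eq0 ?pivot_rowact // ?(logV LM) ?pivot_rowact //.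
    by rewrite addrC.
have j_finite A : finite_set [set s | D s /\ j A s <> j 1%g s]%classic.
  exact: finite_finset.
have [|phi phiE] := transfer_functional (h := h) _ act_stable act1 actM j_mul j_finite three.
  by move=> A B; apply: map_slM.
exists n, phi; rewrite phiE; split => //; congr (_ *+ _).
(* the second root of [x ^+ 2 + x + 1] *)
pose w := - 1 - z.
have w3 : w ^+ 2 + w + 1 = 0 by rewrite -z3 /w; ring.
have rowactE s : rowact (val (h (tri (mulr1 1)))) s = (s.2, - s.1 - s.2).
  rewrite /rowact /h /= !mxE /= rmorph0 !rmorphN rmorph1.
  by congr (_, _); ring.
have j1 s : D s -> j 1%g s = 0 by rewrite /D /j /= rowact1 => ->; apply: log1.
rewrite (_ : [set s | _]%classic = [set (1, z); (1, w)]%classic).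
  rewrite fset_setU ?fset_set1 ?cardfs2 //.
  rewrite xpair_eqE eqxx /= /w (_ : _ == _ = false) //.
  apply: contraNF E3 => /eqP e; apply/eqP.
  have e1 : z *+ 2 + 1 = 0 by rewrite mulr2n {2}e; ring.
  have -> : 3%:R = 4%:R * (z ^+ 2 + z + 1) - (z *+ 2 + 1) ^+ 2 by ring.
  by rewrite z3 e1; ring.
apply/seteqP; split => [[a b] [Ds ds js]|s].
  move: ds; rewrite /act rowactE /rownorm /rowscale /=.
  move: Ds; rewrite /D /pivot /=; have [->|a0] := eqVneq a 0 => /= ->.
    by rewrite oner_eq0 /= invr1 !mul1r => -[/eqP]; rewrite oner_eq0.
  have [->|b0] := eqVneq b 0.
    by rewrite /= !mulr0 => -[/esym/eqP]; rewrite oner_eq0.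
  move=> /= -[_ e]; have : (b - z) * (b - w) = 0.
    have {e}e : b ^+ 2 + b + 1 = 0.
      by rewrite expr2 -{2}e mulrA mulfV // mul1r; ring.
    have -> : (b - z) * (b - w) = b ^+ 2 + b + 1 - (z ^+ 2 + z + 1).
      by rewrite /w; ring.
    by rewrite e z3 subrr.
  by move=> /eqP; rewrite mulf_eq0 !subr_eq0 => /orP[]/eqP->; [left|right].
have fixed b : b ^+ 2 + b + 1 = 0 ->
    [/\ D (1, b), act (h (tri (mulr1 1))) (1, b) = (1, b) &
      j (h (tri (mulr1 1))) (1, b) <> j 1%g (1, b)].
  move=> b3; have b0 := cube_root_neq0 b3.
  have Ds : D (1, b) by rewrite /D /pivot /= oner_eq0.
  split => //.
    rewrite /act rowactE /rownorm /rowscale /pivot /= b0 mulVf //.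
    congr (_, _); apply: (mulfI b0); rewrite mulrA mulfV // mul1r.
    by apply/eqP; rewrite -subr_eq0 -oppr_eq0 -b3; apply/eqP; ring.
  rewrite j1 // /j rowactE /pivot /= b0; apply/eqP.
  exact: (log_cube_root L_inj b3 E3).
by move=> [] ->; apply: fixed.
Qed.

(** * The cocycle of a discrete valuation *)

(** [red] extends the reduction map of [v] to [F], with values in a field [E]
    that contains the residue field, and [lam] is a homomorphism on the units of
    [E] whose kernel consists of the nonzero residues: it measures how far an element of [E]
    is from a residue. The vertices of the tree of [v] are the lattices of rank
    two up to scaling. Those in the orbit of the standard lattice are the cosets
    of SL_2 of the valuation ring, and the stabiliser of each of them acts by
    homographies on the elements of [E] that are not residues. *)
Section Tree.
Variables (F : fieldExtType rat) (v : finite_prime F) (E : finFieldType).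
Variables (red : F -> E) (n : nat) (lam : E -> 'I_n.+2) (z : E).
Local Notation V := (in_valuation_ring v).

Definition residue (e : E) : Prop := exists2 x, x \in V & red x = e.

Hypothesis redD : {in V &, {morph red : x y / x + y}}.
Hypothesis redM : {in V &, {morph red : x y / x * y}}.
Hypothesis red1 : red 1 = 1.
Hypothesis red_eq0 : forall x, x \in V -> (red x == 0) = ((x == 0) || (0 < v x)).
Hypothesis lamM : {in [pred x | x != 0] &, {morph lam : x y / x * y >-> x + y}}.
Hypothesis lam_eq0 : forall e, e != 0 -> lam e = 0 <-> residue e.
Hypothesis z3 : z ^+ 2 + z + 1 = 0.
Hypothesis z_res : ~ residue z.

Lemma valuation_ringE x : (x \in V) = (x == 0) || (0 <= v x).
Proof. by []. Qed.

Lemma nuV x : x != 0 -> v x^-1 = - v x.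
Proof.
move=> x0; apply: (addrI (v x)); rewrite subrr -nuM ?invr_eq0 // divff //.
exact: nu1.
Qed.

Lemma nuX x m : x != 0 -> v (x ^+ m) = v x *+ m.
Proof.
by move=> x0; elim: m => [|m IH]; rewrite ?expr0 ?nu1 // exprS nuM ?expf_neq0 // IH mulrS.
Qed.

Lemma red0 : red 0 = 0.
Proof. by apply/eqP; rewrite red_eq0 ?rpred0 // eqxx. Qed.

Lemma redN x : x \in V -> red (- x) = - red x.
Proof.
move=> Vx; apply: (addrI (red x)).
by rewrite subrr -redD ?rpredN // subrr red0.
Qed.

Lemma red_unit x : x \in V -> red x != 0 -> [/\ x != 0, v x = 0 & x^-1 \in V].
Proof.
move=> Vx; rewrite red_eq0 // negb_or => /andP[x0 vx].
have {}vx : v x = 0.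
  by apply/eqP; rewrite eq_le leNgt vx; move: Vx; rewrite valuation_ringE (negPf x0).
by split=> //; rewrite valuation_ringE nuV // vx oppr0 lexx orbT.
Qed.

Lemma unit_red x : x != 0 -> v x = 0 -> x \in V /\ red x != 0.
Proof.
move=> x0 vx; have Vx : x \in V by rewrite valuation_ringE vx lexx orbT.
by rewrite red_eq0 // vx ltxx (negPf x0).
Qed.

Lemma residue_red x : x \in V -> residue (red x).
Proof. by exists x. Qed.

Lemma residue1 : residue 1. Proof. by exists 1; rewrite ?rpred1. Qed.

Lemma residueB a b : residue a -> residue b -> residue (a - b).
Proof.
move=> [x Vx <-] [y Vy <-]; exists (x - y); first exact: rpredB.
by rewrite redD ?rpredN // redN.
Qed.

Lemma residueN a : residue a -> residue (- a).
Proof.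
by move=> [x Vx <-]; exists (- x); rewrite ?rpredN // redN.
Qed.

Lemma residueM a b : residue a -> residue b -> residue (a * b).
Proof.
by move=> [x Vx <-] [y Vy <-]; exists (x * y); rewrite ?rpredM // redM.
Qed.

Lemma residueV a : residue a -> residue a^-1.
Proof.
move=> [x Vx <-]; have [->|x0] := eqVneq (red x) 0.
  by rewrite invr0; exists 0; rewrite ?rpred0 // red0.
have [x00 vx Vx'] := red_unit Vx x0.
exists x^-1 => //; apply: (mulfI x0).
by rewrite -redM // !divff.
Qed.

Lemma residue_indep tau a b : ~ residue tau -> residue a -> residue b ->
  a + b * tau = 0 -> a = 0 /\ b = 0.
Proof.
move=> ntau ra rb e; have [b0|b0] := eqVneq b 0.
  by move: e; rewrite b0 mul0r addr0.
case: ntau; rewrite (_ : tau = - a / b).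
  by apply: residueM; [apply: residueN|apply: residueV].
apply: (mulIf b0); rewrite divfK // mulrC.
by apply/eqP; rewrite -addr_eq0 addrC e.
Qed.

(** The form is the norm of [a - b * z], and [z] is not a residue. *)
Lemma norm_form_anisotropic a b : residue a -> residue b ->
  a ^+ 2 + a * b + b ^+ 2 = 0 -> a = 0 /\ b = 0.
Proof.
move=> ra rb e; have [b0|b0] := eqVneq b 0.
  by move/eqP: e; rewrite b0 mulr0 expr0n /= !addr0 expf_eq0 => /eqP.
pose s := a / b; have rs : residue s by apply: residueM => //; apply: residueV.
have as_ : a = s * b by rewrite divfK.
have /eqP : (s - z) * (s - (- 1 - z)) * b ^+ 2 = 0.
  rewrite (_ : _ * _ = a ^+ 2 + a * b + b ^+ 2 - (z ^+ 2 + z + 1) * b ^+ 2).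
    by rewrite e z3 mul0r subr0.
  by rewrite as_; ring.
rewrite !mulf_eq0 (negPf b0) !orbF !subr_eq0 => /orP[]/eqP sz.
  by case: z_res; rewrite -sz.
case: z_res; rewrite (_ : z = - 1 - s); last by rewrite sz; ring.
by apply: residueB => //; apply/residueN/residue1.
Qed.

(** ** Primitive vectors *)

Definition primitive (x : F * F) := [/\ x.1 \in V, x.2 \in V &
  (red x.1 != 0) || (red x.2 != 0)].

(** The coordinate of least valuation; the test also gives a nonzero one when the
    other vanishes. *)
Definition content (x : F * F) : F :=
  if (x.2 == 0) || (x.1 != 0) && (v x.1 <= v x.2) then x.1 else x.2.

Definition vscale (p : F) (x : F * F) : F * F := (p * x.1, p * x.2).

Lemma contentP x : x != (0, 0) -> content x != 0 /\
  primitive (x.1 / content x, x.2 / content x).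
Proof.
case: x => a b; rewrite xpair_eqE negb_and /content /primitive /=.
have [-> |b0] := eqVneq b 0.
  rewrite orbF => a0; rewrite mul0r divff // rpred0 rpred1 red1 oner_eq0.
  by [].
have [->|a0] := eqVneq a 0.
  by move=> _ /=; rewrite mul0r divff // b0 rpred0 rpred1 red1 oner_eq0 orbT.
rewrite /=; have [ab|ba] := leP; split => //.
  rewrite divff // rpred1 red1 oner_eq0; split => //.
  by rewrite valuation_ringE nuM ?invr_eq0 // nuV // subr_ge0 ab orbT.
rewrite divff // rpred1 red1 oner_eq0 orbT; split => //.
by rewrite valuation_ringE nuM ?invr_eq0 // nuV // subr_ge0 ltW ?orbT.
Qed.

Lemma primitive_unique p p' x x' : p != 0 -> p' != 0 -> primitive x ->
  primitive x' -> vscale p x = vscale p' x' ->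
  exists2 e, e \in V & [/\ red e != 0, x' = vscale e x & v p = v p'].
Proof.
have half q q' y y' : q != 0 -> q' != 0 -> primitive y -> primitive y' ->
    vscale q y = vscale q' y' -> v q' <= v q.
  move=> q0 q'0 [V1 V2 y0] [V1' V2' _] [e1 e2].
  have [a [b [Va Vb a0 e]]] : exists a b, [/\ a \in V, b \in V, red a != 0 &
      q * a = q' * b].
    by case/orP: y0 => y0; [exists y.1, y'.1|exists y.2, y'.2].
  have [a00 va _] := red_unit Va a0.
  have b0 : b != 0.
    by apply: contra_neq (mulf_neq0 q0 a00) => b0; rewrite e b0 mulr0.
  have := congr1 v e; rewrite !nuM // va addr0 => ->.
  by rewrite lerDl; move: Vb; rewrite valuation_ringE (negPf b0).
move=> p0 p'0 px px' e.
have vpp : v p = v p'.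
  by apply/le_anti; rewrite (half _ _ _ _ p0 p'0 px px' e) (half _ _ _ _ p'0 p0 px' px).
have pp0 : p / p' != 0 by rewrite mulf_neq0 ?invr_eq0.
have vpp0 : v (p / p') = 0 by rewrite nuM ?invr_eq0 // nuV // vpp subrr.
have [Ve e0] := unit_red pp0 vpp0.
exists (p / p') => //; split => //; case: x x' e {px px'} => a b [a' b'] [ea eb].
by rewrite /vscale /= ![p / p' * _]mulrAC ea eb ![p' * _]mulrC !mulfK.
Qed.

Definition vmin (x : F * F) : int := v (content x).
(** The vector divided by its content reduces to a nonzero linear form, evaluated
    at the non-residue [tau]. The value in [E] depends on the choice of a content,
    but its logarithm does not, since contents differ by units of the valuation
    ring. *)
Definition logval (tau : E) (x : F * F) :=
  lam (red (x.1 / content x) + red (x.2 / content x) * tau).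

Lemma primitive_nonzero tau x : ~ residue tau -> primitive x ->
  red x.1 + red x.2 * tau != 0.
Proof.
move=> ntau [V1 V2 x0]; apply/eqP => e.
have [e1 e2] := residue_indep ntau (residue_red V1) (residue_red V2) e.
by move: x0; rewrite e1 e2 eqxx.
Qed.

Lemma vscale_neq0 p x : p != 0 -> primitive x -> vscale p x != (0, 0).
Proof.
move=> p0 [_ _]; rewrite xpair_eqE !mulf_eq0 (negPf p0) /= => x0.
by apply/negP => /andP[/eqP e1 /eqP e2]; move: x0; rewrite e1 e2 red0 eqxx.
Qed.

Lemma contentK (c : F) x : c != 0 -> vscale c (x.1 / c, x.2 / c) = x.
Proof. by case: x => a b c0; rewrite /vscale /= ![c * _]mulrC !divfK. Qed.

Lemma content_decomp x : x != (0, 0) ->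
  exists p x', [/\ p != 0, primitive x' & x = vscale p x'].
Proof.
move=> x0; have [c0 px] := contentP x0.
by exists (content x), (x.1 / content x, x.2 / content x); rewrite contentK.
Qed.

Lemma vminE p x : p != 0 -> primitive x -> vmin (vscale p x) = v p.
Proof.
move=> p0 px; have [c0 pc] := contentP (vscale_neq0 p0 px).
have [e _ [_ _ ->//]] := primitive_unique p0 c0 px pc (esym (contentK _ c0)).
Qed.

Lemma logvalE tau p x : ~ residue tau -> p != 0 -> primitive x ->
  logval tau (vscale p x) = lam (red x.1 + red x.2 * tau).
Proof.
move=> ntau p0 px; have [c0 pc] := contentP (vscale_neq0 p0 px).
have [e Ve [e0 ex _]] := primitive_unique p0 c0 px pc (esym (contentK _ c0)).
have [V1 V2 _] := px; rewrite /logval.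
have [-> ->] : (vscale p x).1 / content (vscale p x) = e * x.1 /\
    (vscale p x).2 / content (vscale p x) = e * x.2 by case: ex.
rewrite !redM // -mulrA -mulrDr lamM ?inE ?primitive_nonzero //.
by rewrite (lam_eq0 e0).2 ?add0r //; apply: residue_red.
Qed.

(** ** The action of matrices *)

Local Notation SL := (special_linear 2 F).
Implicit Types g h u y : SL.

Definition col1 g : F * F := (val g 0 0, val g 1 0).
Definition colact (A : 'M[F]_2) (x : F * F) : F * F :=
  (A 0 0 * x.1 + A 0 1 * x.2, A 1 0 * x.1 + A 1 1 * x.2).

Lemma col1M g h : col1 (g * h)%g = colact (val g) (col1 h).
Proof. by rewrite /col1 /colact /= !mulmx2E. Qed.

Lemma colactM A B x : colact (A *m B) x = colact A (colact B x).
Proof. by rewrite /colact /= !mulmx2E; congr (_, _); ring. Qed.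

Lemma colact1 x : colact 1%:M x = x.
Proof. by case: x => a b; rewrite /colact !mxE /= !mul1r !mul0r addr0 add0r. Qed.

Lemma colact_scale A p x : colact A (vscale p x) = vscale p (colact A x).
Proof. by rewrite /colact /vscale /=; congr (_, _); ring. Qed.

Lemma col1_neq0 g : col1 g != (0, 0).
Proof.
apply/eqP => -[e1 e2]; have := sl2_det g; rewrite e1 e2 mul0r mulr0 subr0.
by move/esym/eqP; rewrite oner_eq0.
Qed.

Definition integral g := forall i j, val g i j \in V.

Lemma sl2V g : [/\ val (g^-1)%g 0 0 = val g 1 1, val (g^-1)%g 0 1 = - val g 0 1,
  val (g^-1)%g 1 0 = - val g 1 0 & val (g^-1)%g 1 1 = val g 0 0].
Proof.
have e : (val g *m mat2 (val g 1 1) (- val g 0 1) (- val g 1 0) (val g 0 0) = 1%:M)%R.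
  rewrite [X in X *m _]mat2_eta mulmx_mat2 [RHS]mat2_eta !mxE /=.
  have d := sl2_det g; congr mat2; rewrite -?d; ring.
have -> : val (g^-1)%g = mat2 (val g 1 1) (- val g 0 1) (- val g 1 0) (val g 0 0).
  rewrite -[LHS]mulmx1 -e mulmxA -[_ *m val g]/(val (g^-1 * g)%g) mulVg.
  exact: mul1mx.
by rewrite !mat2E.
Qed.

Lemma integralV g : integral g -> integral g^-1%g.
Proof.
have [e1 e2 e3 e4] := sl2V g; move=> ig.
by apply: ord2P; apply: ord2P; rewrite ?e1 ?e2 ?e3 ?e4 ?rpredN.
Qed.

Lemma integral1 : integral 1%g.
Proof. by move=> i j; rewrite !mxE; case: eqP; rewrite ?rpred0 ?rpred1. Qed.

Lemma red_colact u x : integral u -> x.1 \in V -> x.2 \in V ->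
  red (colact (val u) x).1 = red (val u 0 0) * red x.1 + red (val u 0 1) * red x.2 /\
  red (colact (val u) x).2 = red (val u 1 0) * red x.1 + red (val u 1 1) * red x.2.
Proof. by move=> iu V1 V2; rewrite /colact /= !redD ?rpredM // !redM. Qed.

Lemma primitive_colact u x : integral u -> primitive x ->
  primitive (colact (val u) x).
Proof.
move=> iu [V1 V2 x0]; split; try by rewrite rpredD ?rpredM.
rewrite -negb_and; apply: contraL x0 => /andP[/eqP e1 /eqP e2].
have ex : colact (val (u^-1)%g) (colact (val u) x) = x.
  by rewrite -colactM -[_ *m _]/(val (u^-1 * u)%g) mulVg colact1.
have V1' : (colact (val u) x).1 \in V by rewrite rpredD ?rpredM.
have V2' : (colact (val u) x).2 \in V by rewrite rpredD ?rpredM.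
have [] := red_colact (integralV iu) V1' V2'.
by rewrite ex e1 e2 !mulr0 !addr0 => -> ->; rewrite eqxx.
Qed.

(** The reduction of [u] acting from the right on the row (1, tau), as a
    homography of [tau] and its factor of automorphy. *)
Definition factor u tau : E := red (val u 0 0) + red (val u 1 0) * tau.
Definition mobius u tau : E :=
  (red (val u 0 1) + red (val u 1 1) * tau) / factor u tau.

Lemma red_det u : integral u -> red (val u 0 0) * red (val u 1 1)
  - red (val u 0 1) * red (val u 1 0) = 1.
Proof.
move=> iu; have := congr1 red (sl2_det u).
by rewrite red1 redD ?rpredN ?rpredM // redN ?rpredM // !redM.
Qed.

Lemma factor_neq0 u tau : integral u -> ~ residue tau -> factor u tau != 0.
Proof.
move=> iu ntau; apply: (primitive_nonzero (x := (val u 0 0, val u 1 0))) => //.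
split; rewrite /= ?iu //; rewrite -negb_and; apply/negP => /andP[/eqP e1 /eqP e2].
have /eqP := red_det iu; rewrite e1 e2 mul0r mulr0 subrr eq_sym.
by rewrite oner_eq0.
Qed.

Lemma mobius_residue u tau : integral u -> ~ residue tau ->
  ~ residue (mobius u tau).
Proof.
move=> iu ntau rm; have f0 := factor_neq0 iu ntau.
have e : mobius u tau * factor u tau =
    red (val u 0 1) + red (val u 1 1) * tau by rewrite /mobius divfK.
set m := mobius u tau in rm e; have rr i j := residue_red (iu i j).
have [e1 e2] : red (val u 0 1) - m * red (val u 0 0) = 0 /\
    red (val u 1 1) - m * red (val u 1 0) = 0.
  apply: (residue_indep ntau); try by apply: residueB => //; apply: residueM.
  apply: (etrans (y := red (val u 0 1) + red (val u 1 1) * tau - m * factor u tau)).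
    by rewrite /factor; ring.
  by rewrite e subrr.
have /eqP := red_det iu; rewrite -(subrK (m * red (val u 0 0)) (red (val u 0 1))) e1.
rewrite -(subrK (m * red (val u 1 0)) (red (val u 1 1))) e2 !add0r.
by rewrite mulrCA mulrA subrr eq_sym oner_eq0.
Qed.

Lemma vmin_colact u x : integral u -> x != (0, 0) ->
  vmin (colact (val u) x) = vmin x.
Proof.
move=> iu x0; have [c0 px] := contentP x0; rewrite -(contentK x c0).
by rewrite colact_scale !vminE //; apply: primitive_colact.
Qed.

Lemma logval_colact u x tau : integral u -> ~ residue tau -> x != (0, 0) ->
  logval tau (colact (val u) x) =
  lam (factor u tau) + logval (mobius u tau) x.
Proof.
move=> iu ntau x0; have [c0 px] := contentP x0; rewrite -(contentK x c0).
have nm := mobius_residue iu ntau; have f0 := factor_neq0 iu ntau.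
rewrite colact_scale !logvalE //; last exact: primitive_colact.
rewrite -lamM ?inE ?primitive_nonzero //; congr lam.
have [V1 V2 _] := px; have [-> ->] := red_colact iu V1 V2.
have e : factor u tau * mobius u tau =
    red (val u 0 1) + red (val u 1 1) * tau by rewrite mulrC /mobius divfK.
by rewrite mulrDr [_ * (_ * mobius _ _)]mulrCA e /factor; ring.
Qed.

(** ** The vertices of the tree, with a non-residue at each of them *)

Local Notation Theta := ((SL -> int) * (SL -> 'I_n.+2))%type.

Definition vm g := vmin (col1 g).
Definition lg tau g := logval tau (col1 g).

(** The coset of [y] modulo integral matrices on the left, together with [tau]
    transported by [mobius]. Instead of a quotient, a pair of functions encodes
    them: it depends on the coset only ([theta_left]) and separates the [tau]
    ([theta_inj]). The second function is normalised to vanish at 1, which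
    removes the factors of automorphy. *)
Definition theta y tau : Theta :=
  (fun g => vm (y * g)%g, fun g => lg tau (y * g)%g - lg tau y).

Definition theta_act h (t : Theta) : Theta :=
  (fun g => t.1 (h * g)%g, fun g => t.2 (h * g)%g - t.2 h).

Lemma flip_subproof : \det (mat2 0 (-1) 1 0 : 'M[F]_2) == 1.
Proof. by rewrite det_mx2 !mat2E mul0r sub0r mulr1 opprK. Qed.

Definition flip : SL := SpecialLinear flip_subproof.

Lemma col1_flip g : col1 (g * flip)%g = (val g 0 1, val g 1 1).
Proof. by rewrite /col1 /= !mulmx2E !mat2E !mulr0 !add0r !mulr1. Qed.

Lemma col1_1 : col1 1%g = (1, 0).
Proof. by rewrite /col1 !mxE. Qed.

Lemma col1_flip1 : col1 flip = (0, 1).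
Proof. by rewrite /col1 /= !mat2E. Qed.

(** The coordinate of [g] at a vertex compares the logarithms of the first column
    of [y] and of a column of minimal valuation of [y * g]; right multiplication
    by [flip] puts the second column in the first place. *)
Definition theta_log g (t : Theta) : 'I_n.+2 :=
  if t.1 g <= t.1 (g * flip)%g then t.2 g else t.2 (g * flip)%g.

Definition vertices : set Theta :=
  [set t | exists y tau, ~ residue tau /\ t = theta y tau]%classic.

Lemma theta_actE h y tau : theta_act h (theta y tau) = theta (y * h)%g tau.
Proof.
rewrite /theta_act /theta /=; congr (_, _); apply: funext => g.
  by rewrite mulgA.
by rewrite mulgA opprB addrA subrK.
Qed.

Lemma theta_act_stable h t : vertices t -> vertices (theta_act h t).
Proof.
by move=> [y [tau [nt ->]]]; rewrite theta_actE; exists (y * h)%g, tau.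
Qed.

Lemma theta_act1 t : vertices t -> theta_act 1%g t = t.
Proof. by move=> [y [tau [nt ->]]]; rewrite theta_actE mulg1. Qed.

Lemma theta_actM g h t : vertices t ->
  theta_act (g * h)%g t = theta_act h (theta_act g t).
Proof. by move=> [y [tau [nt ->]]]; rewrite !theta_actE mulgA. Qed.

Lemma theta_log_act h g t :
  theta_log g (theta_act h t) = theta_log (h * g)%g t - t.2 h.
Proof. by rewrite /theta_log /= !mulgA; case: ifP. Qed.

Lemma theta_log_mul h g t : vertices t -> theta_log (h * g)%g t - theta_log h t =
  theta_log g (theta_act h t) - theta_log 1%g (theta_act h t).
Proof.
by move=> _; rewrite !theta_log_act mulg1 opprB addrA subrK.
Qed.

Lemma theta_left u y tau : integral u -> ~ residue tau ->
  theta (u * y)%g tau = theta y (mobius u tau).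
Proof.
move=> iu nt; rewrite /theta /vm /lg; congr (_, _); apply: funext => g.
  by rewrite -mulgA (col1M u) vmin_colact ?col1_neq0.
rewrite -mulgA !(col1M u) !logval_colact ?col1_neq0 //.
by rewrite opprD addrACA subrr add0r.
Qed.

Lemma logval_primitive tau x : ~ residue tau -> primitive x ->
  logval tau x = lam (red x.1 + red x.2 * tau).
Proof.
move=> nt px; rewrite -(logvalE nt (oner_neq0 F) px).
by case: x {px} => a b; rewrite /vscale /= !mul1r.
Qed.

Lemma primitive1l x : x \in V -> primitive (1, x).
Proof. by move=> Vx; rewrite /primitive /= rpred1 red1 oner_neq0. Qed.

Lemma primitive1r x : x \in V -> primitive (x, 1).
Proof. by move=> Vx; rewrite /primitive /= rpred1 red1 oner_neq0 orbT. Qed.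

Lemma residue_neq0 s : ~ residue s -> s != 0.
Proof.
by move=> ns; apply: contra_notN ns => /eqP->; exists 0; rewrite ?rpred0 ?red0.
Qed.

Lemma residue_neqN1 s : ~ residue s -> 1 + s != 0.
Proof.
move=> ns; apply: contra_notN ns => /eqP e1.
have -> : s = - 1 by apply/eqP; rewrite -addr_eq0 addrC e1.
exact/residueN/residue1.
Qed.

(** The logarithm at the columns (1, 0), (0, 1), (1, 1) tells that [tau / tau'] and
    [(1 + tau) / (1 + tau')] are residues. *)
Lemma theta_inj y tau tau' : ~ residue tau -> ~ residue tau' ->
  theta y tau = theta y tau' -> tau = tau'.
Proof.
move=> nt nt' /(congr1 snd) e.
have E1 g : lg tau g - lg tau y = lg tau' g - lg tau' y.
  by have := congr1 (fun f : SL -> 'I_n.+2 => f (y^-1 * g)%g) e; rewrite /= mulgA mulgV mul1g.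
have lg1 s : ~ residue s -> lg s 1%g = 0.
  move=> ns; rewrite /lg col1_1 logval_primitive //=; last exact/primitive1l/rpred0.
  rewrite red1 red0 mul0r addr0; apply/lam_eq0; first exact: oner_neq0.
  exact: residue1.
have Eg g : lg tau g = lg tau' g.
  have := E1 1%g; rewrite !lg1 // !sub0r => /oppr_inj ey.
  by have := E1 g; rewrite ey => /addIr.
have ratio a b : a != 0 -> b != 0 -> lam a = lam b -> residue (a / b).
  move=> a0 b0 ab; apply/lam_eq0; first by rewrite mulf_neq0 ?invr_eq0.
  by apply: (addIr (lam b)); rewrite -lamM ?inE ?mulf_neq0 ?invr_eq0 // divfK // add0r.
have [r1 r2] : residue (tau / tau') /\ residue ((1 + tau) / (1 + tau')).
  split; apply: ratio; rewrite ?residue_neqN1 ?residue_neq0 //.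
    have := Eg flip; rewrite /lg col1_flip1.
    have p01 : primitive (0, 1) by apply/primitive1r/rpred0.
    rewrite (logval_primitive nt p01) (logval_primitive nt' p01) /=.
    by rewrite red0 red1 !add0r !mul1r.
  have d : \det (mat2 1 0 1 1 : 'M[F]_2) == 1.
    by rewrite det_mx2 !mat2E mulr1 mul0r subr0.
  have := Eg (SpecialLinear d); rewrite /lg (_ : col1 _ = (1, 1)); last first.
    by rewrite /col1 /= !mat2E.
  have p11 : primitive (1, 1) by apply/primitive1r/rpred1.
  by rewrite (logval_primitive nt p11) (logval_primitive nt' p11) /= red1 !mul1r.
set a := tau / tau' in r1; set b := _ / _ in r2.
have ea : tau = a * tau' by rewrite divfK // residue_neq0.
have eb : 1 + tau = b * (1 + tau') by rewrite divfK // residue_neqN1.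
have [/eqP e1 /eqP e2] : 1 - b = 0 /\ a - b = 0.
  apply: (residue_indep nt'); try by apply: residueB => //; apply: residue1.
  apply: (etrans (y := 1 + a * tau' - b * (1 + tau'))); first by ring.
  by rewrite -ea -eb subrr.
move: e1 e2; rewrite !subr_eq0 => /eqP e1 /eqP e2.
by rewrite ea e2 -e1 mul1r.
Qed.

(** ** Finiteness *)

Definition ball (m : int) (a : F) := (a == 0) || (m <= v a).

Lemma ball0 a : ball 0 a = (a \in V). Proof. by []. Qed.

Lemma ballN m a : ball m (- a) = ball m a.
Proof. by rewrite /ball oppr_eq0 nuN. Qed.

Lemma ballD m a b : ball m a -> ball m b -> ball m (a + b).
Proof.
rewrite /ball; have [->|a0] := eqVneq a 0; first by rewrite add0r.
have [->|b0] := eqVneq b 0; first by rewrite addr0 (negPf a0).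
have [//|ab0] := eqVneq (a + b) 0; rewrite /= => va vb.
by apply: le_trans (nuD v a0 b0 ab0); rewrite le_min va.
Qed.

Lemma ballB m a b : ball m a -> ball m b -> ball m (a - b).
Proof. by move=> ba bb; apply: ballD; rewrite ?ballN. Qed.

Lemma ballM m m' a b : ball m a -> ball m' b -> ball (m + m') (a * b).
Proof.
rewrite /ball; have [->|a0] := eqVneq a 0; first by rewrite mul0r eqxx.
have [->|b0] := eqVneq b 0; first by rewrite mulr0 eqxx.
by rewrite /= => va vb; rewrite nuM // lerD ?orbT.
Qed.

Lemma ball_le m m' a : m' <= m -> ball m a -> ball m' a.
Proof. by move=> mm /orP[/eqP->|va]; rewrite /ball ?eqxx // (le_trans mm va) orbT. Qed.

Lemma vmin_ball m x : x != (0, 0) -> m <= vmin x -> ball m x.1 /\ ball m x.2.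
Proof.
move=> x0 mx; have [c0 [V1 V2 _]] := contentP x0.
have bc : ball m (content x) by rewrite /ball mx orbT.
by split; [rewrite -(divfK c0 x.1)|rewrite -(divfK c0 x.2)];
  rewrite mulrC -[m]addr0; apply: ballM.
Qed.

(** [E] being finite, finitely many elements represent the residue field. *)
Lemma residue_approx : exists rs : seq F,
  forall x, x \in V -> exists2 r, r \in rs & ball 1 (x - r).
Proof.
pose rep e := xget 0 [set x | x \in V /\ red x = e]%classic.
exists [seq rep e | e <- enum E] => x Vx; exists (rep (red x)).
  by apply: map_f; rewrite mem_enum.
have [Vr er] : [set y | y \in V /\ red y = red x]%classic (rep (red x)).
  by apply: xgetPex; exists x.
have : red (x - rep (red x)) == 0.
  by rewrite redD ?rpredN // redN // er subrr.
by rewrite red_eq0 ?rpredB // /ball gtz0_ge1.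
Qed.

(** Successive approximation along the powers of a uniformizer. *)
Lemma approx (N : nat) : exists rs : seq F,
  forall x, x \in V -> exists2 r, r \in rs & ball N (x - r).
Proof.
have [pi pi0 vpi] := nu_normalized v.
have [ks kP] := residue_approx; elim: N => [|N [rs rsP]].
  by exists [:: 0] => x Vx; exists 0; rewrite ?mem_head // subr0.
exists [seq r + pi ^+ N * s | r <- rs, s <- ks] => x Vx.
have [r rs_r br] := rsP x Vx; have piN0 : pi ^+ N != 0 by rewrite expf_neq0.
have vpiN : v (pi ^+ N) = N by rewrite nuX // vpi natz.
have Vy : (x - r) / pi ^+ N \in V.
  rewrite -ball0 -(subrr (N : int)); apply: ballM => //.
  by rewrite /ball nuV // vpiN lexx orbT.
have [s ks_s bs] := kP _ Vy; exists (r + pi ^+ N * s).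
  by apply/allpairsP; exists (r, s).
have -> : x - (r + pi ^+ N * s) = pi ^+ N * ((x - r) / pi ^+ N - s).
  by rewrite mulrBr [pi ^+ N * (_ / _)]mulrC divfK // opprD addrA.
rewrite -addn1 PoszD; apply: ballM bs.
by rewrite /ball vpiN lexx orbT.
Qed.

Lemma approx_ball (M : nat) : exists rs : seq F,
  forall x, ball (- M%:Z) x -> exists2 r, r \in rs & ball M (x - r).
Proof.
have [pi pi0 vpi] := nu_normalized v.
have [rs rsP] := approx (M + M); exists [seq r / pi ^+ M | r <- rs] => x bx.
have piM0 : pi ^+ M != 0 by rewrite expf_neq0.
have vpiM : v (pi ^+ M) = M by rewrite nuX // vpi natz.
have [|r rs_r br] := rsP (pi ^+ M * x).
  rewrite -ball0 -(subrr (M : int)); apply: ballM => //.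
  by rewrite /ball vpiM lexx orbT.
exists (r / pi ^+ M); first exact: map_f.
have -> : x - r / pi ^+ M = (pi ^+ M * x - r) * (pi ^+ M)^-1.
  by rewrite mulrBl [pi ^+ M * x]mulrC mulfK.
rewrite (_ : M%:Z = (M + M)%N%:Z - M%:Z); last by rewrite PoszD addrK.
by apply: ballM => //; rewrite /ball nuV // vpiM lexx orbT.
Qed.

Definition bounded (m : int) y := forall i j, ball m (val y i j).

Lemma close_integral m y y' : bounded (- m) y ->
  (forall i j, ball m (val y' i j - val y i j)) -> integral (y' * y^-1)%g.
Proof.
move=> by_ close i j.
have e : val (y' * y^-1)%g = (val y' - val y) *m val (y^-1)%g + 1%:M.
  by rewrite mulmxBl -[X in _ - X]/(val (y * y^-1)%g) mulgV /= subrK.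
have [e1 e2 e3 e4] := sl2V y.
have byV : bounded (- m) y^-1%g.
  by apply: ord2P; apply: ord2P; rewrite ?e1 ?e2 ?e3 ?e4 ?ballN.
have bd a b : ball m ((val y' - val y) a b) by have := close a b; rewrite !mxE.
rewrite e mxE rpredD ?(integral1 i j) // mulmx2E.
by rewrite rpredD // -ball0 -(subrr m); apply: ballM.
Qed.

(** Two bounded matrices whose entries are close differ by an integral matrix on
    the left, and finitely many entries suffice up to a given distance. *)
Lemma bounded_finite (M : nat) : finite_set
  [set t | exists y tau, [/\ bounded (- M%:Z) y, ~ residue tau & t = theta y tau]]%classic.
Proof.
have [rs rsP] := approx_ball M.
pose near (c : F * F * (F * F)) y := [/\ bounded (- M%:Z) y,
  ball M (val y 0 0 - c.1.1), ball M (val y 0 1 - c.1.2),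
  ball M (val y 1 0 - c.2.1) & ball M (val y 1 1 - c.2.2)].
pose Y c := xget 1%g [set y | near c y]%classic.
pose rs2 := [seq (a, b) | a <- rs, b <- rs].
pose cs := [seq (a, b) | a <- rs2, b <- rs2].
apply: (@sub_finite_set _ _ [set` [seq theta (Y c) tau | c <- cs, tau <- enum E]]).
  move=> t [y [tau [by_ nt ->]]] /=.
  have [[[a ra ba] [b rb bb]] [[c rc bc] [d rd bd]]] :=
    ((rsP _ (by_ 0 0), rsP _ (by_ 0 1)), (rsP _ (by_ 1 0), rsP _ (by_ 1 1))).
  pose q := ((a, b), (c, d)).
  have [bY Ya Yb Yc Yd] : near q (Y q) by apply: xgetPex; exists y.
  have iu : integral (y * (Y q)^-1)%g.
    apply: close_integral bY _.
    have sub (e x x' : F) : ball M (x - e) -> ball M (x' - e) -> ball M (x - x').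
      by move=> h1 h2; rewrite (_ : x - x' = x - e - (x' - e)); [apply: ballB|ring].
    by apply: ord2P; apply: ord2P; [apply: (sub a)|apply: (sub b)|apply: (sub c)|apply: (sub d)].
  apply/allpairsP; exists (q, mobius (y * (Y q)^-1)%g tau); split => /=.
  - by apply/allpairsP; exists ((a, b), (c, d)); split => //; apply/allpairsP;
      [exists (a, b)|exists (c, d)].
  - by rewrite mem_enum.
  - by rewrite -theta_left // -mulgA mulVg mulg1.
exact: finite_seq.
Qed.

(** The linear forms of proportional vectors differ by a residue. *)
Lemma lam_collinear tau a b c d : ~ residue tau ->
  residue a -> residue b -> residue c -> residue d ->
  (a != 0) || (b != 0) -> (c != 0) || (d != 0) -> a * d = b * c ->
  lam (a + b * tau) = lam (c + d * tau).
Proof.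
move=> nt ra rb rc rd ab0 cd0 e.
have nz s t : residue s -> residue t -> (s != 0) || (t != 0) -> s + t * tau != 0.
  move=> rs rt st0; apply/eqP => /(residue_indep nt rs rt)[s0 t0].
  by move: st0; rewrite s0 t0 eqxx.
have [k rk [k0 ec ed]] : exists2 k, residue k & [/\ k != 0, c = k * a & d = k * b].
  have rdiv s t : residue s -> residue t -> residue (s / t).
    by move=> rs rt; apply: residueM => //; apply: residueV.
  have [a0|a0] := eqVneq a 0.
    move: ab0 e; rewrite a0 eqxx mul0r => /= b0 /esym/eqP.
    rewrite mulf_eq0 (negPf b0) /= => /eqP c0; move: cd0; rewrite c0 eqxx => /= d0.
    exists (d / b); first exact: rdiv.
    by rewrite mulf_neq0 ?invr_eq0 // mulr0 divfK.
  have ed : d = c / a * b.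
    by apply: (mulfI a0); rewrite e mulrA [a * _]mulrC divfK // mulrC.
  exists (c / a); first exact: rdiv.
  split => //; last by rewrite divfK.
  apply: contraTneq cd0 => ca0; rewrite ed ca0 mul0r eqxx orbF.
  by rewrite -(divfK a0 c) ca0 mul0r eqxx.
rewrite ec ed -mulrA -mulrDr lamM ?inE ?nz // (lam_eq0 k0).2 // add0r.
by [].
Qed.

(** Of the two columns of [y], one of minimal valuation. *)
Definition sel y := if vm y <= vm (y * flip)%g then y else (y * flip)%g.

Lemma theta_logE g y tau : theta_log g (theta y tau) = lg tau (sel (y * g)%g) - lg tau y.
Proof. by rewrite /theta_log /sel /= !mulgA; case: ifP. Qed.

Lemma sel_cases y : exists2 s, s = 1%g \/ s = flip & sel y = (y * s)%g.
Proof.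
rewrite /sel; case: ifP => _; last by exists flip; [right|].
by exists 1%g; [left|rewrite mulg1].
Qed.

Lemma vm_sel_le y : vm (sel y) <= vm y /\ vm (sel y) <= vm (y * flip)%g.
Proof. by rewrite /sel; case: (leP (vm y)) => [|/ltW]. Qed.

Lemma vm_ball m y : m <= vm (sel y) -> bounded m y.
Proof.
move=> my; have [le1 le2] := vm_sel_le y.
have [b1 b2] := vmin_ball (col1_neq0 y) (le_trans my le1).
have [b3 b4] := vmin_ball (col1_neq0 (y * flip)%g) (le_trans my le2).
by move: b3 b4; rewrite col1_flip => b3 b4; apply: ord2P; apply: ord2P.
Qed.

Lemma vm_sel_le0 y : vm (sel y) <= 0.
Proof.
rewrite leNgt; apply/negP; rewrite gtz0_ge1 => /vm_ball by_.
have iy : integral y by move=> i j; apply: ball_le (by_ i j).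
have r0 i j : red (val y i j) = 0.
  by apply/eqP; rewrite red_eq0 // gtz0_ge1; apply: by_.
by have /eqP := red_det iy; rewrite !r0 mul0r subrr eq_sym oner_eq0.
Qed.

(** If the selected columns of [y] and [y * g] have independent reductions,
    their determinant is, up to sign, an entry of [g]. *)
Lemma theta_log_bounded m g y tau : bounded m g -> ~ residue tau ->
  theta_log g (theta y tau) <> theta_log 1%g (theta y tau) -> bounded m y.
Proof.
move=> bg nt; rewrite !theta_logE mulg1 => neq; apply: vm_ball.
have [s s1 es] := sel_cases y; have [s' s1' es'] := sel_cases (y * g)%g.
have [p [[a b] [p0 pab e1]]] := content_decomp (col1_neq0 (sel y)).
have [p' [[c d] [p0' pcd e2]]] := content_decomp (col1_neq0 (sel (y * g)%g)).
have vp' : v p' <= 0 by rewrite -(vminE p0' pcd) -e2; apply: vm_sel_le0.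
move: neq; rewrite /vm /lg e1 e2 vminE // !logvalE //= => neq.
have [[/= V1 V2 px] [/= V1' V2' px']] := (pab, pcd).
have ad : red (a * d - b * c) != 0.
  apply: contra_notN neq => /eqP; rewrite redD ?rpredN ?rpredM // redN ?rpredM //.
  rewrite !redM // => /eqP; rewrite subr_eq0 => /eqP e; congr (_ - _).
  by apply/esym/lam_collinear => //; apply: residue_red.
have Vad : a * d - b * c \in V by rewrite rpredB ?rpredM.
have [ad0 vad _] := red_unit Vad ad.
have e : p * p' * (a * d - b * c) =
    (col1 s).1 * (col1 (g * s')%g).2 - (col1 s).2 * (col1 (g * s')%g).1.
  have -> : p * p' * (a * d - b * c) =
      (vscale p (a, b)).1 * (vscale p' (c, d)).2 -
      (vscale p (a, b)).2 * (vscale p' (c, d)).1 by rewrite /=; ring.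
  rewrite -e1 -e2 es es' -!(mulgA y).
  have := sl2_det y; rewrite !(col1M y) /colact /=.
  move: (val y 0 0) (val y 0 1) (val y 1 0) (val y 1 1) => y1 y2 y3 y4 dy.
  rewrite -[RHS]mul1r -dy; ring.
have {}bg : ball m (p * p' * (a * d - b * c)).
  rewrite e; have gs' : ball m (col1 (g * s')%g).1 /\ ball m (col1 (g * s')%g).2.
    by case: s1' => ->; rewrite ?mulg1 ?col1_flip; split; apply: bg.
  case: s1 => ->; rewrite ?col1_1 ?col1_flip1 [(_, _).1]/= [(_, _).2]/=.
    by rewrite mul1r mul0r subr0; case: gs'.
  by rewrite mul0r mul1r sub0r ballN; case: gs'.
move: bg; rewrite /ball !mulf_eq0 (negPf p0) (negPf p0') (negPf ad0) /=.
rewrite !nuM ?mulf_neq0 // vad addr0 => mp.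
by apply: le_trans mp _; rewrite gerDl.
Qed.

Lemma theta_log_finite g : finite_set
  [set t | vertices t /\ theta_log g t <> theta_log 1%g t]%classic.
Proof.
have [M bg] : exists M : nat, bounded (- M%:Z) g.
  pose w i j : nat := `|v (val g i j)|%N.
  pose M := (w 0%R 0%R + w 0%R 1%R + (w 1%R 0%R + w 1%R 1%R))%N.
  exists M; have le i j : (w i j <= M)%N -> ball (- M%:Z) (val g i j).
    by rewrite /w => le; rewrite /ball; apply/orP; right; lia.
  by apply: ord2P; apply: ord2P; apply: le; rewrite /M; lia.
apply: sub_finite_set (bounded_finite M) => t [[y [tau [nt ->]]] neq].
by exists y, tau; split => //; apply: theta_log_bounded bg nt neq.
Qed.

(** ** Fixed points of elements of order three *)

Lemma vm1 : vm 1%g = 0.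
Proof. by rewrite /vm col1_1 /vmin /content /= eqxx nu1. Qed.

Lemma vm_flip : vm flip = 0.
Proof. by rewrite /vm col1_flip1 /vmin /content /= oner_eq0 eqxx /= nu1. Qed.

(** A matrix fixing the vertex of [y] preserves all column valuations of [y], so
    its conjugate by [y] is integral. *)
Lemma fixed_integral c y tau : theta_act c (theta y tau) = theta y tau ->
  integral (y * c * y^-1)%g.
Proof.
rewrite theta_actE => /(congr1 fst) e i j; rewrite -ball0.
have {}e g : vm (y * c * y^-1 * g)%g = vm g.
  have := congr1 (fun f : SL -> int => f (y^-1 * g)%g) e.
  by rewrite /= !mulgA mulgV mul1g.
have vu := e 1%g; rewrite mulg1 vm1 in vu.
by apply: vm_ball; rewrite /sel vu e vm_flip lexx vu.
Qed.

Lemma diag_subproof (p : F) : p != 0 -> \det (mat2 p 0 0 p^-1) == 1.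
Proof. by move=> p0; rewrite det_mx2 !mat2E mulr0 subr0 divff. Qed.

Definition diag p (p0 : p != 0) : SL := SpecialLinear (diag_subproof p0).

Lemma diagV p (p0 : p != 0) (p0' : p^-1 != 0) : (diag p0 * diag p0' = 1)%g.
Proof.
apply: val_inj; rewrite /= mulmx_mat2 [RHS]mat2_eta !mxE /=.
by congr mat2; rewrite ?invrK ?mulr0 ?mul0r ?addr0 ?add0r ?divff ?mulVf.
Qed.

Section FixedPoints.
Variables (t : F) (t0 : t != 0).
Let c : SL := tri (divff t0).

(** Multiplying by diagonal matrices turns [c] into a matrix over the residue
    field with characteristic polynomial [x ^+ 2 + x + 1], which has no
    eigenvector there; so the lattice that it stabilises is unique up to scaling,
    and comparing determinants gives the parity of [v t]. *)
Lemma fixed_lattice y : integral (y * c * y^-1)%g ->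
  exists p, [/\ p != 0, v t = v p *+ 2 &
    forall q (q0 : q != 0), v q = v p -> integral (y * diag q0)%g].
Proof.
set u := (y * c * y^-1)%g => iu.
have uy : (u * y = y * c)%g by rewrite /u -mulgA mulVg mulg1.
have uyE i j : val u i 0 * val y 0 j + val u i 1 * val y 1 j =
    val y i 0 * val c 0 j + val y i 1 * val c 1 j.
  by rewrite -!mulmx2E -[val u *m _]/(val (u * y)%g) uy.
have E0 i : val u i 0 * (val y 0 0 * t) + val u i 1 * (val y 1 0 * t) = val y i 1.
  rewrite !mulrA -mulrDl uyE /= !mat2E mulr0 add0r divfK //.
have E1 i : val u i 0 * val y 0 1 + val u i 1 * val y 1 1 =
    - (val y i 0 * t) - val y i 1.
  by rewrite uyE /= !mat2E mulrN mulrN1.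
have dy := sl2_det y.
(* [a, b; cc, d] is [y] times the diagonal matrix of [t] and 1, divided by its
   content [p] *)
have [p [a [b [cc [d [p0 Vs [ea eb ec ed] nz]]]]]] : exists p a b cc d,
    [/\ p != 0, [/\ a \in V, b \in V, cc \in V & d \in V],
     [/\ val y 0 0 * t = p * a, val y 0 1 = p * b, val y 1 0 * t = p * cc &
       val y 1 1 = p * d] &
     ~ [/\ red a = 0, red b = 0, red cc = 0 & red d = 0]].
  have n1 : (val y 0 0 * t, val y 1 0 * t) != (0, 0).
    by have := col1_neq0 y; rewrite /col1 !xpair_eqE !mulf_eq0 (negPf t0) !orbF.
  have n2 : (val y 0 1, val y 1 1) != (0, 0) by rewrite -col1_flip col1_neq0.
  have [p1 [[a1 c1] [p10 [/= Va Vc r1] [ea ec]]]] := content_decomp n1.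
  have [p2 [[b2 d2] [p20 [/= Vb Vd r2] [eb ed]]]] := content_decomp n2.
  have quo q q' : q != 0 -> q' != 0 -> v q <= v q' -> q' / q \in V.
    by move=> q0 q0' le; rewrite valuation_ringE nuM ?invr_eq0 // nuV // subr_ge0 le orbT.
  have [le|/ltW le] := leP (v p1) (v p2).
    have Vq := quo _ _ p10 p20 le.
    exists p1, a1, (p2 / p1 * b2), c1, (p2 / p1 * d2); split => //.
    - by split => //; apply: rpredM.
    - by split; rewrite // mulrA [p1 * _]mulrC divfK.
    - by move=> [ra _ rc _]; move: r1; rewrite ra rc eqxx.
  have Vq := quo _ _ p20 p10 le.
  exists p2, (p1 / p2 * a1), b2, (p1 / p2 * c1), d2; split => //.
  - by split => //; apply: rpredM.
  - by split; rewrite // mulrA [p2 * _]mulrC divfK.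
  - by move=> [_ rb _ rd]; move: r2; rewrite rb rd eqxx.
have [Va Vb Vc Vd] := Vs.
have e1 : val u 0 0 * a + val u 0 1 * cc = b.
  by apply: (mulfI p0); rewrite -eb -E0 ea ec; ring.
have e2 : val u 0 0 * b + val u 0 1 * d = - a - b.
  by apply: (mulfI p0); rewrite mulrBr mulrN -ea -eb -E1 eb ed; ring.
have e3 : val u 1 0 * a + val u 1 1 * cc = d.
  by apply: (mulfI p0); rewrite -ed -E0 ea ec; ring.
have e4 : val u 1 0 * b + val u 1 1 * d = - cc - d.
  by apply: (mulfI p0); rewrite mulrBr mulrN -ec -ed -E1 eb ed; ring.
have Vdet : a * d - b * cc \in V by rewrite rpredB ?rpredM.
have nz_det : red (a * d - b * cc) != 0.
  apply/eqP => r0; apply: nz.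
  have sq x x' : x \in V -> x' \in V -> red (x ^+ 2 + x * x' + x' ^+ 2) = 0 ->
      red x = 0 /\ red x' = 0.
    move=> Vx Vx' e; apply: norm_form_anisotropic; try exact: residue_red.
    by move: e; rewrite !redD ?rpredD ?rpredM ?rpredX // !expr2 !redM.
  have [ra rb] : red a = 0 /\ red b = 0.
    apply: sq => //.
    have -> : a ^+ 2 + a * b + b ^+ 2 = - val u 0 1 * (a * d - b * cc).
      apply: (etrans (y := - (a * (- a - b) - b * b))); first by ring.
      by rewrite -{2}e1 -e2; ring.
    by rewrite redM ?rpredN // r0 mulr0.
  have [rc rd] : red cc = 0 /\ red d = 0.
    apply: sq => //.
    have -> : cc ^+ 2 + cc * d + d ^+ 2 = val u 1 0 * (a * d - b * cc).
      apply: (etrans (y := - (cc * (- cc - d) - d * d))); first by ring.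
      by rewrite -{2}e3 -e4; ring.
    by rewrite redM // r0 mulr0.
  by split.
have [det0 vdet _] := red_unit Vdet nz_det.
have et : t = p * p * (a * d - b * cc).
  transitivity ((val y 0 0 * val y 1 1 - val y 0 1 * val y 1 0) * t).
    by rewrite dy mul1r.
  transitivity ((val y 0 0 * t) * val y 1 1 - val y 0 1 * (val y 1 0 * t)).
    by ring.
  by rewrite ea eb ec ed; ring.
have vt : v t = v p *+ 2 by rewrite et !nuM ?mulf_neq0 // vdet addr0 mulr2n.
exists p; split => // q q0 vq.
have Vr : p * q / t \in V.
  by rewrite valuation_ringE !nuM ?mulf_neq0 ?invr_eq0 // nuV // vt vq mulr2n subrr lexx orbT.
have Vr' : p / q \in V by rewrite valuation_ringE nuM ?invr_eq0 // nuV // vq subrr lexx orbT.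
have y0E i x : val y i 0 * t = p * x -> val y i 0 * q = p * q / t * x.
  by move=> e; apply: (mulIf t0); rewrite mulrAC e; field.
apply: ord2P; apply: ord2P; rewrite /= mulmx2E !mat2E ?mulr0 ?addr0 ?add0r.
- by rewrite (y0E _ _ ea) rpredM.
- by rewrite eb mulrAC rpredM.
- by rewrite (y0E _ _ ec) rpredM.
- by rewrite ed mulrAC rpredM.
Qed.

Definition fixed_vertices : set Theta :=
  [set th | [/\ vertices th, theta_act c th = th &
               theta_log c th <> theta_log 1%g th]]%classic.

(** The order three matrix fixes a single vertex of the whole tree; it lies in the
    orbit of the standard vertex exactly when the valuation of [t] is even. *)
Lemma fixed_odd : (forall m : int, v t <> m *+ 2) -> fixed_vertices = set0.
Proof.
move=> odd; apply/seteqP; split => // th [[y [tau [nt ->]]] e _].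
have [p [_ vt _]] := fixed_lattice (fixed_integral e).
by case: (odd (v p)).
Qed.

(** On the non-residues over the fixed vertex, the matrix acts as the homography of
    an element of order three over the residue field; the fixed points are the
    two primitive cube roots of unity, up to the scaling by [red e]. *)
Lemma fixed_even p : p != 0 -> v t = v p *+ 2 ->
  exists th1 th2, th1 <> th2 /\ fixed_vertices = [set th1; th2]%classic.
Proof.
move=> p0 vt; have p0' : p^-1 != 0 by rewrite invr_eq0.
pose y0 := diag p0'; pose e := t / (p * p).
have e0 : e != 0 by rewrite !mulf_neq0 ?invr_eq0 ?mulf_neq0.
have ve : v e = 0.
  rewrite /e nuM ?invr_eq0 ?mulf_neq0 // nuV ?mulf_neq0 // nuM // vt mulr2n.
  by rewrite subrr.
have [Ve re0] := unit_red e0 ve; have [_ _ Ve'] := red_unit Ve re0.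
pose u0 : SL := tri (divff e0).
have iu0 : integral u0.
  by apply: ord2P; apply: ord2P; rewrite /= !mat2E ?rpredN ?rpred0 ?rpred1.
have y0c : (y0 * c = u0 * y0)%g.
  apply: val_inj; rewrite /= !mulmx_mat2 /e.
  by congr mat2; rewrite ?invrK ?mul0r ?mulr0 ?add0r ?addr0 //; field; rewrite ?p0 ?t0.
have re1 : red e^-1 = (red e)^-1.
  by apply: (mulfI re0); rewrite -redM // !divff.
have fac s : factor u0 (red e * s) = s.
  by rewrite /factor /= !mat2E red0 add0r re1 mulKf.
have nre s : ~ residue s -> ~ residue (red e * s).
  move=> ns r; apply: ns; rewrite -(mulKf re0 s).
  by apply: residueM => //; apply/residueV/residue_red.
have mob s : s ^+ 2 + s + 1 = 0 -> s != 0 -> mobius u0 (red e * s) = red e * s.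
  move=> s3 s0; rewrite /mobius fac /= !mat2E !redN ?rpred1 // red1.
  apply: (mulIf s0); rewrite divfK //; apply/eqP; rewrite -subr_eq0.
  have -> : - red e + -1 * (red e * s) - red e * s * s = - red e * (s ^+ 2 + s + 1).
    by ring.
  by rewrite s3 mulr0.
pose w := - 1 - z; have w3 : w ^+ 2 + w + 1 = 0 by rewrite -z3 /w; ring.
have nw : ~ residue w.
  move=> rw; apply: z_res; rewrite (_ : z = - 1 - w); last by rewrite /w; ring.
  by apply: residueB => //; apply/residueN/residue1.
have zw : z <> w.
  move=> e1; have r2 : residue (1 + 1).
    by rewrite -[X in _ + X]opprK; apply: residueB; [|apply: residueN]; apply: residue1.
  have e2 : 1 + (1 + 1) * z = 0 by rewrite mulrDl mul1r {2}e1 /w; ring.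
  by have [/eqP] := residue_indep z_res residue1 r2 e2; rewrite oner_eq0.
exists (theta y0 (red e * z)); exists (theta y0 (red e * w)); split.
  by move=> /(theta_inj (nre _ z_res) (nre _ nw)) /(mulfI re0).
apply/seteqP; split => [th [[y [tau [nt ->]]] fix_ _]|].
  have [q [q0 vt' iq]] := fixed_lattice (fixed_integral fix_).
  have vpq : v p = v q by move: vt'; rewrite vt; lia.
  have [k ik ey] : exists2 k, integral k & y = (k * y0)%g.
    by exists (y * diag p0)%g; [apply: iq|rewrite -mulgA diagV mulg1].
  set s := mobius k tau; have ns : ~ residue s by apply: mobius_residue.
  move: fix_; rewrite theta_actE ey -mulgA y0c !(theta_left _ ik nt) -/s.
  rewrite (theta_left _ iu0 ns).
  move=> /(theta_inj (mobius_residue iu0 ns) ns) es.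
  pose x := s / red e; have sx : s = red e * x by rewrite mulrC divfK.
  have nx : ~ residue x.
    by move=> rx; apply: ns; rewrite sx; apply: residueM => //; apply: residue_red.
  have x0 := residue_neq0 nx.
  have x3 : x ^+ 2 + x + 1 = 0.
    move: es; rewrite sx /mobius fac /= !mat2E !redN ?rpred1 // red1.
    move=> es; apply: (mulfI re0); rewrite mulr0.
    have := congr1 (fun r => r * x) es; rewrite /= divfK // => e2.
    apply: (etrans (y := red e * x * x - (- red e + - 1 * (red e * x)))).
      by ring.
    by rewrite e2 subrr.
  have /eqP : (x - z) * (x - w) = 0.
    have -> : (x - z) * (x - w) = x ^+ 2 + x + 1 - (z ^+ 2 + z + 1).
      by rewrite /w; ring.
    by rewrite x3 z3 subrr.
  by rewrite mulf_eq0 !subr_eq0 => /orP[]/eqP ex; [left|right]; rewrite /= sx ex.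
have fixed s : s ^+ 2 + s + 1 = 0 -> ~ residue s ->
    fixed_vertices (theta y0 (red e * s)).
  move=> s3 ns; have s0 := residue_neq0 ns; have nrs := nre _ ns.
  have fix_ : theta_act c (theta y0 (red e * s)) = theta y0 (red e * s).
    by rewrite theta_actE y0c theta_left // mob.
  split => //; first by exists y0, (red e * s).
  have := theta_log_act c 1%g (theta y0 (red e * s)); rewrite fix_ mulg1 => -> eq1.
  apply: ns; apply/lam_eq0 => //.
  have : lg (red e * s) (y0 * c)%g - lg (red e * s) y0 = 0.
    by move/eqP: eq1; rewrite -subr_eq0 opprB addrC subrK => /eqP.
  by rewrite y0c /lg col1M logval_colact ?col1_neq0 // fac mob // addrK.
by move=> _ [] ->; apply: fixed.
Qed.

End FixedPoints.

Hypothesis three : (3 %| n.+2)%N.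

(** The transfer for the decorated vertices: an element that maps to [tri t] has
    two fixed points that count if the valuation of [t] is even, and none if it
    is odd. *)
Theorem tree_functional (G : groupType) (h : G -> SL) :
  {morph h : x y / (x * y)%g} ->
  exists phi : {additive group_homology G 3 -> 'I_n.+2},
    forall (t : F) (t0 : t != 0) (g : G) (g3 : (g * (g * g) = 1)%g),
      h g = tri (divff t0) ->
      ((forall m : int, v t <> m *+ 2) -> phi (order3_class g3) = 0) /\
      (forall p, p != 0 -> v t = v p *+ 2 ->
         phi (order3_class g3) = third n *+ 2).
Proof.
move=> hM; have [phi phiE] := transfer_functional hM theta_act_stable theta_act1
  theta_actM theta_log_mul theta_log_finite three.
exists phi => t t0 g g3 hg; rewrite phiE hg -/(fixed_vertices t0).
split => [odd|p p0 vt]; first by rewrite fixed_odd // fset_set0 cardfs0.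
have [th1 [th2 [neq ->]]] := fixed_even t0 p0 vt.
rewrite fset_setU ?fset_set1 ?cardfs2 //.
by move/eqP: neq => ->.
Qed.

End Tree.

(** * Residue fields *)

Lemma finite_field_of (T : comNzRingType) : finite_set [set: T]%classic ->
  (forall x : T, x != 0 -> exists y, y * x = 1) ->
  exists (k : finFieldType) (f : {rmorphism T -> k}),
    bijective f /\ #|k| = #|` fset_set [set: T]%classic|.
Proof.
move=> finT invT.
pose s := enum_fset (fset_set [set: T]%classic).
have us : uniq s by apply: fset_uniq.
have ms x : x \in s by rewrite in_fset_set // inE.
have /choice[inv invP] (x : T) : exists y, x != 0 -> y * x = 1.
  by have [->|/invT[y yx]] := eqVneq x 0; [exists 0|exists y].
pose inv' x := if x == 0 then 0 else inv x.
have mulV x : x != 0 -> inv' x * x = 1.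
  by move=> x0; rewrite /inv' (negPf x0) invP.
have inv0 : inv' 0 = 0 by rewrite /inv' eqxx.
have pickleK : pcancel (index^~ s) (onth s).
  by move=> x; rewrite /= onthE (nth_map x) ?index_mem // nth_index.
pose Mc := isCountable.Build T pickleK.
have finP : Finite.axiom s by move=> x; rewrite count_uniq_mem // ms.
pose Mf := isFinite.Build T finP.
pose Mi := GRing.ComNzRing_isField.Build T mulV inv0.
pose k : finFieldType := HB.pack T Mc Mf Mi.
pose f : {rmorphism T -> k} := (idfun : {rmorphism T -> T}).
exists k, f; split; first by exists idfun.
by rewrite cardE enumT unlock /=.
Qed.

Section ResidueField.
Variables (F : fieldExtType rat) (v : finite_prime F).
Local Notation V := (in_valuation_ring v).
Local Notation pi := (\pi_(residue_field v)%qT).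

Lemma pi_eq0 (a : valuation_ring v) :
  (pi a == 0) = (val a == 0) || (0 < v (val a)).
Proof. by rewrite -[0](rmorph0 pi) -Quotient.idealrBE subr0. Qed.

Lemma residue_field_inv (x : residue_field v) : x != 0 -> exists y, y * x = 1.
Proof.
elim/quotW: x => a; rewrite pi_eq0 negb_or => /andP[a0 va].
have va0 : v (val a) = 0.
  apply/eqP; rewrite eq_le leNgt va /=.
  by have := vringP a; rewrite unfold_in /in_valuation_ring (negPf a0).
have Va' : (val a)^-1 \in V by rewrite valuation_ringE nuV // va0 oppr0 lexx orbT.
exists (pi (ValuationRing Va')); rewrite -rmorphM -(rmorph1 pi); congr (pi _).
by apply: val_inj; rewrite rmorphM rmorph1 /= mulVf.
Qed.

(** The reduction map of [v], extended by 0 to the whole of [F]. *)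
Lemma reduction_map : finite_set [set: residue_field v]%classic ->
  exists (k : finFieldType) (red : F -> k), [/\ #|k| = residue_card v,
    {in V &, {morph red : x y / x + y}}, {in V &, {morph red : x y / x * y}},
    red 1 = 1 &
    (forall x, x \in V -> (red x == 0) = ((x == 0) || (0 < v x))) /\
    (forall e, exists2 x, x \in V & red x = e)].
Proof.
move=> finR; have [k [f [[f' fK f'K] cardk]]] := finite_field_of finR residue_field_inv.
pose red x : k := if insub x is Some a then f (pi (a : valuation_ring v)) else 0.
have redE (a : valuation_ring v) : red (val a) = f (pi a).
  by rewrite /red valK.
have redV x (Vx : x \in V) : red x = f (pi (ValuationRing Vx)).
  exact: redE (ValuationRing Vx).
exists k, red; split; [by []| | | |split].
- move=> x y Vx Vy; rewrite (redV x Vx) (redV y Vy) -!rmorphD.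
  by rewrite -redE; congr red; rewrite rmorphD.
- move=> x y Vx Vy; rewrite (redV x Vx) (redV y Vy) -!rmorphM.
  by rewrite -redE; congr red; rewrite rmorphM.
- by rewrite -[1 in LHS](rmorph1 (val : valuation_ring v -> F)) redE !rmorph1.
- by move=> x Vx; rewrite redV -(rmorph0 f) (inj_eq (can_inj fK)) pi_eq0.
- move=> e; exists (val (repr (f' e))); first exact: vringP.
  by rewrite redE reprK f'K.
Qed.

End ResidueField.

Lemma card_finField_natr (k : finFieldType) : #|k|%:R = 0 :> k.
Proof.
have : \sum_(x : k) x = \sum_(x : k) (x + 1) := reindex_inj (addIr (1 : k)).
rewrite big_split /= sumr_const -[LHS]addr0 => /addrI/esym e.
by rewrite -[RHS]e; congr (_ *+ _); apply: eq_card.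
Qed.

Lemma finField_neq3 (k : finFieldType) : #|k| = 2 %[mod 3] -> 3%:R != 0 :> k.
Proof.
move=> q2; apply/eqP => k3; have := card_finField_natr k.
rewrite (divn_eq #|k| 3) q2 natrD natrM k3 mulr0 add0r => k2.
have /eqP : 1 = 0 :> k by rewrite -[RHS]k3 -addn1 natrD k2 add0r.
by rewrite oner_eq0.
Qed.

Lemma finField_root_image (k E : finFieldType) (f : {rmorphism k -> E}) e :
  e ^+ #|k| = e -> exists a, f a = e.
Proof.
move=> eq; have /(congr1 (fun p => (map_poly f p).[e])) := finField_genPoly k.
rewrite rmorphB /= map_polyXn map_polyX !hornerE eq subrr rmorph_prod.
rewrite horner_prod => /esym/eqP/prodf_eq0[a _].
by rewrite rmorphB /= map_polyX map_polyC !hornerE subr_eq0 => /eqP ->; exists a.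
Qed.

(** As the residue field [k] has order 2 modulo 3, it has no primitive cube root of
    unity. The homomorphism [lam] is the logarithm of the power of exponent
    [#|k| - 1], whose kernel consists of the units of [k]. *)
Theorem inert_functional (F : fieldExtType rat) (v : finite_prime F)
    (G : groupType) (h : G -> special_linear 2 F) :
  (residue_card v = -1 %[mod 3])%Z -> {morph h : x y / (x * y)%g} ->
  exists n (phi : {additive group_homology G 3 -> 'I_n.+2}),
    (3 %| n.+2)%N /\
    forall (t : F) (t0 : t != 0) (g : G) (g3 : (g * (g * g) = 1)%g),
      h g = tri (divff t0) ->
      ((forall m : int, v t <> m *+ 2) -> phi (order3_class g3) = 0) /\
      (forall p, p != 0 -> v t = v p *+ 2 ->
         phi (order3_class g3) = third n *+ 2).
Proof.
move=> hq hM.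
have q2 : residue_card v = 2 %[mod 3].
  by move: hq; rewrite modz_nat => -[].
have finR : finite_set [set: residue_field v]%classic.
  apply: contrapT => infR; move: q2.
  by rewrite /residue_card /fset_set; case: pselect.
have [k [red [cardk redD redM red1 [red_eq0 red_surj]]]] := reduction_map finR.
have [E [f [z z3]]] := cube_root_extension k.
rewrite -cardk in q2; have k3 := finField_neq3 q2.
have E3 : 3%:R != 0 :> E by rewrite -(rmorph_nat f) fmorph_eq0.
have [n Ecard] := card_ge3 z3 E3.
have [L [LM L_inj]] := finField_log Ecard.
have three := cube_root_dvd3 LM L_inj z3 E3.
have q1 : #|k| = #|k|.-1.+1 by rewrite prednK // (cardD1 0).
pose fred x := f (red x); pose lam e := L (e ^+ #|k|.-1).
have fredP e : residue v fred e <-> exists a, f a = e.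
  split=> [[x _ <-]|[a <-]]; first by exists (red x).
  by have [x Vx <-] := red_surj a; exists x.
have expk (a : k) : a != 0 -> a ^+ #|k|.-1 = 1.
  by move=> a0; apply: (mulfI a0); rewrite -exprS -q1 expf_card mulr1.
have [|||||||phi phiP] := @tree_functional F v E fred n lam z _ _ _ _ _ _ z3 _ three G h hM.
- by move=> x y Vx Vy; rewrite /fred redD // rmorphD.
- by move=> x y Vx Vy; rewrite /fred redM // rmorphM.
- by rewrite /fred red1 rmorph1.
- by move=> x Vx; rewrite /fred fmorph_eq0 red_eq0.
- move=> x y x0 y0; rewrite /lam exprMn LM ?inE ?expf_neq0 //.
- move=> e e0; rewrite fredP /lam; split=> [/L_inj e1|[a ea]].
    by apply: finField_root_image; rewrite q1 exprS e1 ?mulr1 ?expf_neq0.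
  by rewrite -ea -rmorphXn expk ?rmorph1 ?(log1 LM) // -(fmorph_eq0 f) ea.
- move=> /fredP[a fa].
  have a3 : a ^+ 2 + a + 1 = 0.
    by apply: (fmorph_inj f); rewrite !rmorphD rmorphXn rmorph1 rmorph0 fa.
  have := expk a (cube_root_neq0 a3).
  have -> : #|k|.-1 = (#|k| %/ 3 * 3 + 1)%N.
    by rewrite {1}(divn_eq #|k| 3) q2 addn2 addn1.
  rewrite exprD mulnC exprM (cube_root_expr3 a3) expr1n mul1r expr1 => a1.
  by move: (cube_root_neq1 a3 k3); rewrite a1 eqxx.
by exists n, phi.
Qed.

(** * Arithmetic of the ring of integers *)

Section IntegersOfF.
Variable F : fieldExtType rat.
Local Notation O := (@ring_of_integers F).

Lemma intF_inj : injective (intr : int -> F).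
Proof.
move=> m n; rewrite -!(rmorph_int (in_alg F)) => /fmorph_inj; exact: intr_inj.
Qed.

Lemma intF_eq0 (m : int) : (m%:~R == 0 :> F) = (m == 0).
Proof. by rewrite -(inj_eq intF_inj) rmorph0. Qed.

Lemma O_int (m : int) : O m%:~R.
Proof. exact: integral_id. Qed.

Lemma O_opp x : O x -> O (- x). Proof. exact: integral_opp. Qed.
Lemma O_sub x y : O x -> O y -> O (x - y). Proof. exact: integral_sub. Qed.
Lemma O_exp x n : O x -> O (x ^+ n).
Proof.
by move=> Ox; elim: n => [|n IH]; [exact: O_1|rewrite exprS; apply: O_mul].
Qed.

(** Divide a monic equation of [x] by a power of [x]. *)
Lemma integral_inv_relation (x : F) : x != 0 -> O x ->
  exists h : {poly int}, 1 = x^-1 * (map_poly intr h).[x^-1].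
Proof.
move=> x0 [p mp /rootP px].
have [n sp] : exists n, size p = n.+1.
  by exists (size p).-1; rewrite prednK // size_poly_gt0 monic_neq0.
exists (\poly_(j < n) - p`_(n.-1 - j)).
have pn : p`_n = 1 by have := monicP mp; rewrite /lead_coef sp.
have e : x ^- n * (map_poly intr p).[x] = 0 by rewrite px mulr0.
move: e; rewrite horner_coef size_map_poly_id0 ?sp; last first.
  by rewrite (monicP mp) oner_eq0.
rewrite big_ord_recr /= mulrDr coef_map pn mul1r mulVf ?expf_neq0 //.
move/eqP; rewrite addrC addr_eq0 => /eqP e1; rewrite [LHS]e1.
rewrite (@horner_coef_wide _ n); last first.
  by apply: leq_trans (size_poly _ _) _; apply: size_poly.
rewrite [in RHS](reindex_inj rev_ord_inj) /= !mulr_sumr -sumrN.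
apply: eq_bigr => i _; rewrite !coef_map /= coef_poly.
have lti := ltn_ord i; rewrite ifT; last by lia.
have -> : (n.-1 - (n - i.+1) = i)%N by lia.
rewrite mulrNz mulNr mulrN; congr (- _).
rewrite mulrCA [RHS]mulrCA; congr (_ * _).
have -> : (n - i.+1 = (n - i).-1)%N by lia.
rewrite -exprS prednK ?subn_gt0 // -exprVn -{1}(subnK (ltnW lti)) exprD -mulrA.
by rewrite -exprMn mulVf // expr1n mulr1.
Qed.

(** If [x] had negative valuation, its inverse would divide 1 in the valuation
    ring. *)
Lemma O_valuation (v : finite_prime F) x : O x -> x \in in_valuation_ring v.
Proof.
move=> Ox; apply: contraT; rewrite valuation_ringE negb_or -ltNge => /andP[x0 vx].
have [h e] := integral_inv_relation x0 Ox.
have Vx : x^-1 \in in_valuation_ring v.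
  by rewrite valuation_ringE nuV // oppr_ge0 ltW // orbT.
have Vh : (map_poly intr h).[x^-1] \in in_valuation_ring v.
  rewrite horner_coef; apply: rpred_sum => i _.
  by rewrite coef_map rpredM ?rpredX // rpred_int.
have : ball v 1 (1 : F).
  rewrite e -[1]addr0; apply: ballM => //.
  by rewrite /ball nuV // -gtz0_ge1 oppr_gt0 vx orbT.
by rewrite /ball oner_eq0 nu1.
Qed.

Lemma O_inv_nat (l : nat) : (1 < l)%N -> ~ O (l%:R^-1).
Proof.
move=> l1 Ol; have l0 : l%:R^-1 != 0 :> F.
  by rewrite invr_eq0 -[l%:R]/(l%:~R) intF_eq0; lia.
have [h] := integral_inv_relation l0 Ol; rewrite invrK.
rewrite -[l%:R]/(l%:Z%:~R) horner_map -rmorphM => /= e.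
have {e} : 1 = l%:Z * h.[l%:Z] by apply: intF_inj; rewrite -e.
move=> /(congr1 absz)/esym/eqP; rewrite abszM muln_eq1 => /andP[/eqP l1' _].
by move: l1; rewrite -[l]/(absz l%:Z) l1'.
Qed.

Lemma O_fraction (x : F) : exists2 c : int, c != 0 & O (c%:~R * x).
Proof.
have [q q0 qx] : exists2 q : {poly int}, q != 0 & root (map_poly intr q) x.
  have /polyOver1P[p ep] := minPolyOver 1%AS x.
  have [q [a a0 pq]] := rat_poly_scale p.
  have eq1 : map_poly intr q = a%:~R *: p.
    by rewrite pq scalerA mulfV ?scale1r // intr_eq0.
  have eq2 : map_poly intr q = map_poly (in_alg F) (map_poly intr q).
    by rewrite -map_poly_comp; apply: eq_map_poly => m /=; rewrite scaler_int.
  exists q.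
    apply: contraTneq (monic_neq0 (monic_minPoly 1%AS x)) => q0.
    by rewrite ep pq q0 rmorph0 scaler0 rmorph0 eqxx.
  by rewrite eq2 eq1 map_polyZ -ep rootE hornerZ minPolyxx mulr0.
have [n sq] : exists n, size q = n.+1.
  by exists (size q).-1; rewrite prednK // size_poly_gt0.
pose c := q`_n; have c0 : c != 0 by rewrite -[c]/(q`_n) -[n]/(n.+1.-1) -sq lead_coef_eq0.
exists c => //.
have n0 : (0 < n)%N.
  case: n sq @c c0 => // sq c c0; move: qx; rewrite rootE horner_coef.
  rewrite size_map_inj_poly ?sq ?big_ord1 ?coef_map ?expr0 ?mulr1 //; last exact: intF_inj.
  by rewrite intF_eq0 (negPf c0).
exists (\poly_(i < n.+1) (if i == n then 1 else q`_i * c ^+ (n.-1 - i))).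
  apply/monicP; rewrite lead_coef_poly ?eqxx //; exact: oner_neq0.
rewrite rootE; apply/eqP.
have qx0 : c%:~R ^+ n.-1 * (map_poly intr q).[x] = 0 by rewrite (rootP qx) mulr0.
rewrite -[RHS]qx0 (@horner_coef_wide _ n.+1); last first.
  by apply: leq_trans (size_poly _ _) _; apply: size_poly.
rewrite (@horner_coef_wide _ n.+1 (map_poly intr q)); last first.
  by apply: leq_trans (size_poly _ _) _; rewrite sq.
rewrite mulr_sumr; apply: eq_bigr => i _; rewrite !coef_map /= coef_poly ltn_ord.
rewrite exprMn; have [->|ni] := eqVneq (i : nat) n.
  by rewrite -/c mul1r mulrA -exprSr prednK.
have lt_in : (i <= n.-1)%N by have := ltn_ord i; lia.
rewrite rmorphM rmorphXn /= -!mulrA [RHS]mulrCA; congr (_ * _).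
by rewrite mulrA -exprD subnK.
Qed.

(** ** Finite quotients of subrings *)

Section FiniteQuotient.
Variable R : set F.
Hypothesis R1 : R 1.
Hypothesis RB : forall x y, R x -> R y -> R (x - y).
Hypothesis RM : forall x y, R x -> R y -> R (x * y).

Lemma subring_0 : R 0. Proof. by rewrite -(subrr 1); apply: RB. Qed.
Lemma subring_N x : R x -> R (- x).
Proof. by move=> Rx; rewrite -sub0r; apply: RB => //; apply: subring_0. Qed.
Lemma subring_D x y : R x -> R y -> R (x + y).
Proof. by move=> Rx Ry; rewrite -[y]opprK; apply: RB => //; apply: subring_N. Qed.
Lemma subring_mulz x (m : int) : R x -> R (x *~ m).
Proof.
have Rmuln y k : R y -> R (y *+ k).
  by move=> Ry; elim: k => [|k IH]; rewrite ?mulr0n ?mulrS; [exact: subring_0|apply: subring_D].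
by case: m => k Rx; [apply: Rmuln|rewrite NegzE mulrNz; apply/subring_N/Rmuln].
Qed.
Lemma subring_sum (I : Type) (r : seq I) (f : I -> F) :
  (forall i, R (f i)) -> R (\sum_(i <- r) f i).
Proof. by move=> Rf; elim/big_ind: _ => //; [exact: subring_0|exact: subring_D]. Qed.

Definition indep_mod (l : nat) (us : seq F) :=
  (forall i, R us`_i) /\
  forall c : nat -> int, R ((\sum_(i < size us) us`_i *~ c i) / l%:R) ->
    forall i : 'I_(size us), (l %| c i)%Z.

(** An integral relation could be divided by [l] indefinitely. *)
Lemma indep_mod_free (l : nat) (us : seq F) : (1 < l)%N -> indep_mod l us -> free us.
Proof.
move=> l1 [_ ind].
have l0 : (l%:Z != 0) by lia.
have div_all k (c : nat -> int) : \sum_(i < size us) us`_i *~ c i = 0 ->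
    forall i : 'I_(size us), (l%:Z ^+ k %| c i)%Z.
  elim: k c => [|k IH] c c0 i; first by rewrite expr0 dvd1z.
  have dv j : (j < size us)%N -> (l %| c j)%Z.
    by move=> js; apply: (ind c _ (Ordinal js)); rewrite c0 mul0r; apply: subring_0.
  pose c' j := (c j %/ l)%Z.
  have cE j : (j < size us)%N -> c j = c' j * l by move=> /dv/divzK.
  rewrite cE // exprSr; apply: dvdz_mul => //; apply: IH.
  apply: (mulIf (_ : l%:~R != 0 :> F)); first by rewrite intF_eq0.
  rewrite mul0r mulr_suml -[RHS]c0; apply: eq_bigr => j _.
  by rewrite [in RHS]cE // mulrzA mulrzr.
have zero_all (c : nat -> int) : \sum_(i < size us) us`_i *~ c i = 0 ->
    forall i : 'I_(size us), c i = 0.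
  move=> c0 i; apply/eqP; apply: contraT => ci0.
  have := div_all `|c i|%N c c0 i; rewrite dvdzE abszX => /dvdn_leq.
  by rewrite absz_gt0 ci0 leqNgt ltn_expl // => /(_ isT).
rewrite -[us]/(tval (in_tuple us)); apply/freeP => k k0.
pose D := \prod_i denq (k i).
have D0 : D != 0 by apply/prodf_neq0 => i _; apply: denq_neq0.
pose c j := if insub j is Some i then numq (k i) * \prod_(i' | i' != i) denq (k i') else 0.
have cE (i : 'I_(size us)) : (c i)%:~R = k i * D%:~R.
  rewrite /c valK /D [in RHS](bigD1 i) //= !intrM mulrA; congr (_ * _).
  by rewrite -{2}(divq_num_den (k i)) divfK // intr_eq0 denq_neq0.
move=> i; have ci : c i = 0.
  apply: zero_all; transitivity (D%:~R *: \sum_(i < size us) k i *: us`_i).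
    rewrite scaler_sumr; apply: eq_bigr => j _.
    by rewrite scalerA mulrC -cE scaler_int.
  by rewrite k0 scaler0.
have /eqP := cE i; rewrite ci eq_sym mulf_eq0 intr_eq0 (negPf D0) orbF.
by move/eqP.
Qed.

(** A maximal family independent modulo [l] exists, since [indep_mod_free] bounds
    its length by the degree of [F]. Its combinations with coefficients below [l]
    represent all classes. *)
Lemma quotient_prime (l : nat) : prime l -> exists rs : seq F,
  (forall r, r \in rs -> R r) /\
  forall x, R x -> exists2 r, r \in rs & R ((x - r) / l%:R).
Proof.
move=> pl; have l1 := prime_gt1 pl.
have l0 : l%:R != 0 :> F by rewrite -[l%:R]/(l%:Z%:~R) intF_eq0; lia.
have [us indus maxus] : exists2 us, indep_mod l us &
    forall x, R x -> ~ indep_mod l (x :: us).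
  apply: contrapT => nex.
  have long k : exists2 us, indep_mod l us & size us = k.
    elim: k => [|k [us ius sz]].
      by exists [::] => //; split => [i|c _ []//]; rewrite nth_nil; apply: subring_0.
    have [x [Rx ix]] : exists x, R x /\ indep_mod l (x :: us).
      apply: contrapT => nx; apply: nex; exists us => // x Rx ix.
      by apply: nx; exists x.
    by exists (x :: us); rewrite //= sz.
  have [us ius sz] := long (\dim {:F}).+1.
  have := indep_mod_free l1 ius; rewrite /free => /eqP e.
  have : (\dim <<us>> <= \dim {:F})%N by apply/dimvS/subvf.
  by rewrite e sz ltnn.
have [Rus ind] := indus.
pose comb (f : {ffun 'I_(size us) -> 'I_l}) := \sum_(i < size us) us`_i *~ (f i : nat)%:Z.
exists [seq comb f | f <- enum {: {ffun 'I_(size us) -> 'I_l}}]; split.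
  by move=> _ /mapP[f _ ->]; apply: subring_sum => i; apply: subring_mulz.
move=> x Rx.
have [c [Rc [i ndiv]]] : exists c : nat -> int,
    R ((\sum_(i < (size us).+1) (x :: us)`_i *~ c i) / l%:R) /\
    exists i : 'I_(size us).+1, ~ (l %| c i)%Z.
  apply: contrapT => nex; apply: (maxus x Rx); split; first by case.
  move=> c Rc i; apply: contrapT => nd; apply: nex; exists c; split => //.
  by exists i.
move: Rc; rewrite big_ord_recl /= => Rc.
have nd0 : ~ (l %| c 0%N)%Z.
  move=> /dvdzP[q cq]; apply: ndiv.
  have Rc' : R ((\sum_(j < size us) us`_j *~ c j.+1) / l%:R).
    have -> : (\sum_(j < size us) us`_j *~ c j.+1) / l%:R =
        (x *~ c 0%N + \sum_(j < size us) us`_j *~ c j.+1) / l%:R - x *~ q.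
      rewrite mulrDl cq mulrzA -mulrzr -[(l%:Z)%:~R]/(l%:R) mulfK //.
      by rewrite addrAC subrr add0r.
    by apply: RB => //; apply: subring_mulz.
  case: i => [[|i] lti] /=; first by rewrite cq dvdz_mull.
  exact: (ind (fun j => c j.+1) Rc' (Ordinal (lti : i < size us)%N)).
have [u [a ua]] : exists u a : int, u * l%:Z + a * c 0%N = 1.
  have [u [a]] := Bezoutz l%:Z (c 0%N) => ua; exists u, a; rewrite ua.
  apply/eqP; rewrite -/(coprimez _ _) coprimezE prime_coprime //.
  by apply/negP; rewrite -[X in (X %| _)%N]/(absz l%:Z) -dvdzE.
pose e (j : nat) : int := - (a * c j.+1).
have em j : (0 <= (e j %% l%:Z)%Z < l%:Z).
  by rewrite modz_ge0 ?ltz_pmod //; lia.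
have lt_l j : (`|(e j %% l%:Z)%Z| < l)%N by have := em j; lia.
pose f : {ffun 'I_(size us) -> 'I_l} := [ffun j : 'I_(size us) => Ordinal (lt_l j)].
exists (comb f); first by rewrite map_f // mem_enum.
move: Rc; set X := _ + _ => Rc.
have -> : (x - comb f) / l%:R = x *~ u +
    \sum_(j < size us) us`_j *~ (e j %/ l%:Z)%Z + (X / l%:R) *~ a.
  apply: (mulIf l0); rewrite divfK // mulrDl -[_ *~ a]mulrzr mulrAC divfK //.
  rewrite /X mulrDl mulrDl addrACA; congr (_ + _).
    have ua' : u%:~R * l%:R + a%:~R * (c 0%N)%:~R = 1 :> F.
      by rewrite -[l%:R]/(l%:Z%:~R) -!intrM -intrD ua.
    rewrite -[x *~ u]mulrzr -[x *~ c 0%N]mulrzr -[LHS]mulr1 -[X in _ * X = _]ua'.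
    by rewrite mulrDr mulrA [a%:~R * _]mulrC mulrA.
  rewrite /comb -sumrN !mulr_suml -big_split; apply: eq_bigr => j _.
  rewrite ffunE /= -[_ *~ (_ %/ _)%Z]mulrzr -[_ *~ c _]mulrzr -[_ *~ _%:Z]mulrzr.
  have -> : (`|(e j %% l%:Z)%Z|%N%:Z)%:~R = - a%:~R * (c j.+1)%:~R -
      (e j %/ l%:Z)%Z%:~R * l%:R :> F.
    have -> : `|(e j %% l%:Z)%Z|%N%:Z = e j - (e j %/ l%:Z)%Z * l%:Z.
      by rewrite {2}(divz_eq (e j) l) addrAC subrr add0r; have := em j; lia.
    by rewrite intrB /e mulrNz !intrM mulNr.
  move: (a%:~R) ((c j.+1)%:~R) ((_ %/ _)%Z%:~R) => a' c' q'.
  by ring.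
apply: subring_D; last exact: subring_mulz.
by apply: subring_D; [apply: subring_mulz|apply: subring_sum => j; apply: subring_mulz].
Qed.

Lemma quotient_finite (m : nat) : (0 < m)%N -> exists rs : seq F,
  (forall r, r \in rs -> R r) /\
  forall x, R x -> exists2 r, r \in rs & R ((x - r) / m%:R).
Proof.
elim/ltn_ind: m => m IH m0; have [m1|m1] := leqP m 1.
  exists [:: 0]; split=> [r|x Rx]; first by rewrite inE => /eqP->; apply: subring_0.
  by exists 0; rewrite ?mem_head // subr0 (_ : m = 1%N) ?divr1 //; lia.
have pl := pdiv_prime m1; set l := pdiv m in pl.
have em : (m = l * (m %/ l))%N by rewrite mulnC divnK ?pdiv_dvd.
have l0 : l%:R != 0 :> F by rewrite -[l%:R]/(l%:Z%:~R) intF_eq0; have := prime_gt0 pl; lia.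
have [rs [Rrs rsP]] := quotient_prime pl.
have [||rs' [Rrs' rsP']] := IH (m %/ l)%N.
- by rewrite ltn_Pdiv ?prime_gt1.
- by rewrite divn_gt0 ?prime_gt0 // dvdn_leq // pdiv_dvd.
exists [seq r + l%:R * r' | r <- rs, r' <- rs']; split.
  move=> _ /allpairsP[[r r'] /= [/Rrs Rr /Rrs' Rr' ->]]; apply: subring_D => //.
  by apply: RM => //; rewrite -[l%:R]/(1 *~ l%:Z); apply: subring_mulz.
move=> x Rx; have [r rs_r Rr] := rsP x Rx; have [r' rs_r' Rr'] := rsP' _ Rr.
exists (r + l%:R * r'); first by apply/allpairsP; exists (r, r').
rewrite em natrM invfM mulrA.
by rewrite opprD addrA [(_ - _) / l%:R]mulrBl mulrAC divff // mul1r.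
Qed.

End FiniteQuotient.

Lemma O_quotient (m : nat) : (0 < m)%N -> exists rs : seq F,
  (forall r, r \in rs -> O r) /\
  forall x, O x -> exists2 r, r \in rs & O ((x - r) / m%:R).
Proof. by apply: quotient_finite; [exact: O_1|exact: O_sub|exact: O_mul]. Qed.

Lemma pigeonhole (T : eqType) (f : nat -> T) (rs : seq T) :
  (forall i, f i \in rs) -> exists i j, (i < j)%N /\ f i = f j.
Proof.
move=> frs; apply: contrapT => nex.
have injf : injective f.
  move=> i j fij; have [lt_ij|lt_ji|//] := ltngtP i j; case: nex.
    by exists i, j.
  by exists j, i.
have : (size [seq f i | i <- iota 0 (size rs).+1] <= size rs)%N.
  by apply: uniq_leq_size; rewrite ?map_inj_uniq ?iota_uniq // => _ /mapP[i _ ->].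
by rewrite size_map size_iota ltnn.
Qed.

Lemma O_divides (x : F) : x != 0 -> O x ->
  exists (m : nat), (0 < m)%N /\ O (m%:R / x).
Proof.
move=> x0 Ox; have [c c0 Oc] := O_fraction x^-1.
exists `|c|%N; split; first by rewrite absz_gt0.
by case: (intP c) c0 Oc => // k _; rewrite ?abszN // mulrNz mulNr => /O_opp;
  rewrite opprK.
Qed.

(** The powers of [x] all have the denominator [a], so two of them agree modulo
    integral elements; this is a monic equation for [x]. *)
Lemma O_completely_closed (a x : F) : a != 0 -> O a ->
  (forall n, O (a * x ^+ n)) -> O x.
Proof.
move=> a0 Oa Oax; have [m [m0 Om]] := O_divides a0 Oa.
have mF0 : m%:R != 0 :> F by rewrite -[m%:R]/(m%:Z%:~R) intF_eq0; lia.
have Omx n : O (m%:R * x ^+ n).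
  by rewrite -(divfK a0 m%:R) -[_ / a * a * _]mulrA; apply: O_mul.
have [rs [_ rsP]] := O_quotient m0.
have /choice[f fP] (k : nat) : exists r, r \in rs /\ O ((m%:R * x ^+ k - r) / m%:R).
  by have [r ? ?] := rsP _ (Omx k); exists r.
have [i [j [lt_ij fij]]] := pigeonhole (fun n => (fP n).1).
have Oij : O (x ^+ j - x ^+ i).
  have [_ Oi] := fP i; have [_ Oj] := fP j.
  have -> : x ^+ j - x ^+ i =
      (m%:R * x ^+ j - f j) / m%:R - (m%:R * x ^+ i - f i) / m%:R.
    by rewrite -mulrBl fij opprB addrA subrK -mulrBr mulrC mulKf.
  exact: O_sub.
pose p : {poly F} := 'X^j - ('X^i + (x ^+ j - x ^+ i)%:P).
have sp : (size ('X^i + (x ^+ j - x ^+ i)%:P)%R <= j)%N.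
  rewrite (leq_trans (size_polyD _ _)) // geq_max size_polyXn lt_ij /=.
  by rewrite (leq_trans (size_polyC_leq1 _)) //; lia.
have mp : p \is monic.
  by rewrite monicE /p lead_coefDl ?lead_coefXn // size_polyN size_polyXn ltnS.
have px : root p x.
  by rewrite rootE /p hornerD hornerN hornerD !hornerXn hornerC [x ^+ i + _]addrC subrK subrr.
apply: (integral_root_monic mp px) => _ /(nthP 0)[k _ <-].
rewrite /p coefB coefD coefC !coefXn.
apply: O_sub; first exact: (O_int (k == j)).
by apply: O_add; [apply: (O_int (k == i))|case: ifP => _ //; apply: (O_int 0)].
Qed.

(** ** Inverting a maximal ideal *)

(** Maximality is stated as invertibility modulo [P]. *)
Record maximal_over (l : nat) (P : set F) : Prop := MaximalOver {
  mo_sub : forall x, P x -> O x;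
  mo_B : forall x y, P x -> P y -> P (x - y);
  mo_M : forall a x, O a -> P x -> P (a * x);
  mo_l : P l%:R;
  mo_1 : ~ P 1;
  mo_max : forall a, O a -> ~ P a -> exists2 c, O c & P (1 - c * a)
}.

Section MaximalIdeal.
Variables (l : nat) (P : set F).
Hypothesis l0 : (0 < l)%N.
Hypothesis Pmax : maximal_over l P.

Let lF0 : l%:R != 0 :> F.
Proof. by rewrite -[l%:R]/(l%:Z%:~R) intF_eq0; lia. Qed.

Lemma mo_D x y : P x -> P y -> P (x + y).
Proof.
move=> Px Py; rewrite -[y]opprK; apply: (mo_B Pmax) => //.
have P0 : P 0 by rewrite -(subrr x); apply: (mo_B Pmax).
by rewrite -sub0r; apply: (mo_B Pmax).
Qed.

Lemma mo_prime x y : O x -> O y -> ~ P x -> ~ P y -> ~ P (x * y).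
Proof.
move=> Ox Oy nx ny Pxy; have [c Oc Pc] := mo_max Pmax Ox nx.
apply: ny; have -> : y = y * (1 - c * x) + c * (x * y) by ring.
by apply: mo_D; apply: (mo_M Pmax).
Qed.

(** [x / l] does not belong to the localization of the ring of integers at [P]. *)
Definition alive x := O x /\ forall t, O t -> ~ P t -> ~ O (t * x / l%:R).

Lemma alive1 : alive 1.
Proof.
split=> [|t Ot nt Otl]; first exact: O_1.
apply: nt; rewrite -[t](divfK lF0); apply: (mo_M Pmax) (mo_l Pmax).
by rewrite mulr1 in Otl.
Qed.

(** The powers of [a] repeat modulo [l], so some power of [a] is killed in the
    localization at [P]; stop just before that happens. *)
Lemma alive_step a x : P a -> alive x -> exists c, O c /\
  alive (c * x) /\ O (a * (c * x) / l%:R).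
Proof.
move=> Pa [Ox ax]; have Oa := mo_sub Pmax Pa.
have [rs [_ rsP]] := O_quotient l0.
have /choice[f fP] (k : nat) : exists r, r \in rs /\ O ((a ^+ k - r) / l%:R).
  by have [r ? ?] := rsP _ (O_exp k Oa); exists r.
have [i [j [lt_ij fij]]] := pigeonhole (fun n => (fP n).1).
have Oij : O (a ^+ i * (1 - a ^+ (j - i)) / l%:R).
  have [_ Oi] := fP i; have [_ Oj] := fP j.
  have -> : a ^+ i * (1 - a ^+ (j - i)) / l%:R =
      (a ^+ i - f i) / l%:R - (a ^+ j - f j) / l%:R.
    rewrite -mulrBl fij opprB addrA subrK mulrBr mulr1 -exprD subnKC //.
    exact: ltnW.
  exact: O_sub.
have dead : exists k, ~ alive (a ^+ k * x).
  exists i => -[_ /(_ (1 - a ^+ (j - i)))]; apply.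
  - by apply: O_sub; [exact: O_1|exact: O_exp].
  - move=> P1; apply: (mo_1 Pmax); rewrite -[1](subrK (a ^+ (j - i))).
    apply: mo_D => //; rewrite -(subnSK lt_ij) exprSr.
    by apply: (mo_M Pmax) => //; apply: O_exp.
  - have -> : (1 - a ^+ (j - i)) * (a ^+ i * x) / l%:R =
        x * (a ^+ i * (1 - a ^+ (j - i)) / l%:R) by ring.
    exact: O_mul.
have {dead} exk : exists k, `[< ~ alive (a ^+ k * x) >].
  by have [k dk] := dead; exists k; apply/asboolP.
case: (ex_minnP exk) => -[|k] /asboolP dead mink.
  by case: dead; rewrite expr0 mul1r.
have [Okx alk] : alive (a ^+ k * x).
  by apply: contrapT => /asboolP/mink; rewrite ltnn.
have [t [Ot nPt Ot']] : exists t, [/\ O t, ~ P t & O (t * (a ^+ k.+1 * x) / l%:R)].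
  apply: contrapT => nt; apply: dead; split.
    by apply: O_mul => //; apply: O_exp.
  by move=> t Ot nPt Ot'; apply: nt; exists t.
exists (t * a ^+ k); split; first by apply: O_mul => //; apply: O_exp.
split; last first.
  by move: Ot'; rewrite exprS; congr (O _); ring.
split; first by rewrite -mulrA; apply: O_mul.
move=> t' Ot1 nt1.
have -> : t' * (t * a ^+ k * x) = t' * t * (a ^+ k * x) by ring.
apply: alk.
  exact: O_mul.
exact: mo_prime.
Qed.

Lemma alive_list (s : seq F) : (forall a, a \in s -> P a) ->
  exists x, alive x /\ forall a, a \in s -> O (a * x / l%:R).
Proof.
elim: s => [|a s IH] sP; first by exists 1; split => //; apply: alive1.
have [|x [ax xs]] := IH; first by move=> b bs; apply: sP; rewrite inE bs orbT.
have [c [Oc [acx Oacx]]] := alive_step (sP a (mem_head a s)) ax.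
exists (c * x); split => // b; rewrite inE => /predU1P[->//|/xs Obx].
have -> : b * (c * x) / l%:R = c * (b * x / l%:R) by ring.
exact: O_mul.
Qed.

(** The element is [x / l], for an [x] that stays alive although all of [P] kills
    it modulo [l]; [P] is generated by [l] and finitely many elements, which are
    treated one after the other. *)
Lemma maximal_ideal_inverse : exists b, ~ O b /\ forall a, P a -> O (b * a).
Proof.
have [rs [_ rsP]] := O_quotient l0.
have [|x [[Ox ax] xs]] := alive_list (s := [seq r <- rs | `[< P r >]]).
  by move=> a; rewrite mem_filter => /andP[/asboolP].
exists (x / l%:R); split=> [Ob|a Pa].
  by have := ax 1 (O_1 F) (mo_1 Pmax); rewrite mul1r.
have [r rs_r Or] := rsP a (mo_sub Pmax Pa).
have Pr : P r.
  have -> : r = a - (a - r) / l%:R * l%:R by rewrite divfK // opprB addrC subrK.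
  by apply: (mo_B Pmax) => //; apply: (mo_M Pmax) (mo_l Pmax).
have -> : x / l%:R * a = r * x / l%:R + (a - r) / l%:R * x by ring.
apply: O_add; last exact: O_mul.
by apply: xs; rewrite mem_filter rs_r andbT; apply/asboolP.
Qed.

Variable b : F.
Hypotheses (nOb : ~ O b) (bP : forall a, P a -> O (b * a)).

(** Otherwise [b] would map [P] to itself, all [l * b ^+ n] would be integral, and
    so would [b]. *)
Lemma inverse_uniformizer : exists2 a, P a & ~ P (b * a).
Proof.
apply: contrapT => nex; apply: nOb.
apply: (O_completely_closed lF0); first exact: (O_int l).
move=> n; suff : P (l%:R * b ^+ n) by apply: (mo_sub Pmax).
elim: n => [|n IH]; first by rewrite expr0 mulr1; apply: (mo_l Pmax).
apply: contrapT => nP; apply: nex; exists (l%:R * b ^+ n) => //.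
by rewrite mulrCA -exprS.
Qed.

(** The integrality of [b ^+ n * x] for all [n] would make [b] integral; the last
    integral one is not in [P]. *)
Lemma inverse_power x : x != 0 -> O x -> exists n : nat, O (b ^+ n * x) /\ ~ P (b ^+ n * x).
Proof.
move=> x0 Ox.
have exk : exists k, `[< ~ O (b ^+ k * x) >].
  apply: contrapT => nex; apply: nOb; apply: (O_completely_closed x0 Ox) => n.
  by apply: contrapT => nO; apply: nex; exists n; apply/asboolP; rewrite mulrC.
case: (ex_minnP exk) => -[|k] /asboolP nO mink.
  by case: nO; rewrite expr0 mul1r.
exists k; split.
  by apply: contrapT => /asboolP/mink; rewrite ltnn.
by move=> Pk; apply: nO; rewrite exprS -mulrA; apply: bP.
Qed.

Let b0 : b != 0.
Proof. by apply: contra_notN nOb => /eqP->; apply: (O_int 0). Qed.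

Lemma inverse_decomp x : x != 0 -> exists (m : int) (s t : F),
  [/\ O s, ~ P s, O t, ~ P t & x = b ^ (- m) * (s / t)].
Proof.
move=> x0; have [c c0 Oc] := O_fraction x.
have cF0 : c%:~R != 0 :> F by rewrite intF_eq0.
have [i [Os nPs]] := inverse_power (mulf_neq0 cF0 x0) Oc.
have [k [Ot nPt]] := inverse_power cF0 (O_int c).
exists (i%:Z - k%:Z), (b ^+ i * (c%:~R * x)), (b ^+ k * c%:~R); split => //.
rewrite opprB expfzDr // -exprnN -exprnP.
have bk0 : b ^+ k != 0 by rewrite expf_neq0.
have bi0 : b ^+ i != 0 by rewrite expf_neq0.
by field; rewrite cF0 bk0 bi0.
Qed.

Lemma mo_neq0 x : ~ P x -> x != 0.
Proof.
move=> nP; apply: contra_notN nP => /eqP->.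
by rewrite -(subrr l%:R); apply: (mo_B Pmax) (mo_l Pmax) (mo_l Pmax).
Qed.

Lemma mo_exp x n : O x -> ~ P x -> ~ P (x ^+ n).
Proof.
move=> Ox nP; elim: n => [|n IH]; first by rewrite expr0; apply: (mo_1 Pmax).
by rewrite exprS; apply: mo_prime => //; apply: O_exp.
Qed.

Section OwnValuation.
Variable v : finite_prime F.
Hypothesis v_unit : forall x, O x -> ~ P x -> v x = 0.
Hypothesis v_pos : forall x, P x -> x != 0 -> 0 < v x.

Lemma nuXz x (m : int) : x != 0 -> v (x ^ m) = v x * m.
Proof.
move=> x0; case: m => k; first by rewrite -exprnP nuX // -mulr_natr natz.
by rewrite NegzE -exprnN nuV ?expf_neq0 // nuX // mulrN -mulr_natr natz.
Qed.

(** By [inverse_decomp] the valuation of every element is a multiple of that of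
    [b], and valuations are normalised. *)
Lemma nu_inverse : v b = -1.
Proof.
have [a Pa nPba] := inverse_uniformizer.
have ba0 := mo_neq0 nPba; have a0 : a != 0.
  by apply: contraNneq ba0 => ->; rewrite mulr0.
have vb : v b < 0.
  have := v_unit (bP Pa) nPba; rewrite nuM // => /eqP.
  by rewrite addr_eq0 => /eqP->; rewrite oppr_lt0 v_pos.
have [x x0 vx] := nu_normalized v.
have [m [s [t [Os nPs Ot nPt ex]]]] := inverse_decomp x0.
have [s0 t0] := (mo_neq0 nPs, mo_neq0 nPt).
have st0 : s / t != 0 by rewrite mulf_neq0 ?invr_eq0.
move: vx; rewrite ex nuM ?expfz_neq0 // nuXz // nuM ?invr_eq0 // nuV //.
rewrite (v_unit Os nPs) (v_unit Ot nPt) subrr addr0.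
move=> /(congr1 absz)/eqP; rewrite abszM muln_eq1 => /andP[/eqP vb1 _]; lia.
Qed.

Lemma nu_decomp m s t : O s -> ~ P s -> O t -> ~ P t ->
  v (b ^ (- m) * (s / t)) = m.
Proof.
move=> Os nPs Ot nPt; have [s0 t0] := (mo_neq0 nPs, mo_neq0 nPt).
have st0 : s / t != 0 by rewrite mulf_neq0 ?invr_eq0.
rewrite nuM ?expfz_neq0 // nuXz // nuM ?invr_eq0 // nuV //.
by rewrite (v_unit Os nPs) (v_unit Ot nPt) subrr addr0 nu_inverse mulN1r opprK.
Qed.

End OwnValuation.

Let decomp_le m m' s s' t t' : O s -> ~ P s -> O t -> ~ P t -> O s' -> ~ P s' ->
  O t' -> ~ P t' -> b ^ (- m) * (s / t) = b ^ (- m') * (s' / t') -> m <= m'.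
Proof.
move=> Os nPs Ot nPt Os' nPs' Ot' nPt' e; rewrite leNgt; apply/negP => lt.
have [a Pa nPba] := inverse_uniformizer.
have [k ek] : exists k : nat, m - m' = k.+1 by exists (absz (m - m' - 1)%R); lia.
have [[[s0 t0] s0'] t0'] := (mo_neq0 nPs, mo_neq0 nPt, mo_neq0 nPs', mo_neq0 nPt').
have e1 : s * t' = b ^+ k.+1 * (s' * t).
  have : b ^ m * (b ^ (- m) * (s / t)) = b ^ m * (b ^ (- m') * (s' / t')).
    by rewrite e.
  rewrite !mulrA -!expfzDr // subrr expr0z mul1r ek -exprnP => e2.
  apply: (mulIf (_ : (t * t')^-1 != 0)); first by rewrite invr_eq0 mulf_neq0.
  rewrite invfM; apply: (etrans (y := s / t)); first by field; rewrite t0 t0'.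
  by rewrite e2; field; rewrite t0 t0'.
have : P (a ^+ k.+1 * (s * t')).
  rewrite exprSr -mulrA; apply: (mo_M Pmax); first exact/O_exp/(mo_sub Pmax).
  by rewrite mulrC; apply: (mo_M Pmax) => //; apply: O_mul.
rewrite e1 mulrA -exprMn [a * b]mulrC.
have nPk := mo_exp (n := k.+1) (bP Pa) nPba.
exact: (mo_prime (O_exp _ (bP Pa)) (O_mul Os' Ot) nPk (mo_prime Os' Ot nPs' nPt)).
Qed.

(** The exponent in [inverse_decomp] is the valuation. For the ultrametric
    inequality, both summands are multiplied by a power of [b * a], a unit at [P],
    to write the second one with the exponent of the first. *)
Lemma maximal_ideal_valuation : exists v : finite_prime F, 0 < v l%:R.
Proof.
have /choice[ord ordP] (x : F) : exists m : int, (x = 0 -> m = 0) /\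
    (x != 0 -> exists s t, [/\ O s, ~ P s, O t, ~ P t & x = b ^ (- m) * (s / t)]).
  have [->|x0] := eqVneq x 0; first by exists 0.
  have [m mP] := inverse_decomp x0; exists m; split => // x00.
  by rewrite x00 eqxx in x0.
have ordE m s t : O s -> ~ P s -> O t -> ~ P t -> ord (b ^ (- m) * (s / t)) = m.
  move=> Os nPs Ot nPt.
  have x0 : b ^ (- m) * (s / t) != 0.
    by rewrite mulf_neq0 ?expfz_neq0 // mulf_neq0 ?invr_eq0 ?(mo_neq0 nPs) ?(mo_neq0 nPt).
  have [_ /(_ x0)[s' [t' [Os' nPs' Ot' nPt' e]]]] := ordP (b ^ (- m) * (s / t)).
  by apply/le_anti; rewrite (decomp_le _ _ _ _ _ _ _ _ (esym e)) // (decomp_le _ _ _ _ _ _ _ _ e).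
have ord0 : ord 0 = 0 by apply: (ordP 0).1.
have ordM x y : x != 0 -> y != 0 -> ord (x * y) = ord x + ord y.
  move=> x0 y0; have [_ /(_ x0)[s [t [Os nPs Ot nPt ex]]]] := ordP x.
  have [_ /(_ y0)[s' [t' [Os' nPs' Ot' nPt' ey]]]] := ordP y.
  rewrite -(ordE (ord x + ord y) (s * s') (t * t')); try exact: O_mul; try exact: mo_prime.
  congr ord; rewrite {1}ex {1}ey opprD expfzDr //.
  by rewrite invfM; ring.
have ordD x y : x != 0 -> y != 0 -> x + y != 0 -> ord x <= ord y ->
    ord x <= ord (x + y).
  move=> x0 y0 xy0 le; have [_ /(_ x0)[s [t [Os nPs Ot nPt ex]]]] := ordP x.
  have [_ /(_ y0)[s' [t' [Os' nPs' Ot' nPt' ey]]]] := ordP y.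
  have [a Pa nPba] := inverse_uniformizer; have Oa := mo_sub Pmax Pa.
  have [k ek] : exists k : nat, ord y - ord x = k by exists (absz (ord y - ord x)%R); lia.
  have [[t0 t0'] ba0] := (mo_neq0 nPt, mo_neq0 nPt', mo_neq0 nPba).
  have bk0 : (b * a) ^+ k != 0 by rewrite expf_neq0.
  pose num := s * t' * (b * a) ^+ k + a ^+ k * (s' * t).
  pose den := t * t' * (b * a) ^+ k.
  have exy : x + y = b ^ (- ord x) * (num / den).
    rewrite {1}ex {1}ey (_ : - ord y = - ord x - k%:Z); last by rewrite -ek; ring.
    rewrite expfzDr // -exprnN -mulrA -mulrDr; congr (_ * _).
    rewrite /num /den exprMn; have bk : b ^+ k != 0 by rewrite expf_neq0.
    have ak : a ^+ k != 0 by move: bk0; rewrite exprMn mulf_eq0 negb_or => /andP[].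
    by field; rewrite t0 t0' bk ak.
  have Obk : O ((b * a) ^+ k) by apply/O_exp/bP.
  have Oak : O (a ^+ k) by apply: O_exp.
  have On : O num.
    by apply: O_add; apply: O_mul => //; apply: O_mul.
  have Od : O den by apply: O_mul => //; apply: O_mul.
  have nPd : ~ P den.
    have nPk := mo_exp (n := k) (bP Pa) nPba.
    exact: (mo_prime (O_mul Ot Ot') (O_exp _ (bP Pa)) (mo_prime Ot Ot' nPt nPt') nPk).
  have num0 : num != 0 by apply: contraNneq xy0 => n0; rewrite exy n0 mul0r mulr0.
  have [i [Oi nPi]] := inverse_power num0 On.
  have -> : x + y = b ^ (- (ord x + i%:Z)) * (b ^+ i * num / den).
    rewrite exy opprD expfzDr // -exprnN -[RHS]mulrA -[b ^+ i * num / den]mulrA.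
    by rewrite mulKf // expf_neq0.
  by rewrite ordE // lerDl.
have ordD' x y : x != 0 -> y != 0 -> x + y != 0 -> Num.min (ord x) (ord y) <= ord (x + y).
  move=> x0 y0 xy0; case: (leP (ord x) (ord y)) => [|/ltW] le; first exact: ordD.
  by rewrite addrC; apply: ordD; rewrite // addrC.
have ordn : exists2 x, x != 0 & ord x = 1.
  exists (b ^ (- 1) * (1 / 1)); first by rewrite divr1 mulr1 expfz_neq0.
  by apply: ordE; try exact: O_1; exact: (mo_1 Pmax).
exists (FinitePrime ord0 ordM ordD' ordn) => /=.
have [i [Oi nPi]] := inverse_power lF0 (O_int l).
have -> : l%:R = b ^ (- i%:Z) * (b ^+ i * l%:R / 1).
  by rewrite -exprnN divr1 mulrA mulVf ?mul1r ?expf_neq0.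
rewrite ordE //; [|exact: O_1|exact: (mo_1 Pmax)].
by case: i nPi {Oi} => //; rewrite expr0 mul1r => /(_ (mo_l Pmax)).
Qed.

End MaximalIdeal.

(** Proper ideals containing [l] are compared by the number of representatives of
    the classes modulo [l] that they contain; one with the most is maximal. *)
Lemma exists_maximal_over (l : nat) : prime l -> exists P, maximal_over l P.
Proof.
move=> pl; have l1 := prime_gt1 pl.
have lF0 : l%:R != 0 :> F by rewrite -[l%:R]/(l%:Z%:~R) intF_eq0; lia.
have [rs [Ors rsP]] := O_quotient (prime_gt0 pl).
pose ideal (I : set F) := [/\ forall x, I x -> O x,
  forall x y, I x -> I y -> I (x - y), forall a x, O a -> I x -> I (a * x),
  I l%:R & ~ I 1].
pose size_of (I : set F) := count (fun r => `[< I r >]) rs.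
have [I idI maxI] : exists2 I, ideal I & forall J, ideal J -> (size_of J <= size_of I)%N.
  pose Q k := `[< exists2 I, ideal I & size_of I = k >].
  have exQ : exists k, Q k.
    exists (size_of [set x | O (x / l%:R)]%classic); apply/asboolP.
    exists [set x | O (x / l%:R)]%classic => //; split => /=.
    - by move=> x Ox; rewrite -(divfK lF0 x); apply: O_mul => //; apply: (O_int l).
    - by move=> x y Ox Oy; rewrite mulrBl; apply: O_sub.
    - by move=> a x Oa Ox; rewrite -mulrA; apply: O_mul.
    - by rewrite divff //; apply: O_1.
    - by rewrite div1r; apply: O_inv_nat.
  have bound k : Q k -> (k <= size rs)%N.
    by move=> /asboolP[I _ <-]; apply: count_size.
  have [k /asboolP[I idI <-] maxk] := ex_maxnP exQ bound.
  by exists I => // J idJ; apply: maxk; apply/asboolP; exists J.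
have [IO IB IM Il I1] := idI; exists I; split => // a Oa nIa.
apply: contrapT => nc; pose J := [set x | exists2 c, O c & I (x - c * a)]%classic.
have IJ x : I x -> J x.
  by move=> Ix; exists 0; [exact: (O_int 0)|rewrite mul0r subr0].
have idJ : ideal J.
  split.
  - move=> x [c Oc Ix]; rewrite -(subrK (c * a) x).
    by apply: O_add; [apply: IO|apply: O_mul].
  - move=> x y [c Oc Ix] [d Od Iy]; exists (c - d); first exact: O_sub.
    by rewrite mulrBl opprD addrACA -opprD; apply: IB.
  - move=> x y Ox [c Oc Iy]; exists (x * c); first exact: O_mul.
    by rewrite -mulrA -mulrBr; apply: IM.
  - exact: IJ.
  - by move=> [c Oc I1c]; apply: nc; exists c.
have [r rs_r Or] := rsP a Oa.
have Ir : I ((a - r) / l%:R * l%:R) by apply: IM.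
have I0 : I 0 by rewrite -(subrr l%:R); apply: (IB).
have nIr : ~ I r.
  move=> I_r; apply: nIa; rewrite -(subrK r a) -[X in _ + X]opprK.
  apply: (IB); first by rewrite -(divfK lF0 (a - r)).
  by rewrite -sub0r; apply: (IB).
have Jr : J r.
  exists 1; first exact: O_1.
  rewrite mul1r -opprB -sub0r; apply: (IB) => //.
  by rewrite -(divfK lF0 (a - r)).
have := maxI J idJ; rewrite leqNgt => /negP; apply.
have lt_count (s : seq F) : r \in s ->
    (count (fun x => `[< I x >]) s < count (fun x => `[< J x >]) s)%N.
  have le x : (`[< I x >] <= `[< J x >])%N.
    by case: asboolP => // /IJ/asboolP->.
  elim: s => // x s IH; rewrite inE => /predU1P[<-|/IH lt] /=.
    rewrite (asboolT Jr) (asboolF nIr) add0n add1n ltnS; elim: (s) => //= y s' IHs.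
    exact: leq_add.
  by rewrite -addnS leq_add.
exact: lt_count.
Qed.

Lemma exists_valuation_over (l : nat) : prime l ->
  exists v : finite_prime F, 0 < v l%:R.
Proof.
move=> pl; have [P Pmax] := exists_maximal_over pl.
have [b [nOb bP]] := maximal_ideal_inverse (prime_gt0 pl) Pmax.
exact: (maximal_ideal_valuation (prime_gt0 pl) Pmax nOb bP).
Qed.

(** ** The prime of a valuation *)

Section PrimeOfValuation.
Variable v : finite_prime F.

Lemma prime_idealP a : prime_ideal v a <-> O a /\ ball v 1 a.
Proof.
rewrite /ball -gtz0_ge1; split=> [[Oa a_or]|[Oa]].
  by split=> //; case: a_or => [->|[a0 ->]]; rewrite ?eqxx ?orbT.
have [a0 _|a0 /= va] := eqVneq a 0; first by split => //; left.
by split => //; right.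
Qed.

Lemma prime_idealPn a : O a -> ~ prime_ideal v a -> a != 0 /\ v a = 0.
Proof.
move=> Oa nP; have a0 : a != 0.
  apply: contra_notN nP => /eqP->; apply/prime_idealP; split; first exact: (O_int 0).
  by rewrite /ball eqxx.
split => //; apply/eqP; rewrite eq_le; have := O_valuation v Oa.
rewrite valuation_ringE (negPf a0) /= => ->; rewrite andbT leNgt; apply/negP => va.
by apply: nP; split => //; right.
Qed.

(** Some nonzero integral element has positive valuation and divides an integer;
    a minimal integer of positive valuation is prime. *)
Lemma prime_below : exists2 l, prime l & 0 < v l%:R.
Proof.
have [x x0 vx] := nu_normalized v; have [c c0 Oc] := O_fraction x.
have cF0 : c%:~R != 0 :> F by rewrite intF_eq0.
have cx0 := mulf_neq0 cF0 x0.
have vcx : 0 < v (c%:~R * x).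
  rewrite nuM // vx; have := O_valuation v (O_int c).
  by rewrite valuation_ringE (negPf cF0) /=; lia.
have [m [m0 Om]] := O_divides cx0 Oc.
have mF0 : m%:R != 0 :> F by rewrite -[m%:R]/(m%:Z%:~R) intF_eq0; lia.
have vm_ : 0 < v m%:R.
  rewrite -(divfK cx0 m%:R) nuM ?mulf_neq0 ?invr_eq0 //.
  have := O_valuation v Om; rewrite valuation_ringE mulf_eq0 invr_eq0 (negPf mF0) (negPf cx0) /=.
  by move=> ?; apply: ltr_wpDl.
elim/ltn_ind: m m0 mF0 vm_ {Om} => m IH m0 mF0 vm_.
have m1 : (1 < m)%N.
  by case: m m0 vm_ {IH mF0} => [|[|]] //; rewrite nu1 ltxx.
have pl := pdiv_prime m1; set l := pdiv m in pl.
have lF0 : l%:R != 0 :> F by rewrite -[l%:R]/(l%:Z%:~R) intF_eq0; have := prime_gt0 pl; lia.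
have [vl|vl] := ltP 0 (v l%:R); first by exists l.
have em : (m = m %/ l * l)%N by rewrite divnK ?pdiv_dvd.
have m'0 : (0 < m %/ l)%N by rewrite divn_gt0 ?prime_gt0 // dvdn_leq // pdiv_dvd.
apply: (IH (m %/ l)%N) => //; first by rewrite ltn_Pdiv ?prime_gt1.
  by rewrite -[_%:R]/((m %/ l)%N%:Z%:~R) intF_eq0; lia.
have m'F0 : (m %/ l)%:R != 0 :> F by rewrite -[_%:R]/((m %/ l)%N%:Z%:~R) intF_eq0; lia.
move: vm_; rewrite {1}em natrM nuM //; lia.
Qed.

(** If [v a = 0], two powers of [a] agree modulo [l], so a power of [a] is 1 modulo
    the prime of [v]. *)
Lemma prime_ideal_maximal (l : nat) : prime l -> 0 < v l%:R ->
  maximal_over l (prime_ideal v).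
Proof.
move=> pl vl; have lF0 : l%:R != 0 :> F.
  by rewrite -[l%:R]/(l%:Z%:~R) intF_eq0; have := prime_gt0 pl; lia.
split.
- by move=> x [].
- move=> x y /prime_idealP[Ox bx] /prime_idealP[Oy by_]; apply/prime_idealP.
  by split; [exact: O_sub|exact: ballB].
- move=> a x Oa /prime_idealP[Ox bx]; apply/prime_idealP; split.
    exact: O_mul.
  by rewrite -[1]add0r; apply: ballM bx; apply: O_valuation Oa.
- by split; [exact: (O_int l)|right].
- by move=> /prime_idealP[_]; rewrite /ball oner_eq0 nu1.
move=> a Oa nPa; have [a0 va] := prime_idealPn Oa nPa.
have [rs [_ rsP]] := O_quotient (prime_gt0 pl).
have /choice[f fP] (k : nat) : exists r, r \in rs /\ O ((a ^+ k - r) / l%:R).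
  by have [r ? ?] := rsP _ (O_exp k Oa); exists r.
have [i [j [lt_ij fij]]] := pigeonhole (fun n => (fP n).1).
exists (a ^+ (j - i).-1); first exact: O_exp.
have aij : 1 - a ^+ (j - i).-1 * a = 1 - a ^+ (j - i).
  by rewrite -exprSr prednK // subn_gt0.
rewrite aij; apply/prime_idealP; split.
  by apply: O_sub; [exact: O_1|exact: O_exp].
have ai0 : a ^+ i != 0 by rewrite expf_neq0.
have -> : 1 - a ^+ (j - i) = (a ^+ i)^-1 *
    ((a ^+ i - f i) / l%:R - (a ^+ j - f j) / l%:R) * l%:R.
  rewrite -mulrBl fij opprB addrA subrK -{2}(subnKC (ltnW lt_ij)) exprD.
  by move: (a ^+ i) ai0 (a ^+ (j - i)) => X X0 Y; field; rewrite X0 lF0.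
rewrite -[1]add0r; apply: ballM; last by rewrite /ball -gtz0_ge1 vl orbT.
rewrite -[0]add0r; apply: ballM.
  by rewrite /ball nuV // nuX // va mul0rn oppr0 lexx orbT.
have [_ Oi] := fP i; have [_ Oj] := fP j.
exact: O_valuation (O_sub Oi Oj).
Qed.

End PrimeOfValuation.

Lemma finite_prime_inj (v w : finite_prime F) : v =1 w -> v = w.
Proof.
case: v w => [f f0 fM fD f1] [g g0 gM gD g1] /= /funext e; subst g.
congr FinitePrime; exact: Prop_irrelevance.
Qed.

End IntegersOfF.

(** * Class groups and elements of prescribed valuations *)

(** A finitely generated group that is 2-divisible is killed by the odd
    determinant of [1 - 2 a], where [a] expresses halves of the generators. *)
Lemma odd_exponent (B : zmodType) (X : set B) : finite_set X ->
  (forall c : mod2 (generated_subgroup X), c = 0) ->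
  exists2 m : nat, odd m & forall x, X x -> x *+ m = 0.
Proof.
move=> /finite_seqP[s sX] div2; pose n := size s.
have span_comb x : x \in in_span X ->
    exists a : 'I_n -> int, x = \sum_(j < n) s`_j *~ a j.
  move=> /asboolP/(_ [set y | exists a : 'I_n -> int, y = \sum_(j < n) s`_j *~ a j]%classic).
  apply; split => [|y]; last first.
    rewrite sX => /= ys; pose i := Ordinal (etrans (index_mem y s) ys : (index y s < n)%N).
    exists (fun j => (j == i)%:R); rewrite (bigD1 i) //= eqxx mulr1z nth_index //.
    by rewrite big1 ?addr0 // => j /negPf->; rewrite mulr0z.
  split=> [|x1 x2].
    rewrite inE; exists (fun=> 0); rewrite big1 // => j _; exact: mulr0z.
  rewrite !inE => -[a1 ->] [a2 ->]; exists (fun j => a1 j - a2 j).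
  by rewrite -sumrB; apply: eq_bigr => j _; rewrite mulrzBr.
have in_gen x : X x -> x \in in_span X.
  by move=> Xx; apply/asboolP => H [_ XH]; apply: XH.
have halves (i : 'I_n) : exists a : 'I_n -> int, s`_i = \sum_(j < n) s`_j *~ (2 * a j).
  have Xi : X s`_i by rewrite sX /=; apply: mem_nth.
  pose g : generated_subgroup X := GeneratedSubgroup (in_gen _ Xi).
  have : g \in @doubles (generated_subgroup X).
    by rewrite -quot_eq0; apply/eqP/div2.
  move=> /asboolP[h gh]; have [a ha] := span_comb _ (genP h).
  exists a; have := congr1 val gh; rewrite raddfMn /= => ->.
  rewrite ha -sumrMnl; apply: eq_bigr => j _.
  by rewrite mulrC mulrzA.
have /choice[a aP] := halves.
pose M : 'M[int]_n := \matrix_(i, j) ((i == j)%:R - 2 * a i j).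
have M0 i : \sum_(j < n) s`_j *~ M i j = 0.
  under eq_bigr do rewrite mxE mulrzBr.
  rewrite sumrB -aP (bigD1 i) //= eqxx mulr1z big1 ?addr0 ?subrr // => j.
  by rewrite eq_sym => /negPf->; rewrite mulr0z.
have kills (k : 'I_n) : s`_k *~ (\det M) = 0.
  have adjM i j : (\adj M *m M) i j = \det M *+ (i == j).
    by rewrite mul_adj_mx mxE.
  transitivity (\sum_(j < n) s`_j *~ (\adj M *m M) k j).
    rewrite (bigD1 k) //= adjM eqxx mulr1n big1 ?addr0 // => j.
    by rewrite adjM eq_sym => /negPf->; rewrite mulr0n mulr0z.
  transitivity (\sum_(i < n) (\sum_(j < n) s`_j *~ M i j) *~ (\adj M) k i).
    under [RHS]eq_bigr do rewrite mulrz_suml.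
    rewrite exchange_big /=; apply: eq_bigr => j _.
    rewrite mxE mulrz_sumr; apply: eq_bigr => i _.
    by rewrite mulrC mulrzA.
  by rewrite big1 // => i _; rewrite M0 mul0rz.
have double0 (x : int) : (2 * x)%:~R = 0 :> 'F_2.
  rewrite (_ : 2 * x = x + x); last by rewrite mulrDl mul1r.
  by rewrite intrD; move: (x%:~R) => y; apply: val_inj; case: y => [[|[|]]].
have odd_det : odd `|\det M|%N.
  have : (\det M)%:~R = 1 :> 'F_2.
    rewrite -det_map_mx -[RHS](det1 _ n); congr determinant.
    apply/matrixP => i j; rewrite !mxE -[LHS]/(_%:~R) intrB double0 subr0.
    by case: (i == j).
  apply: contra_eqT => ev; have /dvdzP[q ->] : (2 %| \det M)%Z.
    by rewrite dvdzE /= dvdn2.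
  by rewrite mulrC double0 eq_sym oner_eq0.
exists `|\det M|%N => // x; rewrite sX /= => xs.
have xs' : (index x s < n)%N by rewrite index_mem.
have := kills (Ordinal xs'); rewrite /= nth_index //.
case: (\det M) => k; first by [].
by rewrite NegzE mulrNz abszN => /eqP; rewrite oppr_eq0 => /eqP.
Qed.

Section PrescribedValuations.
Variable F : fieldExtType rat.
Local Notation O := (@ring_of_integers F).
Implicit Types v w : finite_prime F.

Lemma maximal_O_submodule l (P : set F) : maximal_over l P -> O_submodule P.
Proof.
move=> Pmax; split; last exact: (mo_M Pmax).
  by rewrite -(subrr l%:R); apply: (mo_B Pmax) (mo_l Pmax) (mo_l Pmax).
exact: (mo_D Pmax).
Qed.

(** The inverse is the colon ideal: [b * a] is in the product, and so is every
    integral multiple of [P]; as [b * a] is not in [P], these generate 1. *)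
Lemma maximal_invertible (l : nat) (P : set F) (b a : F) : maximal_over l P ->
  (forall x, P x -> O (b * x)) -> P a -> ~ P (b * a) ->
  ideal_prod P (ideal_colon P) = O.
Proof.
move=> Pmax bP Pa nPba; apply/seteqP; split.
  by apply: ideal_prod_min (O_submodule_O F) _ => x y Px cy; rewrite mulrC; apply: cy.
have subP := maximal_O_submodule Pmax.
have [_ ID IM] := ideal_prod_submodule (ideal_colon P) subP.
have I1 : ideal_prod P (ideal_colon P) 1.
  have [c Oc Pc] := mo_max Pmax (bP a Pa) nPba.
  have -> : 1 = (1 - c * (b * a)) * 1 + a * (c * b) by ring.
  apply: ID; apply: ideal_prod_mem => //.
    by move=> y Py; rewrite mul1r; apply: (mo_sub Pmax).
  by move=> y Py; rewrite -mulrA; apply: O_mul => //; apply: bP.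
by move=> x Ox; rewrite -[x]mulr1; apply: IM.
Qed.

(** Two valuations whose primes are contained in one another agree: both are
    read off from the same decomposition with respect to that prime. *)
Lemma prime_ideal_inj v w : (prime_ideal v `<=` prime_ideal w)%classic -> v = w.
Proof.
move=> vw; have [l pl vl] := prime_below v; have l0 := prime_gt0 pl.
have Pmax := prime_ideal_maximal pl vl.
have [b [nOb bP]] := maximal_ideal_inverse l0 Pmax.
have w_pos x : prime_ideal v x -> x != 0 -> 0 < w x.
  by move=> /vw[_ [->|[]//]]; rewrite eqxx.
have w_unit x : O x -> ~ prime_ideal v x -> w x = 0.
  move=> Ox nvx; have [c Oc Pc] := mo_max Pmax Ox nvx.
  have nwx : ~ prime_ideal w x.
    move=> wx; have [k pk wk] := prime_below w.
    have Wmax := prime_ideal_maximal pk wk; apply: (mo_1 Wmax).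
    by rewrite -(subrK (c * x) 1); apply: (mo_D Wmax); [apply: vw|apply: (mo_M Wmax)].
  by have [] := prime_idealPn Ox nwx.
have v_pos x : prime_ideal v x -> x != 0 -> 0 < v x.
  by move=> [_ [->|[]//]]; rewrite eqxx.
have v_unit x : O x -> ~ prime_ideal v x -> v x = 0.
  by move=> Ox nvx; have [] := prime_idealPn Ox nvx.
apply: finite_prime_inj => x; have [->|x0] := eqVneq x 0; first by rewrite !nu0.
have [m [s [t [Os nPs Ot nPt ->]]]] := inverse_decomp nOb bP x0.
rewrite (nu_decomp l0 Pmax nOb bP v_unit v_pos) //.
by rewrite (nu_decomp l0 Pmax nOb bP w_unit w_pos).
Qed.

(** By [odd_exponent] some odd power [m] of the prime of [v] is principal. A
    generator [t] of it has valuation [m] at [v] and 0 elsewhere. *)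
Lemma prescribed_valuation (S : set (finite_prime F)) v : finite_set S ->
  (forall c : mod2 (class_group_S S), c = 0) -> S v ->
  exists t : F, [/\ t != 0, forall m : int, v t <> m *+ 2 &
    forall w, w <> v -> w t = 0].
Proof.
move=> finS hCl Sv.
have [l pl vl] := prime_below v; have l0 := prime_gt0 pl.
have Pmax := prime_ideal_maximal pl vl.
have [b [nOb bP]] := maximal_ideal_inverse l0 Pmax.
have [a Pa nPba] := inverse_uniformizer l0 Pmax nOb.
have inv : exists2 J, O_submodule J & ideal_prod (prime_ideal v) J = O.
  exists (ideal_colon (prime_ideal v)); first exact: ideal_colon_submodule.
  exact: maximal_invertible Pmax bP Pa nPba.
pose I := FractionalIdeal (maximal_O_submodule Pmax) inv.
have finX : finite_set [set c : class_group F | exists v0 (I0 : fractional_ideal F),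
    [/\ S v0, fi_val I0 = prime_ideal v0 & c = \pi_(class_group F)%qT I0]]%classic.
  pose cl (v0 : finite_prime F) : class_group F := xget 0 [set c | exists2 I0 : fractional_ideal F,
    fi_val I0 = prime_ideal v0 & c = \pi_(class_group F)%qT I0]%classic.
  apply: sub_finite_set (finite_image cl finS) => c [v0 [I0 [Sv0 e0 ->]]].
  exists v0 => //; rewrite /cl; case: xgetP => [c' _ [I1 e1 ->]|/(_ (\pi_(class_group F)%qT I0))].
    by congr (\pi_(class_group F)%qT _); apply: fi_inj; rewrite e0 e1.
  by case; exists I0.
have [m oddm killm] := odd_exponent finX hCl.
have pIm : I *+ m \in @principal F.
  by rewrite -quot_eq0 raddfMn /= killm //; exists v, I.
have {pIm} /asboolP[t t0 eIm] := pIm.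
have powI x k : prime_ideal v x -> fi_val (I *+ k) (x ^+ k).
  move=> Px; elim: k => [|k IH]; first by rewrite expr0; apply: O_1.
  by rewrite exprS mulrS; apply: ideal_prod_mem.
have Ipow y k : fi_val (I *+ k) y -> O y /\ O (b ^+ k * y).
  elim: k y => [|k IH] y; first by rewrite expr0 mul1r.
  have O0 : O 0 := @O_int F 0.
  rewrite mulrS; move: y.
  apply: (@ideal_prod_min _ _ _ [set y | O y /\ O (b ^+ k.+1 * y)]%classic).
    split=> [|x y [Ox bx] [Oy by_]|c x Oc [Ox bx]] /=.
    - by rewrite mulr0.
    - by rewrite mulrDr; split; apply: O_add.
    - by rewrite mulrCA; split; apply: O_mul.
  move=> x y Px /IH[Oy by_]; split; first by apply: O_mul => //; apply: (mo_sub Pmax).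
  have -> : b ^+ k.+1 * (x * y) = (b * x) * (b ^+ k * y) by rewrite exprS; ring.
  by apply: O_mul => //; apply: bP.
have It : fi_val (I *+ m) t by rewrite eIm; exists 1; [exact: O_1|rewrite mulr1].
have [Ot Obt] := Ipow t m It.
have vb : v b = -1.
  apply: (nu_inverse l0 Pmax nOb bP) => [x Ox nvx|x].
    by have [] := prime_idealPn Ox nvx.
  by move=> [_ [->|[]//]]; rewrite eqxx.
have b0 : b != 0 by apply: contra_notN nOb => /eqP->; exact: (@O_int F 0).
have vt : v t = m.
  have [c Oc ac] : [set t * c | c in O]%classic (a ^+ m) by rewrite -eIm; apply: powI.
  have nP : ~ prime_ideal v (b ^+ m * t).
    move=> Pbt; apply: (mo_exp (n := m) Pmax (bP a Pa) nPba).
    by rewrite exprMn -ac mulrA mulrC; apply: (mo_M Pmax).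
  have [_] := prime_idealPn Obt nP.
  rewrite nuM ?expf_neq0 // nuX // vb => /eqP; rewrite addrC addr_eq0 => /eqP ->.
  by rewrite mulNrn opprK natz.
exists t; split => // [k|w wv].
  by rewrite vt => /(congr1 absz); rewrite /= => e; move: oddm; rewrite e; lia.
have [x Px nPx] : exists2 x, prime_ideal v x & ~ prime_ideal w x.
  apply: contrapT => nx; apply: wv; apply/esym/prime_ideal_inj => x Px.
  by apply: contrapT => nPx; apply: nx; exists x.
have [x0 wx] := prime_idealPn (mo_sub Pmax Px) nPx.
have [c Oc xc] : [set t * c | c in O]%classic (x ^+ m) by rewrite -eIm; apply: powI.
have c0 : c != 0.
  by apply: contra_neq (expf_neq0 m x0) => c0; rewrite -xc c0 mulr0.
have := congr1 w xc; rewrite nuM // nuX // wx mul0rn.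
have := O_valuation w Ot; have := O_valuation w Oc.
rewrite !valuation_ringE (negPf t0) (negPf c0) /=; lia.
Qed.

End PrescribedValuations.

(** * Linear independence of the classes *)

Section ChoosingAPrime.
Variable F : fieldExtType rat.
Implicit Types v w : finite_prime F.

(** It is a quotient of the valuation ring modulo a prime number, which is finite
    by [quotient_finite]. *)
Lemma residue_field_finite v : finite_set [set: residue_field v]%classic.
Proof.
have [l pl vl] := prime_below v; have l0 := prime_gt0 pl.
have l0F : l%:R != 0 :> F by rewrite -[l%:R]/(l%:Z%:~R) intF_eq0; lia.
have [|||rs [Vrs rsP]] :=
  @quotient_finite F [set x | x \in in_valuation_ring v]%classic _ _ _ l l0.
- exact: rpred1.
- by move=> x y Vx Vy; apply: rpredB.
- by move=> x y Vx Vy; apply: rpredM.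
pose red x : residue_field v :=
  if insub x is Some a then \pi_(residue_field v)%qT (a : valuation_ring v) else 0.
apply: sub_finite_set (finite_image red (finite_seq rs)) => c _.
elim/quotW: c => a; have [r rs_r /= Vr] := rsP (val a) (vringP a); exists r => //.
have Vr' := Vrs r rs_r.
rewrite /red (insubT (fun x => x \in in_valuation_ring v) Vr') /=.
apply/eqP; rewrite -subr_eq0 -raddfB /= pi_eq0 raddfB /=.
rewrite -[r - _]opprB oppr_eq0 nuN.
have [//|ar0] /= := eqVneq (val a - r) 0.
rewrite -(divfK l0F (val a - r)) nuM ?mulf_neq0 ?invr_eq0 //.
move: Vr; rewrite valuation_ringE mulf_eq0 invr_eq0 (negPf ar0) (negPf l0F) /= => ?.
exact: ltr_wpDl.
Qed.

Lemma prime_below_unique w (l l' : nat) : prime l -> prime l' ->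
  0 < w l%:R -> 0 < w l'%:R -> l = l'.
Proof.
move=> pl pl' wl wl'; have Pmax := prime_ideal_maximal pl wl.
have Pmax' := prime_ideal_maximal pl' wl'.
apply/eqP; rewrite -dvdn_prime2 //; apply: contrapT => /negP.
rewrite -prime_coprime // => /(coprimezP l%:Z l'%:Z)[[a b] /= ab].
apply: (mo_1 Pmax); have -> : 1 = a%:~R * l%:R + b%:~R * l'%:R :> F.
  by rewrite -[LHS]/((1 : int)%:~R) -ab intrD !intrM.
by apply: (mo_D Pmax); [have := mo_l Pmax|have := mo_l Pmax'];
  apply: (mo_M Pmax); apply: O_int.
Qed.

Lemma exists_prime_outside (S : set (finite_prime F)) : finite_set S ->
  exists w (l : nat), [/\ ~ S w, prime l, (3 < l)%N & 0 < w l%:R].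
Proof.
move=> /finite_seqP[s sS].
have /choice[below belowP] (v : finite_prime F) : exists l, prime l /\ 0 < v l%:R.
  by have [l] := prime_below v; exists l.
have [l lbig pl] := prime_above (3 + \max_(v <- s) below v)%N.
have [w wl] := exists_valuation_over F pl.
exists w, l; split => //; last by lia.
rewrite sS /= => ws; have [pb wb] := belowP w.
have := leq_bigmax_seq (P := xpredT) (F := below) w ws isT.
by rewrite (prime_below_unique pb pl wb wl); lia.
Qed.

End ChoosingAPrime.

Section SIntegerMatrices.
Variables (F : fieldExtType rat) (S : set (finite_prime F)).

Lemma S_integral_unit (t : F) : t != 0 -> (forall w, ~ S w -> w t = 0) ->
  exists (s s' : S_integers S), [/\ val s = t, val s' = t^-1 & s * s' = 1].
Proof.
move=> t0 wt.
have It : t \in @S_integral F S.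
  by apply/asboolP; right; split=> // w Sw; rewrite wt.
have It' : t^-1 \in @S_integral F S.
  by apply/asboolP; right; rewrite invr_eq0; split=> // w Sw; rewrite nuV // wt // oppr0.
exists (SInteger It), (SInteger It'); split=> //.
by apply: val_inj; rewrite rmorphM rmorph1 /= divff.
Qed.

Section Twist.
Variables (u : F) (u0 : u != 0).

Lemma twist_subproof (A : special_linear 2 (S_integers S)) :
  \det (mat2 (val (val A 0 0)) (val (val A 0 1) / u) (val (val A 1 0) * u)
    (val (val A 1 1))) == 1.
Proof.
rewrite det_mx2 !mat2E; apply/eqP.
have /(congr1 val) := sl2_det A; rewrite rmorphB !rmorphM rmorph1 /= => <-.
by field.
Qed.

(** The conjugate of [A] by the inverse of the diagonal matrix with entries [u] and
    1, which takes [tri t] to [tri (t / u)]. *)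
Definition twist A : special_linear 2 F := SpecialLinear (twist_subproof A).

Lemma twistM : {morph twist : A B / (A * B)%g}.
Proof.
move=> A B; apply: val_inj; rewrite /= mulmx_mat2 !mulmx2E.
have valD (x y : S_integers S) : sint_val (x + y) = sint_val x + sint_val y.
  by exact: (rmorphD (val : S_integers S -> F)).
have valM (x y : S_integers S) : sint_val (x * y) = sint_val x * sint_val y.
  by exact: (rmorphM (val : S_integers S -> F)).
by congr mat2; rewrite valD !valM; field.
Qed.

Lemma twist_tri (s s' : S_integers S) (ss' : s * s' = 1)
    (t0 : val s / u != 0) : twist (tri ss') = tri (divff t0).
Proof.
have /(congr1 val) := ss'; rewrite rmorphM rmorph1 /= => vss'.
have valN (x : S_integers S) : sint_val (- x) = - sint_val x.
  by exact: (rmorphN (val : S_integers S -> F)).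
apply: val_inj; rewrite /= !mat2E !valN; congr mat2; first by rewrite mulNr.
have s0 : val s != 0 by move: t0; rewrite mulf_eq0 negb_or => /andP[].
by apply: (mulfI s0); rewrite mulrA vss' mul1r invfM invrK mulrA divff ?mul1r.
Qed.

End Twist.
End SIntegerMatrices.

Lemma S_integers_reduction (F : fieldExtType rat) (S : set (finite_prime F)) w :
  ~ S w -> exists (k : finFieldType) (f : {rmorphism S_integers S -> k}),
    forall m : nat, 0 < w m%:R -> f m%:R = 0.
Proof.
move=> nSw.
have [k [red [_ redD redM red1 [red_eq0 _]]]] := reduction_map (residue_field_finite w).
have V (x : S_integers S) : val x \in in_valuation_ring w.
  rewrite valuation_ringE; have /asboolP[x0|[_ wx]] := sintP x; first by rewrite [val x]x0 eqxx.
  by rewrite wx ?orbT.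
pose f (x : S_integers S) := red (val x).
have red0 : red 0 = 0 by apply/eqP; rewrite red_eq0 ?valuation_ringE eqxx.
have fB : {morph f : x y / x - y}.
  move=> x y; rewrite /f rmorphB /=; apply/eqP.
  by rewrite eq_sym subr_eq -redD ?rpredB ?V ?subrK.
have f1 : f 1 = 1 by rewrite /f rmorph1.
have fM : {morph f : x y / x * y}.
  by move=> a b; rewrite /f rmorphM redM ?V.
pose Ma := GRing.isZmodMorphism.Build (S_integers S) k f fB.
pose Mm := GRing.isMonoidMorphism.Build (S_integers S) k f (f1, fM).
pose f' : {rmorphism S_integers S -> k} := HB.pack f Ma Mm.
exists k, f' => m wm; have vm : val (m%:R : S_integers S) = m%:R by apply: rmorph_nat.
by apply/eqP; rewrite -[f' _]/(red (val (m%:R : S_integers S))) red_eq0 ?V // vm wm orbT.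
Qed.

Lemma third2_mulrn_eq0 n (c : 'F_3) : (3 %| n.+2)%N ->
  third n *+ 2 *+ c = 0 -> c = 0.
Proof.
move=> three; have nz := third2_neq0 three; have th3 := third3 three.
case: c => [[|[|[|//]]] lt_c] /= e; first exact: val_inj.
  by move: nz; rewrite -e mulr1n eqxx.
by move: nz; rewrite -mulrnA (_ : third n *+ (2 * 2) = third n) in e *;
  [rewrite e mul0rn eqxx|rewrite mulrSr th3 add0r].
Qed.

Theorem corollary5p8 (F : fieldExtType rat)
  (hF : ~ exists z : F, (3.-primitive_root z)%R)
  (S : set (finite_prime F)) (finS : finite_set S)
  (hCl : forall c : mod2 (class_group_S S), c = 0%R) :
  rank3_ge (group_homology (special_linear 2 (S_integers S)) 3) (1 + r_of S).
Proof.
rewrite /r_of; set T := [set v | _]%classic; set s := fset_set T.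
have finT : finite_set T by apply: sub_finite_set finS => v [].
have sP v : v \in s -> T v by rewrite in_fset_set ?inE.
pose v : 'I_(size s) -> finite_prime F := tnth (in_tuple s).
have vT j : T (v j) by apply: sP; apply: mem_tnth.
have v_inj : injective v by apply/tuple_uniqP/fset_uniq.
pose order3_lift (t : F) (A : special_linear 2 (S_integers S)) :=
  (A * (A * A) = 1)%g /\ forall u (u0 : u != 0) (t0 : t / u != 0),
  twist u0 A = tri (divff t0).
have unit_lift t : t != 0 -> (forall w, ~ S w -> w t = 0) -> exists A, order3_lift t A.
  move=> t0 wt; have [x [x' [vx _ xx']]] := S_integral_unit t0 wt.
  by exists (tri xx'); split; [exact: tri3|rewrite -vx => u u0 tu0; apply: twist_tri].
have /choice[tA tAP] j : exists p : F * special_linear 2 (S_integers S),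
    [/\ p.1 != 0, forall m : int, v j p.1 <> m *+ 2,
      forall w, w <> v j -> w p.1 = 0 & order3_lift p.1 p.2].
  have [Sv _] := vT j; have [t [t0 odd_t off_t]] := prescribed_valuation finS hCl Sv.
  have [|A At] := unit_lift t t0; last by exists (t, A).
  by move=> w nSw; apply: off_t => wv; apply: nSw; rewrite wv.
pose a (i : 'I_(size s).+1) : special_linear 2 (S_integers S) :=
  if unlift ord0 i is Some j then (tA j).2 else tri (mulr1 1).
have aS j : a (fintype.lift ord0 j) = (tA j).2 by rewrite /a liftK.
have a0 : a ord0 = tri (mulr1 1) by rewrite /a unlift_none.
have a3 i : (a i * (a i * a i) = 1)%g.
  by rewrite /a; case: unliftP => [j _|_]; [have [_ _ _ []] := tAP j|apply: tri3].
apply: (dim_ge_indep (b := fun i => Torsion3 (order3_class_tors (a3 i)))) => c sum0.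
have rel n (phi : {additive group_homology (special_linear 2 (S_integers S)) 3 -> 'I_n.+2}) :
    \sum_i phi (order3_class (a3 i)) *+ c i = 0.
  have phi0 : phi (val (0 : torsion3 _)) = 0 by rewrite !raddf0.
  by rewrite -[RHS]phi0 -sum0 !raddf_sum; apply: eq_bigr => i _; rewrite !raddfMn.
(* the functional of [v j], twisted by [t_j], sees the class of index [j] only *)
have cS j : c (fintype.lift ord0 j) = 0.
  have [_ vj] := vT j.
  have [tj0 odd_t _ _] := tAP j.
  have [n [phi [three phiP]]] :=
    @inert_functional F (v j) (special_linear 2 (S_integers S)) (twist tj0) vj (twistM tj0).
  have := rel n phi.
  have off i t : t / (tA j).1 != 0 -> v j t = 0 -> order3_lift t (a i) ->
      phi (order3_class (a3 i)) = 0.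
    move=> t0 vt [_ tw]; have [-> //] := phiP _ t0 _ (a3 i) (tw _ _ _) => m.
    have t00 : t != 0 by move: t0; rewrite mulf_eq0 negb_or => /andP[].
    rewrite nuM ?invr_eq0 // nuV // vt add0r => /(congr1 -%R).
    by rewrite opprK -mulNrn; apply: odd_t.
  rewrite big_ord_recl (off ord0 1) ?mul0rn ?add0r ?nu1 ?mul1r ?invr_eq0 //; last first.
    rewrite a0; split; first exact: tri3.
    by move=> u u0 t0; rewrite (twist_tri u0 (s := 1) (s' := 1)) ?rmorph1.
  rewrite (bigD1 j) //= big1 ?addr0 => [|i ij]; last first.
    have [ti0 _ ti_off ti_tw] := tAP i.
    rewrite (off _ (tA i).1) ?mul0rn ?aS ?mulf_neq0 ?invr_eq0 //.
    by apply: ti_off => /v_inj/eqP; rewrite eq_sym (negPf ij).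
  have t1 : (tA j).1 / (tA j).1 != 0 by rewrite divff ?oner_eq0.
  have [_ _ _ [_ tw]] := tAP j.
  have [_ value] := phiP _ t1 _ (a3 (fintype.lift ord0 j))
    (etrans (congr1 _ (aS j)) (tw _ tj0 t1)).
  rewrite (value 1 (oner_neq0 _)) ?divff ?nu1 ?mul0rn //.
  exact: third2_mulrn_eq0.
(* with only the class of the matrix [tri 1] left, any functional that sees it
   will do *)
have [w [l [nSw pl l3 wl]]] := exists_prime_outside finS.
have [k [f fl0]] := S_integers_reduction nSw.
have [E [f' [z z3]]] := cube_root_extension k.
have E3 : 3%:R != 0 :> E.
  have /(coprimezP 3%:Z l%:Z)[[x y] /= xy] : coprime 3 l.
    by rewrite prime_coprime // dvdn_prime2 //; lia.
  have : (x%:~R * 3%:R + y%:~R * (f' (f l%:R))) = 1 :> E.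
    by rewrite !rmorph_nat -[RHS]/((1 : int)%:~R) -xy intrD !intrM.
  rewrite fl0 // rmorph0 mulr0 addr0 => e.
  by apply: contra_eq_neq e => ->; rewrite mulr0 eq_sym oner_eq0.
have [n [phi [phi_base three]]] := finite_field_detect (f' \o f) z3 E3.
move=> i; have [j ->|->] := unliftP ord0 i; first exact: cS.
have := rel n phi; rewrite big_ord_recl big1 ?addr0 => [|j _]; last by rewrite cS mulr0n.
have -> : order3_class (a3 ord0) = order3_class (tri3 (mulr1 1)).
  by move: (a3 ord0); rewrite a0 => a03; rewrite (Prop_irrelevance a03 (tri3 (mulr1 1))).
by rewrite phi_base; apply: third2_mulrn_eq0.
Qed.
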